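(* Let $n\ge1$ and $\sigma\in[0,2]$. Assume $(|D|^2u_0,u_1,\theta_0)\in L^2(\mathbb{R}^n)\times L^2(\mathbb{R}^n)\times L^2(\mathbb{R}^n)$. Then there exists a uniquely determined solution to the Cauchy problem (P), which satisfies $$u\in\mathcal{C}\left([0,\infty),\dot H^2(\mathbb{R}^n)\right),\qquad u_t\in\mathcal{C}\left([0,\infty),L^2(\mathbb{R}^n)\right),\qquad \theta\in\mathcal{C}\left([0,\infty),L^2(\mathbb{R}^n)\right).$$
   Context: Cauchy problem (P): for unknown functions $u=u(t,x)$, $\theta=\theta(t,x)$, $$u_{tt}+\Delta^2u+\Delta\theta+(-\Delta)^{\sigma}u_t=0,\qquad \theta_t-\Delta\theta-\Delta u_t=0,\qquad t>0,\ x\in\mathbb{R}^n,$$ with $(u,u_t,\theta)(0,x)=(u_0,u_1,\theta_0)(x)$. $|D|^s$ is the pseudo-differential operator with symbol $|\xi|^s$, $(-\Delta)^\sigma$ has symbol $|\xi|^{2\sigma}$, and $\|f\|_{\dot H^2}=\||D|^2f\|_{L^2}$. The partial Fourier transform $w^{(0)}(t,\xi)$ in $x$ of $(u_t+|D|^2u,u_t-|D|^2u,\theta)^{\mathrm T}$ solves $w^{(0)}_t+(|\xi|^2A_0+|\xi|^{2\sigma}A_1)w^{(0)}=0$ with initial value $(\hat u_1+|\xi|^2\hat u_0,\hat u_1-|\xi|^2\hat u_0,\hat\theta_0)^{\mathrm T}$, where $$A_0=\tfrac12\begin{pmatrix}0&-2&-2\\2&0&-2\\1&1&2\end{pmatrix},\qquad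 A_1=\tfrac12\begin{pmatrix}1&1&0\\1&1&0\\0&0&0\end{pmatrix}.$$ *)

(* Defs.v *)
From HB Require Import structures.
From mathcomp Require Import all_boot all_order all_algebra.
From mathcomp Require Import all_classical all_reals all_analysis.
From mathcomp.real_closed Require Import complex.

Set Implicit Arguments.
Unset Strict Implicit.
Unset Printing Implicit Defensive.

Import Order.TTheory GRing.Theory Num.Theory.
Import numFieldNormedType.Exports.
Import ComplexField.Normc.
Local Open Scope classical_set_scope.
Local Open Scope ring_scope.
Local Open Scope complex_scope.

(* Points of R^n are row vectors 'rV[R]_n.  The library has no measure there,
   but it has the Borel structure on n.-tuple R: the Lebesgue measure is built
   on tuples, as an iterated product, and integrals are transported by [point]. *)

Section leb_succ.
Context {R : realType} (n : nat).
Variable mu : {sigma_finite_measure set (n.-tuple R) -> \bar R}.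

Definition consR (p : measurableTypeR R * n.-tuple R) : n.+1.-tuple R :=
  [the n.+1.-tuple R of p.1 :: p.2].

Lemma measurable_consR : measurable_fun setT consR.
Proof. exact: (measurable_cons measurable_fst measurable_snd). Qed.

Definition leb_succ : set (n.+1.-tuple R) -> \bar R :=
  pushforward ((@lebesgue_measure R) \x mu)%E consR.

Let leb_succ0 : leb_succ set0 = 0%E.
Proof. by rewrite /leb_succ /pushforward preimage_set0 measure0. Qed.

Let leb_succ_ge0 A : (0 <= leb_succ A)%E.
Proof. by rewrite /leb_succ /pushforward measure_ge0. Qed.

Let leb_succ_sigma_additive : semi_sigma_additive leb_succ.
Proof.
by apply: measure_semi_sigma_additive => /=; exact: measurable_consR.
Qed.

HB.instance Definition _ := isMeasure.Build _ _ _ leb_succ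
  leb_succ0 leb_succ_ge0 leb_succ_sigma_additive.

Let leb_succ_sigma_finite : sigma_finite setT leb_succ.
Proof.
have /sigma_finiteP[F [FT ndF mF]] := sigma_finiteT (@lebesgue_measure R).
have /sigma_finiteP[G [GT ndG mG]] := sigma_finiteT mu.
pose g (t : n.+1.-tuple R) : measurableTypeR R * n.-tuple R :=
  (thead t, [tuple of behead t]).
have Kg : cancel consR g.
  by move=> [x t]; rewrite /g /consR /=; congr (_, _); apply/val_inj.
have mg : measurable_fun setT g.
  apply: measurable_fun_pair; last exact: measurable_behead.
  exact: (measurable_tnth ord0).
exists (fun k => g @^-1` (F k `*` G k)).
  apply/seteqP; split=> // t _.
  have : setT (thead t) by [].
  rewrite FT => -[k _ Fk].
  have : setT [tuple of behead t] by [].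
  rewrite GT => -[l _ Gl].
  exists (maxn k l) => //; split => /=.
    by move: Fk; exact/subsetPset/ndF/leq_maxl.
  by move: Gl; exact/subsetPset/ndG/leq_maxr.
move=> k; have [mFk Fkoo] := mF k; have [mGk Gkoo] := mG k; split.
  by rewrite -[X in measurable X]setTI; apply: mg => //; exact: measurableX.
rewrite /leb_succ /pushforward -comp_preimage.
rewrite (_ : g \o consR = id); last by apply/funext => p /=; rewrite Kg.
by rewrite preimage_id product_measure1E// lte_mul_pinfty// ge0_fin_numE.
Qed.

HB.instance Definition _ := Measure_isSigmaFinite.Build _ _ _ leb_succ
  leb_succ_sigma_finite.

End leb_succ.

Fixpoint leb (R : realType) (n : nat) :
    {sigma_finite_measure set (n.-tuple R) -> \bar R} :=
  match n with
  | 0 => [the {sigma_finite_measure set (0.-tuple R) -> \bar R} of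
            dirac [tuple]]
  | m.+1 => [the {sigma_finite_measure set (m.+1.-tuple R) -> \bar R} of
               leb_succ (leb R m)]
  end.

Section Rn.
Context {R : realType} {n : nat}.
Local Notation C := R[i].
Local Notation E := 'rV[R]_n.
Implicit Types (f g : E -> C) (x xi : E).

Definition point (t : n.-tuple R) : E := \row_i tnth t i.

Definition dot x xi : R := \sum_(i < n) x 0 i * xi 0 i.

Definition enorm x : R := Num.sqrt (dot x x).

Definition cintegrable f : Prop :=
  (leb R n).-integrable setT (fun t => (complex.Re (f (point t)))%:E) /\
  (leb R n).-integrable setT (fun t => (complex.Im (f (point t)))%:E).

Definition cint f : C :=
  (\int[leb R n]_t complex.Re (f (point t))) +i*
  (\int[leb R n]_t complex.Im (f (point t))).

Definition L2 f : Prop :=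
  (fun t => complex.Re (f (point t))) \in Lfun (leb R n) 2%:E /\
  (fun t => complex.Im (f (point t))) \in Lfun (leb R n) 2%:E.

Definition L2norm f : \bar R :=
  Lnorm (leb R n) 2%:E (fun t => (normc (f (point t)))%:E).

Definition cderivable f x (v : E) : Prop :=
  derivable (fun y => complex.Re (f y)) x v /\
  derivable (fun y => complex.Im (f y)) x v.

Definition partial (i : 'I_n) f : E -> C := fun x =>
  ('D_(delta_mx 0 i) (fun y => complex.Re (f y)) x) +i*
  ('D_(delta_mx 0 i) (fun y => complex.Im (f y)) x).

Definition partials (s : seq 'I_n) f : E -> C := foldr partial f s.

Definition laplacian f : E -> C := fun x =>
  \sum_(i < n) partial i (partial i f) x.

(* All iterated partial derivatives exist; being bounded, they are also
   continuous, so that such an f is automatically of class C^oo. *)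
Definition schwartz f : Prop :=
  (forall (s : seq 'I_n) (i : 'I_n) x, cderivable (partials s f) x (delta_mx 0 i)) /\
  (forall (s : seq 'I_n) (k : nat), exists M : R, forall x,
     (1 + enorm x) ^+ k * normc (partials s f x) <= M).

Definition fourier f : E -> C := fun xi =>
  cint (fun x => (cos (dot x xi) -i* sin (dot x xi)) * f x).

(* Only the values of a distribution at Schwartz functions are meaningful. *)
Definition distr : Type := (E -> C) -> C.
Implicit Types T S : distr.

Definition eqd T S : Prop := forall phi, schwartz phi -> T phi = S phi.

Definition tempered T : Prop :=
  (forall (a : C) phi psi, schwartz phi -> schwartz psi ->
     T (fun x => a * phi x + psi x) = a * T phi + T psi) /\
  (exists (N : nat) (M : R), forall phi (B : R), schwartz phi ->
     (forall (s : seq 'I_n) x, (size s <= N)%N ->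
        (1 + enorm x) ^+ N * normc (partials s phi x) <= B) ->
     normc (T phi) <= M * B).

Definition distr_of f : distr := fun phi => cint (fun x => f x * phi x).

Definition represents f T : Prop :=
  [/\ measurable_fun setT (fun t => complex.Re (f (point t))),
      measurable_fun setT (fun t => complex.Im (f (point t))),
      forall phi, schwartz phi -> cintegrable (fun x => f x * phi x) &
      eqd T (distr_of f)].

Definition inL2 T : Prop := exists2 f, L2 f & eqd T (distr_of f).

Definition dlaplacian T : distr := fun phi => T (laplacian phi).

Definition dfourier T : distr := fun phi => T (fourier phi).

(* [S = m(D) T], i.e. S^ = m T^.  The product m T^ makes sense in two cases:
   when m is a multiplier of the Schwartz space, or when T^ is a function. *)
Definition is_multiplier (m : E -> R) T S : Prop :=
  ((forall phi, schwartz phi -> schwartz (fun xi => (m xi)%:C * phi xi)) /\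
   (forall phi, schwartz phi ->
      dfourier S phi = dfourier T (fun xi => (m xi)%:C * phi xi))) \/
  (exists2 g, represents g (dfourier T) &
     represents (fun xi => (m xi)%:C * g xi) (dfourier S)).

(* |D|^s has symbol |xi|^s; note that 0 `^ 0 = 1. *)
Definition is_absD (s : R) T S : Prop :=
  is_multiplier (fun xi => enorm xi `^ s) T S.

(* (-Delta)^sigma *)
Definition is_fracLap (sigma : R) T S : Prop :=
  is_multiplier (fun xi => enorm xi `^ (2 * sigma)) T S.

Definition halfline : set R := [set s | 0 <= s].

Definition is_tderiv (u : R -> distr) (t : R) S : Prop :=
  forall phi, schwartz phi ->
    normc ((s - t)^-1%:C * (u s phi - u t phi) - S phi)
      @[s --> within halfline t^'] --> (0 : R).

Definition C_L2 (u : R -> distr) : Prop :=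
  exists2 f : R -> E -> C,
    (forall t : R, 0 <= t -> L2 (f t) /\ eqd (u t) (distr_of (f t))) &
    (forall t : R, 0 <= t ->
       L2norm (fun x => f s x - f t x) @[s --> within halfline (nbhs t)]
         --> (0%E : \bar R)).

Definition C_H2dot (u : R -> distr) : Prop :=
  exists2 z : R -> distr,
    (forall t : R, 0 <= t -> is_absD 2 (u t) (z t)) & C_L2 z.

Definition solves_P (sigma : R) (u0 u1 theta0 : distr)
    (u ut theta : R -> distr) : Prop :=
  [/\ forall t : R, 0 <= t -> [/\ tempered (u t), tempered (ut t) & tempered (theta t)],
      forall t : R, 0 <= t -> is_tderiv u t (ut t),
      forall t : R, 0 < t -> exists utt thetat w : distr,
        [/\ is_tderiv ut t utt, is_tderiv theta t thetat,
            is_fracLap sigma (ut t) w,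
            forall phi, schwartz phi ->
              utt phi + dlaplacian (dlaplacian (u t)) phi
                + dlaplacian (theta t) phi + w phi = 0 &
            forall phi, schwartz phi ->
              thetat phi - dlaplacian (theta t) phi
                - dlaplacian (ut t) phi = 0] &
      [/\ eqd (u 0) u0, eqd (ut 0) u1 & eqd (theta 0) theta0]].

End Rn.

Arguments distr R n : clear implicits.

(* Main.v *)
(* At each frequency xi the system is a linear ODE for the transforms of
   (|D|^2 u, u_t, theta) whose Hermitian part is nonnegative, so its flow is a
   contraction uniformly in xi.  Applied pointwise to L^2 data it produces
   (|D|^2 u, u_t, theta), and dominated convergence gives continuity in L^2.
   Only |xi|^2 times the transform of u0 is a function, so u itself is built
   from its increment u - u0, the time integral of u_t.

   For uniqueness, test the difference of two solutions against the transform
   of psi = h(|xi|^2) phi, with h smooth and supported in a compact part of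
   (0, oo).  The symbols |xi|^2 and |xi|^(2 sigma) preserve such Schwartz
   functions and act boundedly on them in L^2, so the tested difference solves
   a linear ODE with bounded coefficients and vanishes.  These psi are dense in
   L^2 because the origin is a null set (n >= 1), whence u_t and theta are
   unique; u is then recovered from u0 and u_t. *)

From HB Require Import structures.
From mathcomp Require Import all_boot all_order all_algebra.
From mathcomp Require Import all_classical all_reals all_analysis.
From mathcomp Require Import measurable_realfun.
From mathcomp.real_closed Require Import complex.
From mathcomp Require Import ring lra.
Require Import Defs.

Set Implicit Arguments.
Unset Strict Implicit.
Unset Printing Implicit Defensive.

Import Order.TTheory GRing.Theory Num.Theory.
Import numFieldNormedType.Exports.
Import ComplexField.Normc.
Local Open Scope classical_set_scope.
Local Open Scope ring_scope.
Local Open Scope complex_scope.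

(** * Complex-valued integrals *)

Section complex_facts.
Context {R : realType}.
Implicit Types x y : R[i].

(** Distributions are functionals on Schwartz functions, so functions have to be recovered from
    pairings: a functional bounded in L2 is represented by minimising a quadratic functional over
    Schwartz functions, which rests on the completeness of L2. Plancherel, a consequence of
    inversion by Gaussian regularisation, supplies the bounds. The flow at a frequency must also be
    measurable in xi; it is therefore a power series in t, whose partial sums are polynomial in the
    symbols and the data. Time derivatives are taken after pairing: the Taylor remainder at xi is
    quadratic in time, with a constant of polynomial growth in |xi| that a Schwartz function
    absorbs. For uniqueness there are two obstacles: |xi|^(2 sigma) is in general not smooth at 0,
    and the derivative of an unknown tested against psi involves other test functions, namely psi
    times a symbol. Instead of a scalar Gronwall inequality, a bound by the L2 norm of psi, uniform
    over the test functions of one annulus, is improved repeatedly. *)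

Lemma ReD x y : complex.Re (x + y) = complex.Re x + complex.Re y.
Proof. by case: x; case: y. Qed.

Lemma ImD x y : complex.Im (x + y) = complex.Im x + complex.Im y.
Proof. by case: x; case: y. Qed.

Lemma ReN x : complex.Re (- x) = - complex.Re x. Proof. by case: x. Qed.

Lemma ImN x : complex.Im (- x) = - complex.Im x. Proof. by case: x. Qed.

Lemma ReM x y : complex.Re (x * y) =
  complex.Re x * complex.Re y - complex.Im x * complex.Im y.
Proof. by case: x; case: y. Qed.

Lemma ImM x y : complex.Im (x * y) =
  complex.Re x * complex.Im y + complex.Im x * complex.Re y.
Proof. by case: x; case: y. Qed.

Lemma ReJ x : complex.Re (conjc x) = complex.Re x. Proof. by case: x. Qed.

Lemma ImJ x : complex.Im (conjc x) = - complex.Im x. Proof. by case: x. Qed.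

Definition ReImE := (ReD, ImD, ReN, ImN, ReM, ImM, ReJ, ImJ).

Lemma complex_ext x y :
  complex.Re x = complex.Re y -> complex.Im x = complex.Im y -> x = y.
Proof. by case: x y => a b [c d] /= -> ->. Qed.

Lemma normc2E x : normc x ^+ 2 = complex.Re x ^+ 2 + complex.Im x ^+ 2.
Proof. by case: x => a b /=; rewrite sqr_sqrtr// addr_ge0// sqr_ge0. Qed.

Lemma normc_ge0 x : 0 <= normc x.
Proof. by case: x => a b; exact: sqrtr_ge0. Qed.

Lemma Re_le_normc x : `|complex.Re x| <= normc x.
Proof.
by rewrite -(ler_sqr (normr_ge0 _) (normc_ge0 _)) normc2E real_normK ?num_real// lerDl sqr_ge0.
Qed.

Lemma Im_le_normc x : `|complex.Im x| <= normc x.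
Proof.
by rewrite -(ler_sqr (normr_ge0 _) (normc_ge0 _)) normc2E real_normK ?num_real// lerDr sqr_ge0.
Qed.

Lemma normc_le_ReIm x : normc x <= `|complex.Re x| + `|complex.Im x|.
Proof.
rewrite -(ler_sqr (normc_ge0 _)) ?nnegrE ?addr_ge0// normc2E sqrrD.
rewrite !real_normK ?num_real// -addrA lerD2l.
by rewrite lerDr mulrn_wge0 // mulr_ge0.
Qed.

Lemma normcJ x : normc (conjc x) = normc x.
Proof. by case: x => a b /=; rewrite sqrrN. Qed.

Lemma normcR (a : R) : normc (a%:C) = `|a|.
Proof. by rewrite /= expr0n addr0 sqrtr_sqr. Qed.

Lemma mulcJ x : x * conjc x = (normc x ^+ 2)%:C.
Proof.
apply: complex_ext; first by rewrite normc2E ReImE /=; case: x => a b /=; ring.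
by rewrite ReImE /=; case: x => a b /=; ring.
Qed.

Lemma conjcM x y : (conjc (x * y)) = conjc x * conjc y.
Proof. by apply: complex_ext; rewrite !ReImE; ring. Qed.

Lemma conjcD x y : (conjc (x + y)) = conjc x + conjc y.
Proof. by apply: complex_ext; rewrite !ReImE; ring. Qed.

Lemma conjcN x : (conjc (- x)) = - conjc x.
Proof. by apply: complex_ext; rewrite !ReImE; ring. Qed.

Lemma normcB x y : normc (x - y) = normc (y - x).
Proof. by rewrite -normcN opprB. Qed.

Lemma normc_dist_le x y : `|normc x - normc y| <= normc (x - y).
Proof.
rewrite ler_norml; apply/andP; split.
  rewrite lerBrDr addrC lerBlDr normcB -[leLHS]/(normc y).
  by rewrite -{1}[y](subrK x) (le_trans (le_normcD _ _)) // addrC.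
rewrite lerBlDr -{1}[x](subrK y); exact: le_normcD.
Qed.

Lemma normc_eq0 x : (normc x == 0) = (x == 0).
Proof. by apply/idP/idP => [/eqP/eq0_normc ->//|/eqP ->]; rewrite normc0. Qed.

End complex_facts.

Section real_integrals.
Context d (T : measurableType d) (R : realType).
Variable mu : {measure set T -> \bar R}.
Implicit Types f g h : T -> R.

Definition rint f := mu.-integrable setT (fun t => (f t)%:E).

Lemma rint_measurable f : rint f -> measurable_fun setT f.
Proof. by move=> /measurable_int /measurable_EFinP. Qed.

Lemma rint_le f g : measurable_fun setT f -> rint g ->
  (forall t, `|f t| <= g t) -> rint f.
Proof.
move=> mf ig fg; apply: (le_integrable _ _ _ ig) => //.
  exact/measurable_EFinP.
by move=> t _; rewrite /= lee_fin (le_trans (fg t))// ler_norm.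
Qed.

Lemma rintD f g : rint f -> rint g -> rint (fun t => f t + g t).
Proof. by move=> fi gi; have := integrableD measurableT fi gi. Qed.

Lemma rintZ (a : R) f : rint f -> rint (fun t => a * f t).
Proof. by move=> fi; have := integrableZl measurableT a fi. Qed.

Lemma rintB f g : rint f -> rint g -> rint (fun t => f t - g t).
Proof. by move=> fi gi; have := integrableB measurableT fi gi. Qed.

Lemma rintN f : rint f -> rint (fun t => - f t).
Proof. by move=> fi; have := integrableN fi. Qed.

Lemma rint_norm f : rint f -> rint (fun t => `|f t|).
Proof. exact: integrable_norm. Qed.

Lemma rint0 : rint (fun=> 0).
Proof. exact: integrable0. Qed.

Lemma RintD f g : rint f -> rint g ->
  \int[mu]_t (f t + g t) = \int[mu]_t f t + \int[mu]_t g t.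
Proof. exact: RintegralD. Qed.

Lemma RintB f g : rint f -> rint g ->
  \int[mu]_t (f t - g t) = \int[mu]_t f t - \int[mu]_t g t.
Proof. exact: RintegralB. Qed.

Lemma RintZ (a : R) f : rint f -> \int[mu]_t (a * f t) = a * \int[mu]_t f t.
Proof. by move=> fi; rewrite -RintegralZl. Qed.

Lemma RintN f : rint f -> \int[mu]_t (- f t) = - \int[mu]_t f t.
Proof.
move=> fi; rewrite -[RHS]mulN1r -RintZ//.
by apply: eq_Rintegral => t _; rewrite mulN1r.
Qed.

Lemma Rint0 : \int[mu]_t (0 : R) = 0.
Proof. by rewrite /Rintegral integral0. Qed.

Lemma Rint_le f g : rint f -> rint g -> (forall t, f t <= g t) ->
  \int[mu]_t f t <= \int[mu]_t g t.
Proof. by move=> fi gi fg; apply: le_Rintegral. Qed.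

Lemma Rint_ge0 f : (forall t, 0 <= f t) -> 0 <= \int[mu]_t f t.
Proof. by move=> f0; apply: Rintegral_ge0. Qed.

Lemma Rint_norm f : rint f -> `|\int[mu]_t f t| <= \int[mu]_t `|f t|.
Proof. by move=> fi; apply: le_normr_Rintegral. Qed.

Lemma Rint_EFin f : rint f -> (\int[mu]_t (f t)%:E)%E = (\int[mu]_t f t)%:E.
Proof.
by move=> fi; rewrite /Rintegral fineK//; apply: integrable_fin_num.
Qed.

Lemma rdct0_ae (h : nat -> T -> R) g : (forall k, measurable_fun setT (h k)) ->
  rint g -> (forall k t, 0 <= h k t <= g t) ->
  {ae mu, forall t, h k t @[k --> \oo] --> (0 : R)} ->
  (\int[mu]_t h k t) @[k --> \oo] --> (0 : R).
Proof.
move=> mh ig hg h0.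
have [] := @dominated_convergence _ _ _ mu setT measurableT
  (fun k t => (h k t)%:E) (fun=> 0%E) (fun t => (g t)%:E).
- by move=> k; exact/measurable_EFinP.
- exact: measurable_cst.
- apply: filterS h0 => t h0 _; apply/fine_cvgP; split; first exact: nearW.
  exact: h0.
- exact: ig.
- apply/aeW => t k _; rewrite /= lee_fin.
  by have /andP[h1 h2] := hg k t; rewrite ger0_norm.
move=> _ _; rewrite integral0 => /fine_cvgP[_].
exact.
Qed.

Lemma rdct0 (h : nat -> T -> R) g : (forall k, measurable_fun setT (h k)) ->
  rint g -> (forall k t, 0 <= h k t <= g t) ->
  (forall t, h k t @[k --> \oo] --> (0 : R)) ->
  (\int[mu]_t h k t) @[k --> \oo] --> (0 : R).
Proof. by move=> mh ig hg h0; apply: (rdct0_ae mh ig hg); exact: aeW. Qed.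

End real_integrals.

Section complex_integrals.
Context d (T : measurableType d) (R : realType).
Local Notation C := R[i].
Implicit Types f g : T -> C.

Definition cmeas f := measurable_fun setT (fun t => complex.Re (f t)) /\
  measurable_fun setT (fun t => complex.Im (f t)).

Lemma cmeas_cst (c : C) : cmeas (fun=> c).
Proof. by split; exact: measurable_cst. Qed.

Lemma cmeasD f g : cmeas f -> cmeas g -> cmeas (fun t => f t + g t).
Proof.
move=> [f1 f2] [g1 g2]; split.
  by under eq_fun do rewrite ReD; apply: measurable_funD.
by under eq_fun do rewrite ImD; apply: measurable_funD.
Qed.

Lemma cmeasM f g : cmeas f -> cmeas g -> cmeas (fun t => f t * g t).
Proof.
move=> [f1 f2] [g1 g2]; split.
  under eq_fun do rewrite ReM.
  by apply: measurable_funB; apply: measurable_funM.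
under eq_fun do rewrite ImM.
by apply: measurable_funD; apply: measurable_funM.
Qed.

Lemma cmeasN f : cmeas f -> cmeas (fun t => - f t).
Proof.
move=> [f1 f2]; split.
  by under eq_fun do rewrite ReN; apply: measurable_funN.
by under eq_fun do rewrite ImN; apply: measurable_funN.
Qed.

Lemma cmeasB f g : cmeas f -> cmeas g -> cmeas (fun t => f t - g t).
Proof. by move=> mf mg; apply: cmeasD => //; exact: cmeasN. Qed.

Lemma cmeasJ f : cmeas f -> cmeas (fun t => (conjc (f t))).
Proof.
move=> [f1 f2]; split.
  by under eq_fun do rewrite ReJ.
by under eq_fun do rewrite ImJ; apply: measurable_funN.
Qed.

Lemma cmeasR (g : T -> R) : measurable_fun setT g -> cmeas (fun t => (g t)%:C).
Proof. by move=> mg; split => //=; exact: measurable_cst. Qed.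

Lemma measurable_normc2 f : cmeas f -> measurable_fun setT (fun t => normc (f t) ^+ 2).
Proof.
move=> [f1 f2]; under eq_fun do rewrite normc2E.
by apply: measurable_funD; apply: measurable_funX.
Qed.

Lemma measurable_normc f : cmeas f -> measurable_fun setT (fun t => normc (f t)).
Proof.
move=> mf.
have -> : (fun t => normc (f t)) = Num.sqrt \o (fun t => normc (f t) ^+ 2).
  by apply/funext => t /=; rewrite sqrtr_sqr ger0_norm// normc_ge0.
apply: measurableT_comp; last exact: measurable_normc2.
by apply: continuous_measurable_fun; exact: sqrt_continuous.
Qed.

Lemma cmeas_cvg (f_ : nat -> T -> C) f : (forall k, cmeas (f_ k)) ->
  (forall t, normc (f_ k t - f t) @[k --> \oo] --> (0 : R)) -> cmeas f.
Proof.
move=> mf cf; split.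
- apply: (measurable_fun_cvg (fun k => (mf k).1)) => t _.
  apply/subr_cvg0; apply: norm_cvg0.
  apply: squeeze_cvgr (cvg_cst 0) (cf t); apply: nearW => k.
  by rewrite normr_ge0 -ReN -ReD Re_le_normc.
- apply: (measurable_fun_cvg (fun k => (mf k).2)) => t _.
  apply/subr_cvg0; apply: norm_cvg0.
  apply: squeeze_cvgr (cvg_cst 0) (cf t); apply: nearW => k.
  by rewrite normr_ge0 -ImN -ImD Im_le_normc.
Qed.

Variable mu : {measure set T -> \bar R}.

Definition cinteg f := rint mu (fun t => complex.Re (f t)) /\
  rint mu (fun t => complex.Im (f t)).

Definition cI f : C :=
  (\int[mu]_t complex.Re (f t)) +i* (\int[mu]_t complex.Im (f t)).

Lemma cinteg_meas f : cinteg f -> cmeas f.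
Proof. by move=> [/rint_measurable ? /rint_measurable ?]. Qed.

Lemma cinteg_normc f : cinteg f -> rint mu (fun t => normc (f t)).
Proof.
move=> fi; have [i1 i2] := fi.
apply: (rint_le _ (rintD (rint_norm i1) (rint_norm i2))).
  exact/measurable_normc/cinteg_meas.
by move=> t; rewrite ger0_norm ?normc_ge0// normc_le_ReIm.
Qed.

Lemma cinteg_le f (g : T -> R) : cmeas f -> rint mu g ->
  (forall t, normc (f t) <= g t) -> cinteg f.
Proof.
move=> [m1 m2] gi fg; split; apply: (rint_le _ gi) => // t.
  exact: le_trans (Re_le_normc _) (fg t).
exact: le_trans (Im_le_normc _) (fg t).
Qed.

Lemma cintegD f g : cinteg f -> cinteg g -> cinteg (fun t => f t + g t).
Proof.
move=> [f1 f2] [g1 g2]; split.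
  by under eq_fun do rewrite ReD; apply: rintD.
by under eq_fun do rewrite ImD; apply: rintD.
Qed.

Lemma cintegZ (a : C) f : cinteg f -> cinteg (fun t => a * f t).
Proof.
move=> [f1 f2]; split.
  by under eq_fun do rewrite ReM; apply: rintB; apply: rintZ.
by under eq_fun do rewrite ImM; apply: rintD; apply: rintZ.
Qed.

Lemma cintegN f : cinteg f -> cinteg (fun t => - f t).
Proof.
move=> [f1 f2]; split.
  by under eq_fun do rewrite ReN; apply: rintN.
by under eq_fun do rewrite ImN; apply: rintN.
Qed.

Lemma cintegB f g : cinteg f -> cinteg g -> cinteg (fun t => f t - g t).
Proof. by move=> fi gi; apply: cintegD => //; exact: cintegN. Qed.

Lemma cintegJ f : cinteg f -> cinteg (fun t => (conjc (f t))).
Proof.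
move=> [f1 f2]; split.
  by under eq_fun do rewrite ReJ.
by under eq_fun do rewrite ImJ; apply: rintN.
Qed.

Lemma cI0 : cI (fun=> 0) = 0.
Proof. by apply: complex_ext; rewrite /= Rint0. Qed.

Lemma cID f g : cinteg f -> cinteg g -> cI (fun t => f t + g t) = cI f + cI g.
Proof.
move=> [f1 f2] [g1 g2]; apply: complex_ext => /=.
  by under eq_Rintegral do rewrite ReD; rewrite RintD.
by under eq_Rintegral do rewrite ImD; rewrite RintD.
Qed.

Lemma cIZ (a : C) f : cinteg f -> cI (fun t => a * f t) = a * cI f.
Proof.
move=> [f1 f2]; apply: complex_ext; rewrite ?ReM ?ImM /=.
  under eq_Rintegral do rewrite ReM.
  by rewrite RintB ?RintZ//; apply: rintZ.
under eq_Rintegral do rewrite ImM.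
by rewrite RintD ?RintZ//; apply: rintZ.
Qed.

Lemma cIN f : cinteg f -> cI (fun t => - f t) = - cI f.
Proof.
move=> fi; rewrite -[RHS]mulN1r -cIZ//.
by congr cI; apply/funext => t; rewrite mulN1r.
Qed.

Lemma cIB f g : cinteg f -> cinteg g -> cI (fun t => f t - g t) = cI f - cI g.
Proof. by move=> fi gi; rewrite cID ?cIN//; exact: cintegN. Qed.

Lemma cIJ f : cinteg f -> cI (fun t => (conjc (f t))) = (conjc (cI f)).
Proof.
move=> [f1 f2]; apply: complex_ext => /=.
  by apply: eq_Rintegral => t _; rewrite ReJ.
by under eq_Rintegral do rewrite ImJ; rewrite RintN.
Qed.

Lemma eq_cI f g : f =1 g -> cI f = cI g.
Proof. by move=> /funext ->. Qed.

Lemma cI_norm f : cinteg f -> normc (cI f) <= \int[mu]_t normc (f t).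
Proof.
move=> fi; set w := cI f.
have [->|w0] := eqVneq w 0.
  by rewrite normc0; apply: Rint_ge0 => t; exact: normc_ge0.
have wp : 0 < normc w by rewrite lt_neqAle normc_ge0 eq_sym normc_eq0 w0.
rewrite -(ler_pM2l wp).
(* Rotating by [conjc w] makes the integral real and nonnegative, so that its modulus becomes the
   integral of a real part. *)
have -> : normc w * normc w = complex.Re (cI (fun t => conjc w * f t)).
  by rewrite cIZ// -/w [conjc w * w]mulrC mulcJ /= expr2.
rewrite -RintZ; last exact: cinteg_normc.
apply: Rint_le; first exact: (cintegZ _ fi).1.
  by apply: rintZ; exact: cinteg_normc.
move=> t; rewrite -(normcJ w) -normcM.
exact: le_trans (ler_norm _) (Re_le_normc _).
Qed.

Lemma cI_norm_le f (g : T -> R) : cmeas f -> rint mu g ->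
  (forall t, normc (f t) <= g t) -> normc (cI f) <= \int[mu]_t g t.
Proof.
move=> mf gi fg; have fi := cinteg_le mf gi fg.
apply: le_trans (cI_norm fi) _; apply: Rint_le => //; exact: cinteg_normc.
Qed.

Lemma cI_dct (f_ : nat -> T -> C) f (g : T -> R) :
  (forall k, cmeas (f_ k)) -> rint mu g -> (forall k t, normc (f_ k t) <= g t) ->
  (forall t, normc (f_ k t - f t) @[k --> \oo] --> (0 : R)) ->
  cinteg f /\ normc (cI (f_ k) - cI f) @[k --> \oo] --> (0 : R).
Proof.
move=> mf gi fg cf; have mF := cmeas_cvg mf cf.
have Fg t : normc (f t) <= g t.
  have h : (g t + normc (f_ k t - f t)) @[k --> \oo] --> g t.
    by rewrite -[X in _ --> X]addr0; apply: cvgD; [exact: cvg_cst|exact: cf].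
  rewrite -(cvg_lim (@Rhausdorff R) h); apply: limr_ge; first by apply/cvg_ex; eexists; exact: h.
  apply: nearW => k.
  rewrite -[f t](subrK (f_ k t)) [f t - _ + _]addrC; apply: le_trans (le_normcD _ _) _.
  by rewrite (addrC (f_ k t)) subrK lerD// normcB.
have fi := cinteg_le mF gi Fg; split => //.
have fki k := cinteg_le (mf k) gi (fg k).
have h : (\int[mu]_t normc (f_ k t - f t)) @[k --> \oo] --> (0 : R).
  apply: (rdct0 (g := fun t => 2 * g t)) => //.
  - by move=> k; apply: measurable_normc; apply: cmeasB.
  - exact: rintZ.
  - move=> k t; rewrite normc_ge0 /= mulr_natl mulr2n.
    by apply: le_trans (le_normcD _ _) _; rewrite normcN lerD.
apply: squeeze_cvgr (cvg_cst 0) h; apply: nearW => k.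
by rewrite normc_ge0 -cIB//; apply: cI_norm; exact: cintegB.
Qed.

End complex_integrals.

(** * Square-integrable functions *)

Section L2.
Context d (T : measurableType d) (R : realType).
Local Notation C := R[i].
Variable mu : {measure set T -> \bar R}.
Implicit Types f g : T -> C.

Definition sqi f := cmeas f /\ rint mu (fun t => normc (f t) ^+ 2).

Definition nrm2 f : R := \int[mu]_t (normc (f t) ^+ 2).

Lemma nrm2_ge0 f : 0 <= nrm2 f.
Proof. by apply: Rint_ge0 => t; exact: sqr_ge0. Qed.

Lemma sqi_le f (g : T -> R) : cmeas f -> rint mu g ->
  (forall t, normc (f t) ^+ 2 <= g t) -> sqi f.
Proof.
move=> mf gi fg; split => //; apply: rint_le gi _; first exact: measurable_normc2.
by move=> t; rewrite ger0_norm ?sqr_ge0.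
Qed.

Lemma normc2D (x y : C) : normc (x + y) ^+ 2 =
  normc x ^+ 2 + 2 * complex.Re (x * conjc y) + normc y ^+ 2.
Proof. by rewrite !normc2E !ReImE; ring. Qed.

Lemma normc2D_le (x y : C) :
  normc (x + y) ^+ 2 <= 2 * normc x ^+ 2 + 2 * normc y ^+ 2.
Proof.
have : 0 <= normc (x - y) ^+ 2 by exact: sqr_ge0.
by rewrite !normc2E !ReImE => h; lra.
Qed.

Lemma sqiD f g : sqi f -> sqi g -> sqi (fun t => f t + g t).
Proof.
move=> [mf fi] [mg gi].
apply: (sqi_le (cmeasD mf mg) (rintD (rintZ 2 fi) (rintZ 2 gi))) => t.
exact: normc2D_le.
Qed.

Lemma sqiZ (a : C) f : sqi f -> sqi (fun t => a * f t).
Proof.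
move=> [mf fi].
apply: (sqi_le (cmeasM (cmeas_cst _ a) mf) (rintZ (normc a ^+ 2) fi)) => t.
by rewrite normcM exprMn.
Qed.

Lemma sqiN f : sqi f -> sqi (fun t => - f t).
Proof.
move=> [mf fi]; apply: (sqi_le (cmeasN mf) fi) => t.
by rewrite normcN.
Qed.

Lemma sqiB f g : sqi f -> sqi g -> sqi (fun t => f t - g t).
Proof. by move=> sf sg; apply: sqiD => //; exact: sqiN. Qed.

Lemma sqiJ f : sqi f -> sqi (fun t => (conjc (f t))).
Proof.
move=> [mf fi]; apply: (sqi_le (cmeasJ mf) fi) => t.
by rewrite normcJ.
Qed.

Lemma sqiM_norm f g : sqi f -> sqi g -> rint mu (fun t => normc (f t) * normc (g t)).
Proof.
move=> [mf fi] [mg gi].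
apply: (rint_le _ (rintD fi gi)).
  by apply: measurable_funM; exact: measurable_normc.
move=> t; rewrite ger0_norm ?mulr_ge0 ?normc_ge0//.
have : 0 <= (normc (f t) - normc (g t)) ^+ 2 by exact: sqr_ge0.
have := mulr_ge0 (normc_ge0 (f t)) (normc_ge0 (g t)).
by rewrite sqrrB; lra.
Qed.

Lemma sqiM f g : sqi f -> sqi g -> cinteg mu (fun t => f t * g t).
Proof.
move=> sf sg; apply: (cinteg_le (cmeasM sf.1 sg.1) (sqiM_norm sf sg)) => t.
by rewrite normcM.
Qed.

Lemma nrm2Z (a : C) f : sqi f -> nrm2 (fun t => a * f t) = normc a ^+ 2 * nrm2 f.
Proof.
move=> [mf fi]; rewrite /nrm2 -RintZ//.
by apply: eq_Rintegral => t _; rewrite normcM exprMn.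
Qed.

Lemma nrm2N f : nrm2 (fun t => - f t) = nrm2 f.
Proof. by apply: eq_Rintegral => t _; rewrite normcN. Qed.

Lemma nrm2J f : nrm2 (fun t => (conjc (f t))) = nrm2 f.
Proof. by apply: eq_Rintegral => t _; rewrite normcJ. Qed.

Lemma nrm2BC f g : nrm2 (fun t => f t - g t) = nrm2 (fun t => g t - f t).
Proof. by apply: eq_Rintegral => t _; rewrite normcB. Qed.

Lemma nrm2DE f g : sqi f -> sqi g -> nrm2 (fun t => f t + g t) =
  nrm2 f + 2 * complex.Re (cI mu (fun t => f t * (conjc (g t)))) + nrm2 g.
Proof.
move=> sf sg; rewrite /nrm2.
under eq_Rintegral do rewrite normc2D.
have [i1 _] := sqiM sf (sqiJ sg).
rewrite RintD; [|by apply: rintD; [exact: sf.2|exact: rintZ]|exact: sg.2].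
by rewrite RintD; [rewrite RintZ|exact: sf.2|exact: rintZ].
Qed.

Lemma nrm2_parallelogram f g : sqi f -> sqi g ->
  nrm2 (fun t => f t + g t) + nrm2 (fun t => f t - g t) = 2 * nrm2 f + 2 * nrm2 g.
Proof.
move=> sf sg; rewrite nrm2DE// nrm2DE//; last exact: sqiN.
rewrite nrm2N.
have -> : cI mu (fun t => f t * (conjc (- g t))) = - cI mu (fun t => f t * (conjc (g t))).
  rewrite -cIN; last exact/sqiM/sqiJ.
  by apply: eq_cI => t; rewrite conjcN mulrN.
by rewrite ReN; ring.
Qed.

Lemma nrm2B_le f g : sqi f -> sqi g ->
  nrm2 (fun t => f t - g t) <= 2 * nrm2 f + 2 * nrm2 g.
Proof.
by move=> sf sg; rewrite -nrm2_parallelogram// lerDr nrm2_ge0.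
Qed.

(** The discriminant bound for a nonnegative quadratic in [s]; it yields both Cauchy-Schwarz and the
    first variation in [riesz]. *)
Lemma quad_ge0_le (A B F : R) : 0 <= A -> 0 <= B ->
  (forall s, 0 <= s ^+ 2 * A - 2 * s * F + B) -> F ^+ 2 <= A * B.
Proof.
move=> A0 B0 h; have [A0'|An0] := eqVneq A 0.
  have [->|Fn0] := eqVneq F 0; first by rewrite expr0n mulr_ge0.
  (* For [A = 0] the polynomial is affine in [s], and at this point it equals [-1]. *)
  exfalso; have := h ((B + 1) / (2 * F)).
  by rewrite A0' (_ : _ - _ + _ = - 1); [lra|field].
have Ap : 0 < A by rewrite lt_neqAle eq_sym An0.
have := h (F / A).
have -> : (F / A) ^+ 2 * A - 2 * (F / A) * F + B = (A * B - F ^+ 2) / A by field.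
by rewrite pmulr_lge0 ?invr_gt0// subr_ge0.
Qed.

Lemma cauchy_schwarz_norm f g : sqi f -> sqi g ->
  \int[mu]_t (normc (f t) * normc (g t)) <= Num.sqrt (nrm2 f) * Num.sqrt (nrm2 g).
Proof.
move=> sf sg; have fgi := sqiM_norm sf sg.
set F := (X in X <= _).
have F0 : 0 <= F by apply: Rint_ge0 => t; rewrite mulr_ge0 ?normc_ge0.
rewrite -sqrtrM ?nrm2_ge0//.
rewrite -(ger0_norm F0) -sqrtr_sqr ler_wsqrtr//.
apply: quad_ge0_le; rewrite ?nrm2_ge0// => s.
have -> : s ^+ 2 * nrm2 f - 2 * s * F + nrm2 g =
    \int[mu]_t ((s * normc (f t) - normc (g t)) ^+ 2).
  rewrite /nrm2 /F -!RintZ//; last exact: sf.2.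
  rewrite -RintB; [|by apply: rintZ; exact: sf.2|exact: rintZ].
  rewrite -RintD; [|by apply: rintB; apply: rintZ => //; exact: sf.2|exact: sg.2].
  by apply: eq_Rintegral => t _; ring.
by apply: Rint_ge0 => t; exact: sqr_ge0.
Qed.

Lemma cauchy_schwarz f g : sqi f -> sqi g ->
  normc (cI mu (fun t => f t * g t)) <= Num.sqrt (nrm2 f) * Num.sqrt (nrm2 g).
Proof.
move=> sf sg; apply: le_trans (cauchy_schwarz_norm sf sg).
apply: cI_norm_le; [exact: cmeasM sf.1 sg.1|exact: sqiM_norm|].
by move=> t; rewrite normcM.
Qed.

(* Cauchy-Schwarz with the weights [2^-j], whose tail sums are [2^(1-k)]. *)
Lemma normc2_telescope (z : nat -> C) k l :
  normc (z (k + l)%N - z k) ^+ 2 <=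
  (2 / 2 ^+ k - 2 / 2 ^+ (k + l)) *
  \sum_(k <= j < k + l) (2 ^+ j * normc (z j.+1 - z j) ^+ 2).
Proof.
elim: l => [|l IH].
  by rewrite addn0 !subrr normc0 expr0n mul0r.
rewrite addnS big_nat_recr ?leq_addr//=; set m := (k + l)%N.
set S := \sum_(k <= j < m) _ in IH *.
set del := normc (z m.+1 - z m).
have e0 : 0 < (2 ^+ m : R) by rewrite exprn_gt0.
have S0 : 0 <= S by apply: sumr_ge0 => j _; rewrite mulr_ge0 ?exprn_ge0 ?normc_ge0//.
set A := 2 / 2 ^+ k - 2 / 2 ^+ m in IH *.
have A0 : 0 <= A.
  rewrite subr_ge0 ler_pM2l// lef_pV2 ?posrE ?exprn_gt0//.
  by rewrite ler_weXn2l// ?leq_addr// ler1n.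
have -> : 2 / 2 ^+ k - 2 / 2 ^+ m.+1 = A + (2 ^+ m)^-1 :> R.
  by rewrite /A exprS; field; rewrite gt_eqF//= gt_eqF// exprn_gt0.
have -> : z m.+1 - z k = (z m - z k) + (z m.+1 - z m) by ring.
set s := normc (z m - z k) in IH.
apply: (@le_trans _ _ ((s + del) ^+ 2)).
  by rewrite ler_sqr ?nnegrE ?addr_ge0 ?normc_ge0// le_normcD.
set e := 2 ^+ m in e0 *.
have del0 : 0 <= del by exact: normc_ge0.
have s0 : 0 <= s by exact: normc_ge0.
(* The cross term is absorbed by the arithmetic-geometric mean inequality: [s ^+ 2 <= A * S], and
   [A * S * del ^+ 2] is the product of the two terms on the right. *)
have key : 2 * s * del <= A * e * del ^+ 2 + S / e.
  rewrite -(ler_sqr (x := 2 * s * del)) ?nnegrE; last first.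
  - by rewrite addr_ge0 ?divr_ge0 ?mulr_ge0 ?sqr_ge0// ltW.
  - by rewrite !mulr_ge0.
  apply: (@le_trans _ _ (4 * (A * S) * del ^+ 2)).
    by rewrite exprMn ler_wpM2r ?sqr_ge0// exprMn; lra.
  rewrite -subr_ge0.
  have -> : (A * e * del ^+ 2 + S / e) ^+ 2 - 4 * (A * S) * del ^+ 2 =
    (A * e * del ^+ 2 - S / e) ^+ 2 by field; rewrite gt_eqF.
  exact: sqr_ge0.
have -> : (A + e^-1) * (S + e * del ^+ 2) =
  A * S + (A * e * del ^+ 2 + S / e) + del ^+ 2 by field; rewrite gt_eqF.
by rewrite sqrrD -mulr_natl mulrA; lra.
Qed.

Lemma cvgn_of_rate (u : nat -> R) (b : R) :
  (forall k l, `|u (k + l)%N - u k| ^+ 2 <= b / 2 ^+ k) -> cvgn u.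
Proof.
move=> h; apply/cauchy_cvgP/cauchy_exP => e e0 /=.
have b0 : 0 <= b.
  by have := h 0%N 0%N; rewrite expr0 divr1 subrr normr0 expr0n.
have : (geometric b (2^-1 : R)) n @[n --> \oo] --> 0.
  by apply: cvg_geometric; rewrite ger0_norm ?invr_ge0// invf_lt1// ltr1n.
move=> /cvgr0_norm_lt /(_ (e ^+ 2)); rewrite exprn_gt0// => /(_ isT) [N _ HN].
exists (u N); exists N => // m /= Nm; rewrite /ball/= distrC.
have := h N (m - N)%N; rewrite subnKC// => hm.
rewrite -(ltr_sqr) ?nnegrE// ?(ltW e0)//.
apply: le_lt_trans hm _; have := HN N (leqnn _).
rewrite /= ger0_norm ?mulr_ge0 ?exprn_ge0 ?invr_ge0//.
by rewrite exprVn.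
Qed.

(* Weighting the increments by [2^k] makes the series of their squares
   integrable, so it is finite off a null set [A]; off [A] it dominates, up to
   [2^(1-k)], the square of the distance of [f k] to the limit. *)
Lemma sqi_complete (f : nat -> T -> C) : (forall k, sqi (f k)) ->
  (forall k, nrm2 (fun t => f k.+1 t - f k t) <= (8^-1) ^+ k) ->
  exists g, sqi g /\ nrm2 (fun t => f k t - g t) @[k --> \oo] --> (0 : R).
Proof.
move=> sf df.
pose dd k t := 2 ^+ k * normc (f k.+1 t - f k t) ^+ 2.
have dd0 k t : 0 <= dd k t by rewrite mulr_ge0 ?exprn_ge0 ?normc_ge0//.
have ddi k : rint mu (dd k) by apply: rintZ; exact: (sqiB (sf _) (sf _)).2.
pose H t := (\sum_(k <oo) (dd k t)%:E)%E.
have H0 t : (0 <= H t)%E.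
  by apply: nneseries_ge0 => k _ _; rewrite lee_fin.
have mH : measurable_fun setT H.
  apply: ge0_emeasurable_sum => [k t _ _|k _]; first by rewrite lee_fin.
  by apply/measurable_EFinP; exact: rint_measurable (ddi k).
have IH : (\int[mu]_t H t < +oo)%E.
  rewrite integral_nneseries//; last 2 first.
  - by move=> k; apply/measurable_EFinP; exact: rint_measurable (ddi k).
  - by move=> k t _; rewrite lee_fin.
  apply: (@le_lt_trans _ _ (\sum_(k <oo) (geometric 1 (4^-1 : R) k)%:E)%E).
    apply: lee_nneseries => [k _ _|k _].
      by apply: integral_ge0 => t _; rewrite lee_fin.
    rewrite Rint_EFin// lee_fin /dd RintZ; last exact: (sqiB (sf _) (sf _)).2.
    (* The weight [2 ^+ k] against the assumed rate [8^-k] leaves the summable [4^-k]. *)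
    apply: (@le_trans _ _ (2 ^+ k * (8^-1) ^+ k)); first by rewrite ler_wpM2l ?exprn_ge0// df.
    by rewrite -exprMn /= mul1r (_ : 2 * 8^-1 = 4^-1 :> R)//; field.
  have g1 : `|4^-1 : R| < 1 by rewrite ger0_norm ?invr_ge0// invf_lt1// ltr1n.
  have hc := cvg_geometric_series (a := 1 : R) g1.
  suff -> : (\sum_(k <oo) (geometric 1 (4^-1 : R) k)%:E)%E = (1 * (1 - 4^-1)^-1)%:E.
    exact: ltry.
  apply/cvg_lim => //.
  have -> : (fun k => (\sum_(0 <= i < k) (geometric 1 (4^-1 : R) i)%:E)%E) =
      EFin \o series (geometric 1 (4^-1 : R)).
    by apply/funext => k; rewrite /series/= sumEFin.
  exact: (cvg_comp _ _ hc).
have iH : mu.-integrable setT H.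
  by apply/integrableP; split => //; under eq_integral do rewrite gee0_abs//.
pose h t := fine (H t).
have hi : rint mu h.
  apply: (le_integrable _ _ _ iH) => //.
    by apply/measurable_EFinP/measurableT_comp => //; exact: fine_measurable.
  move=> t _; rewrite /h /=; have := H0 t; case: (H t) => [r r0|_|] //=.
  by rewrite normr0 leey.
pose A := [set t | (H t < +oo)%E].
have mA : measurable A.
  by rewrite -[A]setTI; apply: emeasurable_fun_infty_o => //.
have sumh t k l : A t -> \sum_(k <= j < k + l) dd j t <= h t.
  move=> At; rewrite -lee_fin /h fineK; last by rewrite ge0_fin_numE.
  apply: le_trans (nneseries_lim_ge (P := xpredT) (m := 0) (k + l) _); last first.
    by move=> j _; rewrite lee_fin.
  rewrite sumEFin lee_fin (@big_cat_nat _ _ _ k 0 (k + l))//= ?leq_addr//.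
  by rewrite lerDr sumr_ge0.
have key t k l : A t -> normc (f (k + l)%N t - f k t) ^+ 2 <= (2 * h t) / 2 ^+ k.
  move=> At; apply: le_trans (normc2_telescope (fun k => f k t) k l) _.
  rewrite mulrAC; apply: ler_pM => //.
  - rewrite subr_ge0 ler_pM2l// lef_pV2 ?posrE ?exprn_gt0//.
    by rewrite ler_weXn2l// ?leq_addr// ler1n.
  - by apply: sumr_ge0 => j _; exact: dd0.
  - by rewrite lerBlDr lerDl divr_ge0// exprn_ge0.
  - exact: sumh.
pose rf k t := complex.Re (f k t); pose mf k t := complex.Im (f k t).
have rc t : A t -> cvgn (rf ^~ t).
  move=> At; apply: (@cvgn_of_rate _ (2 * h t)) => k l.
  apply: le_trans (key t k l At).
  by rewrite /rf -ReN -ReD ler_sqr ?nnegrE ?normc_ge0// Re_le_normc.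
have mc t : A t -> cvgn (mf ^~ t).
  move=> At; apply: (@cvgn_of_rate _ (2 * h t)) => k l.
  apply: le_trans (key t k l At).
  by rewrite /mf -ImN -ImD ler_sqr ?nnegrE ?normc_ge0// Im_le_normc.
(* Cutting off outside [A] gives convergence at every point, hence a measurable limit; the integrals
   do not see the change because [A] has full measure. *)
pose f' k t := (\1_A t : R)%:C * f k t.
pose g t := (\1_A t : R)%:C * ((limn (rf ^~ t)) +i* (limn (mf ^~ t))).
have f'A k t : A t -> f' k t = f k t by move=> At; rewrite /f' indicE mem_set// mul1r.
have f'g t : normc (f' k t - g t) @[k --> \oo] --> (0 : R).
  have [At|nAt] := pselect (A t); last first.
    rewrite /f' /g indicE memNset//; under eq_fun do rewrite !mul0r subrr normc0.
    exact: cvg_cst.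
  rewrite /f' /g indicE mem_set//.
  have hs : (`|rf k t - limn (rf ^~ t)| + `|mf k t - limn (mf ^~ t)|)
      @[k --> \oo] --> (0 : R).
    rewrite -[X in _ --> X]addr0; apply: cvgD.
      apply/norm_cvg0P; apply/subr_cvg0; exact: rc.
    apply/norm_cvg0P; apply/subr_cvg0; exact: mc.
  apply: squeeze_cvgr (cvg_cst 0) hs; apply: nearW => k.
  rewrite normc_ge0 !mul1r; apply: le_trans (normc_le_ReIm _) _.
  by rewrite ReD ImD ReN ImN.
have mf' k : cmeas (f' k).
  by apply: cmeasM; [apply: cmeasR; exact: measurable_indic|exact: (sf k).1].
have mg : cmeas g by exact: cmeas_cvg mf' f'g.
have bnd k t : normc (f' k t - g t) ^+ 2 <= (2 / 2 ^+ k) * h t.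
  have h0 : 0 <= h t by exact: fine_ge0.
  have [At|nAt] := pselect (A t); last first.
    rewrite /f' /g indicE memNset// !mul0r subrr normc0 expr0n.
    by rewrite mulr_ge0// divr_ge0// exprn_ge0.
  (* The bound comes from [key] by letting [l] tend to infinity with [k] fixed. *)
  have c1 : normc (f' k t - f' (k + l)%N t) ^+ 2 @[l --> \oo] -->
      normc (f' k t - g t) ^+ 2.
    have c2 : (normc (f' k t - f' (k + l)%N t)) @[l --> \oo] --> normc (f' k t - g t).
      apply/subr_cvg0; apply: norm_cvg0.
      have c3 : normc (f' (k + l)%N t - g t) @[l --> \oo] --> (0 : R).
        by have := f'g t; rewrite -(cvg_shiftn k); under eq_fun do rewrite addnC.
      apply: squeeze_cvgr (cvg_cst 0) c3; apply: nearW => l.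
      rewrite normr_ge0/=; apply: le_trans (normc_dist_le _ _) _.
      have -> : f' k t - f' (k + l)%N t - (f' k t - g t) = g t - f' (k + l)%N t by ring.
      by rewrite normcB.
    by rewrite expr2; under eq_fun do rewrite expr2; apply: cvgM.
  rewrite -(cvg_lim (@Rhausdorff R) c1); apply: limr_le.
    by apply/cvg_ex; eexists; exact: c1.
  apply: nearW => l; rewrite !f'A// normcB mulrAC; exact: key.
have f'ae k : (\int[mu]_t (normc (f k t - g t) ^+ 2)%:E =
    \int[mu]_t (normc (f' k t - g t) ^+ 2)%:E)%E.
  apply: ge0_ae_eq_integral => //.
  - by apply/measurable_EFinP; apply: measurable_normc2; apply: cmeasB => //; exact: (sf k).1.
  - by apply/measurable_EFinP; apply: measurable_normc2; apply: cmeasB.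
  - by move=> t _; rewrite lee_fin sqr_ge0.
  - by move=> t _; rewrite lee_fin sqr_ge0.
  apply: filterS (integrable_ae measurableT iH) => t /(_ I) Ht _.
  by rewrite f'A// /A /= -ge0_fin_numE.
have f'i k : rint mu (fun t => normc (f' k t - g t) ^+ 2).
  apply: (rint_le _ (rintZ (2 / 2 ^+ k) hi)).
    by apply: measurable_normc2; apply: cmeasB.
  by move=> t; rewrite ger0_norm ?sqr_ge0.
have fi k : rint mu (fun t => normc (f k t - g t) ^+ 2).
  apply/integrableP; split.
    by apply/measurable_EFinP; apply: measurable_normc2; apply: cmeasB => //; exact: (sf k).1.
  under eq_integral do rewrite gee0_abs ?lee_fin ?sqr_ge0//.
  rewrite f'ae; apply: integrable_lty => //; exact: f'i.
exists g; split.
  have e : g = (fun t => f 0%N t - (f 0%N t - g t)).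
    by apply/funext => t; rewrite opprB addrC subrK.
  rewrite e; apply: sqiB => //; split => //; apply: cmeasB => //; exact: (sf _).1.
have hs : ((2 * \int[mu]_t h t) * (2^-1) ^+ k) @[k --> \oo] --> (0 : R).
  by apply: (cvg_geometric (2 * \int[mu]_t h t)); rewrite ger0_norm ?invr_ge0// invf_lt1// ltr1n.
apply: squeeze_cvgr (cvg_cst 0) hs; apply: nearW => k.
rewrite nrm2_ge0 /nrm2.
have -> : \int[mu]_t normc (f k t - g t) ^+ 2 = \int[mu]_t normc (f' k t - g t) ^+ 2.
  by rewrite /Rintegral f'ae.
apply: (@le_trans _ _ (\int[mu]_t (2 / 2 ^+ k * h t))).
  by apply: Rint_le => //; exact: rintZ.
by rewrite RintZ// exprVn mulrAC.
Qed.

End L2.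

Lemma cst_le_cvg0 (R : realType) (D : R) (a : nat -> R) : (forall k, `|D| <= a k) ->
  a k @[k --> \oo] --> (0 : R) -> D = 0.
Proof.
move=> Da a0; apply/normr0_eq0/eqP; rewrite eq_le normr_ge0 andbT.
rewrite -(cvg_lim (@Rhausdorff R) a0); apply: limr_ge.
  by apply/cvg_ex; eexists; exact: a0.
exact: nearW.
Qed.

Lemma cvg_sqrt0 (R : realType) (a : nat -> R) :
  a k @[k --> \oo] --> (0 : R) -> Num.sqrt (a k) @[k --> \oo] --> (0 : R).
Proof.
move=> a0; rewrite -(@sqrtr0 R).
by apply: cvg_comp a0 _; exact: sqrt_continuous.
Qed.

Lemma cvgD0 (R : realType) (u v : nat -> R) (l : R) : u k @[k --> \oo] --> l ->
  v k @[k --> \oo] --> (0 : R) -> (u k + v k) @[k --> \oo] --> l.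
Proof. by move=> ul v0; rewrite -(addr0 l); apply: cvgD. Qed.

Lemma cvgZ0 (R : realType) (c : R) (u : nat -> R) : u k @[k --> \oo] --> (0 : R) ->
  (c * u k) @[k --> \oo] --> (0 : R).
Proof. by move=> u0; rewrite -(mulr0 c); apply: cvgMl_tmp. Qed.

Lemma cvg0Z (R : realType) (c : R) (u : nat -> R) : u k @[k --> \oo] --> (0 : R) ->
  (u k * c) @[k --> \oo] --> (0 : R).
Proof. by move=> u0; rewrite -(mul0r c); apply: cvgMr_tmp. Qed.

(** * Riesz representation on a subspace *)

Section riesz.
Context d (T : measurableType d) (R : realType).
Local Notation C := R[i].
Variable mu : {measure set T -> \bar R}.
Context (U : Type) (p : T -> U).
Variable P : (U -> C) -> Prop.
Hypothesis P0 : P (fun=> 0).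
Hypothesis PZD : forall (a : C) phi psi, P phi -> P psi ->
  P (fun x => a * phi x + psi x).
Hypothesis PJ : forall phi, P phi -> P (fun x => conjc (phi x)).
Hypothesis Psqi : forall phi, P phi -> sqi mu (fun t => phi (p t)).

(** Pairings with [P] control the norm only of functions that are L2 limits of elements of [P].
    Recording this property of the Riesz representative makes [closure_bound] applicable without any
    density of [P] in L2. *)
Definition in_closure (g : T -> C) := sqi mu g /\ exists h : nat -> U -> C,
  (forall k, P (h k)) /\ nrm2 mu (fun t => g t - h k (p t)) @[k --> \oo] --> (0 : R).

Lemma in_closureB g1 g2 : in_closure g1 -> in_closure g2 ->
  in_closure (fun t => g1 t - g2 t).
Proof.
move=> [s1 [h1 [P1 c1]]] [s2 [h2 [P2 c2]]]; split; first exact: sqiB.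
exists (fun k x => -1 * h2 k x + h1 k x); split; first by move=> k; exact: PZD.
have hs : (2 * nrm2 mu (fun t => g1 t - h1 k (p t)) +
    2 * nrm2 mu (fun t => g2 t - h2 k (p t))) @[k --> \oo] --> (0 : R).
  by apply: cvgD0; apply: cvgZ0.
apply: squeeze_cvgr (cvg_cst 0) hs; apply: nearW => k; rewrite nrm2_ge0 /=.
apply: le_trans (nrm2B_le (sqiB s1 (Psqi (P1 k))) (sqiB s2 (Psqi (P2 k)))).
rewrite le_eqVlt; apply/orP; left; apply/eqP; congr nrm2.
by apply/funext => t; ring.
Qed.

(** Pair [g] with its own approximants: |g|^2 is at most [K] |h k| + |g| |g - h k|. The factor 2
    comes from the crude bound of |h k|^2 by 2 |g|^2 + 2 |g - h k|^2 and is harmless in the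
    continuity estimates. *)
Lemma closure_bound g (K : R) : 0 <= K -> in_closure g ->
  (forall phi, P phi ->
     normc (cI mu (fun t => g t * phi (p t))) <=
     K * Num.sqrt (nrm2 mu (fun t => phi (p t)))) ->
  nrm2 mu g <= 2 * K ^+ 2.
Proof.
move=> K0 [sg [h [Ph ch]]] gK.
set G := nrm2 mu g; have G0 : 0 <= G by exact: nrm2_ge0.
pose e k := nrm2 mu (fun t => g t - h k (p t)).
have hG k : nrm2 mu (fun t => h k (p t)) <= 2 * G + 2 * e k.
  have -> : (fun t => h k (p t)) = (fun t => g t - (g t - h k (p t))).
    by apply/funext => t; ring.
  by apply: nrm2B_le => //; apply: sqiB => //; exact: Psqi.
have bk k : G <= K * Num.sqrt (2 * G + 2 * e k) + Num.sqrt G * Num.sqrt (e k).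
  have GE : G = complex.Re (cI mu (fun t => g t * conjc (g t))).
    rewrite /G /nrm2; apply: eq_Rintegral => t _; by rewrite mulcJ.
  rewrite [leLHS]GE.
  have -> : cI mu (fun t => g t * conjc (g t)) =
      cI mu (fun t => g t * conjc (h k (p t))) +
      cI mu (fun t => g t * conjc (g t - h k (p t))).
    have si := Psqi (Ph k).
    rewrite -cID; [|by apply: sqiM => //; exact: sqiJ|].
      by apply: eq_cI => t; rewrite conjcD conjcN; ring.
    by apply: sqiM => //; apply: sqiJ; exact: sqiB.
  rewrite ReD lerD//.
    apply: le_trans (le_trans (ler_norm _) (Re_le_normc _)) _.
    apply: le_trans (gK _ (PJ (Ph k))) _.
    by rewrite ler_wpM2l// ler_wsqrtr// nrm2J; exact: hG.
  apply: le_trans (le_trans (ler_norm _) (Re_le_normc _)) _.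
  rewrite /e -[X in _ <= _ * Num.sqrt X]nrm2J.
  by apply: cauchy_schwarz => //; apply: sqiJ; apply: sqiB => //; exact: Psqi.
have lim : (K * Num.sqrt (2 * G + 2 * e k) + Num.sqrt G * Num.sqrt (e k))
    @[k --> \oo] --> K * Num.sqrt (2 * G).
  apply: cvgD0; last by apply: cvgZ0; exact: cvg_sqrt0.
  apply: cvgMl_tmp; apply: cvg_comp; last exact: sqrt_continuous.
  by apply: cvgD0; [exact: cvg_cst|exact: cvgZ0].
have : G <= K * Num.sqrt (2 * G).
  rewrite -(cvg_lim (@Rhausdorff R) lim); apply: limr_ge.
    by apply/cvg_ex; eexists; exact: lim.
  exact: nearW.
have [->|Gn0] := eqVneq G 0; first by move=> _; rewrite mulr_ge0 ?exprn_ge0.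
have Gp : 0 < G by rewrite lt_neqAle eq_sym Gn0.
rewrite -ler_sqr ?nnegrE ?mulr_ge0 ?sqrtr_ge0// exprMn sqr_sqrtr ?mulr_ge0//.
by rewrite expr2 mulrA ler_pM2r// mulrC.
Qed.

Variable ell : (U -> C) -> C.
Variable K : R.
Hypothesis ellZD : forall (a : C) phi psi, P phi -> P psi ->
  ell (fun x => a * phi x + psi x) = a * ell phi + ell psi.
Hypothesis ellK : forall phi, P phi ->
  normc (ell phi) <= K * Num.sqrt (nrm2 mu (fun t => phi (p t))).

Let N phi := nrm2 mu (fun t => phi (p t)).
Let J phi := N phi - 2 * complex.Re (ell (fun x => conjc (phi x))).

(** Completing the square: [J phi] is at least (K - |phi|)^2 - K^2. *)
Let J_ge phi : P phi -> - K ^+ 2 <= J phi.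
Proof.
move=> Pp.
have : complex.Re (ell (fun x => conjc (phi x))) <= K * Num.sqrt (N phi).
  apply: le_trans (le_trans (ler_norm _) (Re_le_normc _)) _.
  by apply: le_trans (ellK (PJ Pp)) _; rewrite nrm2J.
have : 0 <= (K - Num.sqrt (N phi)) ^+ 2 by exact: sqr_ge0.
rewrite sqrrB sqr_sqrtr ?nrm2_ge0// /J; lra.
Qed.

Let m := inf [set J phi | phi in P].

Let has_infJ : has_inf [set J phi | phi in P].
Proof.
split; first by exists (J (fun=> 0)); exists (fun=> 0).
by exists (- K ^+ 2) => _ [phi Pp <-]; exact: J_ge.
Qed.

Let J_ge_m phi : P phi -> m <= J phi.
Proof.
by move=> Pp; apply: ge_inf; [exact: has_infJ.2|exists phi].
Qed.

Let J_line phi psi (t : R) : P phi -> P psi ->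
  J (fun x => t%:C * psi x + phi x) = J phi + t ^+ 2 * N psi +
  2 * t * (complex.Re (cI mu (fun s => phi (p s) * conjc (psi (p s)))) -
           complex.Re (ell (fun x => conjc (psi x)))).
Proof.
move=> Pphi Ppsi; have sp := Psqi Pphi; have ss := Psqi Ppsi.
rewrite /J /N.
have -> : (fun x => conjc (t%:C * psi x + phi x)) =
    (fun x => t%:C * conjc (psi x) + conjc (phi x)).
  by apply/funext => x; rewrite conjcD conjcM; congr (_ * _ + _); apply: complex_ext; rewrite /= ?oppr0.
rewrite ellZD; [|exact: PJ..].
rewrite nrm2DE//; last exact: sqiZ.
rewrite nrm2Z// normcR real_normK ?num_real//.
have -> : cI mu (fun s => t%:C * psi (p s) * conjc (phi (p s))) =
    t%:C * conjc (cI mu (fun s => phi (p s) * conjc (psi (p s)))).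
  rewrite -cIJ; last by apply: sqiM => //; exact: sqiJ.
  rewrite -cIZ; last by apply/cintegJ/sqiM => //; exact: sqiJ.
  by apply: eq_cI => s; rewrite conjcM conjcK; ring.
by rewrite !ReImE /=; ring.
Qed.

(* Minimise [J phi = |phi|^2 - 2 Re (ell phi^* )]: by the parallelogram law a
   minimising sequence is Cauchy, and the first variation at its limit is the
   representation of [ell]. *)
Lemma riesz : exists g, in_closure g /\
  forall phi, P phi -> cI mu (fun t => g t * phi (p t)) = ell phi.
Proof.
(* With this tolerance the estimate [dist] bounds consecutive squared distances by (1/2 + 1/16)
   [8^-k], within the rate required by [sqi_complete]. *)
have /choice[h hP] : forall k, exists phi, P phi /\ J phi - m <= 4^-1 * (8^-1) ^+ k.
  move=> k.
  have e0 : 0 < 4^-1 * (8^-1) ^+ k :> R by rewrite mulr_gt0 ?exprn_gt0 ?invr_gt0.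
  have [_ [phi Pp <-] h] := inf_adherent e0 has_infJ.
  by exists phi; split => //; rewrite lerBlDl ltW.
have Ph k := (hP k).1; have eh k := (hP k).2.
have dist phi psi : P phi -> P psi ->
    N (fun x => phi x - psi x) <= 2 * (J phi - m) + 2 * (J psi - m).
  move=> P1 P2; have s1 := Psqi P1; have s2 := Psqi P2.
  have := nrm2_parallelogram s1 s2.
  have PD : P (fun x => 1 * phi x + psi x) by exact: PZD.
  (* The midpoint of [phi] and [psi] is again in [P], so its value under [J] is at least [m]. *)
  have := J_ge_m (PZD (2^-1)%:C PD P0).
  have -> : J (fun x => (2^-1)%:C * (1 * phi x + psi x) + 0) =
      4^-1 * nrm2 mu (fun t => phi (p t) + psi (p t)) -
      (complex.Re (ell (fun x => conjc (phi x))) +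
       complex.Re (ell (fun x => conjc (psi x)))).
    rewrite J_line// /J /N.
    have -> : cI mu (fun s => 0 * conjc (1 * phi (p s) + psi (p s))) = 0.
      by rewrite -[RHS](cI0 mu); apply: eq_cI => s; rewrite mul0r.
    have -> : nrm2 mu (fun=> 0) = 0.
      by rewrite /nrm2 normc0 expr0n Rint0.
    have -> : ell (fun=> conjc 0) = 0.
      rewrite conjc0; have := ellZD (-1) P0 P0.
      have -> : (fun x : U => -1 * 0 + 0 : C) = fun=> 0 by apply/funext => x; rewrite mulr0 addr0.
      by rewrite mulN1r addNr.
    have -> : (fun x => conjc (1 * phi x + psi x)) =
        (fun x => 1 * conjc (phi x) + conjc (psi x)).
      by apply/funext => x; rewrite mul1r conjcD mul1r.
    rewrite ellZD; [|exact: PJ..].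
    rewrite mul1r ReD.
    have -> : nrm2 mu (fun t => 1 * phi (p t) + psi (p t)) =
        nrm2 mu (fun t => phi (p t) + psi (p t)).
      by congr nrm2; apply/funext => t; rewrite mul1r.
    by rewrite /=; field.
  by rewrite /J /N => ? ?; lra.
have [|k|g [sg cg]] := @sqi_complete _ _ _ mu (fun k t => h k (p t)).
- by move=> k; exact: Psqi.
- apply: le_trans (dist _ _ (Ph _) (Ph _)) _.
  have := eh k; have := eh k.+1; rewrite exprS => h1 h2.
  have : 0 <= (8^-1 : R) ^+ k by rewrite exprn_ge0// invr_ge0.
  by lra.
have repr psi : P psi -> complex.Re (cI mu (fun t => g t * conjc (psi (p t)))) =
    complex.Re (ell (fun x => conjc (psi x))).
  move=> Pp; have sp := Psqi Pp.
  apply/eqP; rewrite -subr_eq0; apply/eqP.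
  apply: (@cst_le_cvg0 _ _ (fun k => Num.sqrt (N psi * (J (h k) - m)) +
     Num.sqrt (nrm2 mu (fun t => h k (p t) - g t)) * Num.sqrt (N psi))).
    move=> k; have sh := Psqi (Ph k).
    set D := complex.Re (cI mu (fun t => h k (p t) * conjc (psi (p t)))) -
      complex.Re (ell (fun x => conjc (psi x))).
    have -> : complex.Re (cI mu (fun t => g t * conjc (psi (p t)))) -
        complex.Re (ell (fun x => conjc (psi x))) =
        D - complex.Re (cI mu (fun t => (h k (p t) - g t) * conjc (psi (p t)))).
      have -> : cI mu (fun t => (h k (p t) - g t) * conjc (psi (p t))) =
          cI mu (fun t => h k (p t) * conjc (psi (p t))) -
          cI mu (fun t => g t * conjc (psi (p t))).
        rewrite -cIB; [|by apply: sqiM => //; exact: sqiJ..].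
        by apply: eq_cI => t; rewrite mulrBl.
      by rewrite ReD ReN /D; ring.
    apply: le_trans (ler_normB _ _) _; rewrite lerD//.
      rewrite -sqrtr_sqr ler_wsqrtr//.
      (* [J (s psi + h k) - m] is a nonnegative quadratic in [s]; its discriminant bounds [D ^+ 2]
         by [N psi * (J (h k) - m)]. *)
      have := @quad_ge0_le R (N psi) (J (h k) - m) (- D).
      rewrite sqrrN; apply; rewrite ?nrm2_ge0 ?subr_ge0 ?J_ge_m// => s.
      have := J_ge_m (PZD s%:C Pp (Ph k)); rewrite J_line// -/D; lra.
    apply: le_trans (Re_le_normc _) _.
    rewrite -[X in _ <= _ * Num.sqrt X]nrm2J.
    by apply: cauchy_schwarz; [exact: sqiB|exact: sqiJ].
  apply: cvgD0; last by apply: cvg0Z; exact: cvg_sqrt0.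
  apply: cvg_sqrt0; apply: cvgZ0.
  have g0 : geometric (4^-1 : R) (8^-1) k @[k --> \oo] --> (0 : R).
    by apply: cvg_geometric; rewrite ger0_norm ?invr_ge0// invf_lt1// ltr1n.
  apply: squeeze_cvgr (cvg_cst 0) g0; apply: nearW => k /=.
  by rewrite subr_ge0 J_ge_m//= eh.
exists g; split.
  split=> //; exists h; split => //.
  by under eq_fun do rewrite nrm2BC.
have reprE psi : P psi -> complex.Re (cI mu (fun t => g t * psi (p t))) =
    complex.Re (ell psi).
  move=> /PJ /repr.
  have -> : (fun x => conjc (conjc (psi x))) = psi by apply/funext => x; rewrite conjcK.
  by under eq_cI do rewrite conjcK.
move=> phi Pp; apply: complex_ext; first exact: reprE.
(* The imaginary part is the real part for [i phi], up to sign. *)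
have := reprE _ (PZD (0 +i* 1) Pp P0); rewrite ellZD//.
have -> : ell (fun=> 0) = 0.
  have := ellZD (-1) P0 P0.
  have -> : (fun x : U => -1 * 0 + 0 : C) = fun=> 0 by apply/funext => x; rewrite mulr0 addr0.
  by rewrite mulN1r addNr.
have -> : cI mu (fun t => g t * ((0 +i* 1) * phi (p t) + 0)) =
    (0 +i* 1) * cI mu (fun t => g t * phi (p t)).
  rewrite -cIZ; last by apply: sqiM => //; exact: Psqi.
  by apply: eq_cI => t; rewrite addr0 mulrCA.
by rewrite addr0 !ReM /= !mul0r !mul1r !sub0r => /oppr_inj.
Qed.

End riesz.

(** * Lebesgue measure on tuples *)

Section Lfun_bridge.
Context d (T : measurableType d) (R : realType).
Variable mu : {measure set T -> \bar R}.

Lemma Lnorm2E (f : T -> R) :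
  Lnorm mu 2%:E (fun t => (f t)%:E) =
  ((\int[mu]_t (f t ^+ 2)%:E) `^ 2^-1)%E.
Proof.
rewrite unlock; congr (_ `^ _)%E; apply: eq_integral => t _.
by rewrite /= powR_mulrn// real_normK ?num_real.
Qed.

Lemma Lfun2P (f : T -> R) : f \in Lfun mu 2%:E <->
  measurable_fun setT f /\ rint mu (fun t => f t ^+ 2).
Proof.
split=> [fL|[mf fi]].
  split; last exact: Lfun2_integrable_sqr.
  by have := sub_Lfun_mfun fL; rewrite inE.
apply/andP; split; rewrite inE//=.
rewrite /finite_norm (Lnorm2E f); apply: poweR_lty.
by apply: integrable_lty.
Qed.

Lemma Lnorm2_normc (f : T -> R[i]) : sqi mu f ->
  Lnorm mu 2%:E (fun t => (normc (f t))%:E) = (Num.sqrt (nrm2 mu f))%:E.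
Proof.
move=> [mf fi]; rewrite (Lnorm2E (fun t => normc (f t))) Rint_EFin//.
by rewrite poweR_EFin powR12_sqrt// nrm2_ge0.
Qed.

Lemma sqiP (f : T -> R[i]) : sqi mu f <->
  (fun t => complex.Re (f t)) \in Lfun mu 2%:E /\
  (fun t => complex.Im (f t)) \in Lfun mu 2%:E.
Proof.
split=> [[[m1 m2] fi]|[/Lfun2P[m1 i1] /Lfun2P[m2 i2]]].
  split; apply/Lfun2P; split => //.
    apply: (rint_le (measurable_funX _ m1) fi) => t.
    by rewrite ger0_norm ?sqr_ge0// normc2E lerDl sqr_ge0.
  apply: (rint_le (measurable_funX _ m2) fi) => t.
  by rewrite ger0_norm ?sqr_ge0// normc2E lerDr sqr_ge0.
split=> //; under eq_fun do rewrite normc2E.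
exact: rintD.
Qed.

End Lfun_bridge.

(** * Fubini's theorem for real and complex integrands *)

Section fubini.
Context d1 d2 (T1 : measurableType d1) (T2 : measurableType d2) (R : realType).
Variables (m1 : {sigma_finite_measure set T1 -> \bar R})
  (m2 : {sigma_finite_measure set T2 -> \bar R}).
Implicit Types f : T1 * T2 -> R.

(** The inner integrals of Fubini's theorem are extended reals that are finite almost everywhere
    only; applying [fine] changes them on a null set. *)
Lemma rint_fine d (T : measurableType d) (mu : {measure set T -> \bar R})
  (F : T -> \bar R) : mu.-integrable setT F ->
  rint mu (fun t => fine (F t)) /\ \int[mu]_t fine (F t) = fine (\int[mu]_t F t)%E.
Proof.
move=> iF; have mF : measurable_fun setT (fun t => (fine (F t))%:E).
  by apply/measurable_EFinP/measurableT_comp => //; exact: measurable_int iF.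
split.
  apply: (le_integrable _ _ _ iF) => // t _ /=.
  by case: (F t) => //= ; rewrite normr0 leey.
rewrite /Rintegral; congr fine; apply: ae_eq_integral => //.
  exact: measurable_int iF.
by apply: filterS (integrable_ae measurableT iF) => t /(_ I) Ft _; rewrite fineK.
Qed.

Lemma Rint_fubini f : rint (m1 \x m2)%E f ->
  rint m1 (fun x => \int[m2]_y f (x, y)) /\
  \int[(m1 \x m2)%E]_z f z = \int[m1]_x \int[m2]_y f (x, y).
Proof.
move=> fi.
have [h1 h2] := rint_fine (integrable_fubini_F fi).
split; first exact: h1.
rewrite [RHS]h2 /Rintegral; congr fine.
by rewrite -(integral12_prod_meas1 fi).
Qed.

Lemma integrable_fubini_snd (f : T1 * T2 -> \bar R) : (m1 \x m2)%E.-integrable setT f ->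
  m2.-integrable setT (fubini_G m1 f).
Proof.
move=> fi; have mf := measurable_int _ fi.
apply/integrableP; split; first exact: measurable_fubini_G fi.
have h := (integrable21ltyP m1 m2 mf).1 fi.
apply: (le_lt_trans _ h).
apply: ge0_le_integral => //.
- apply: measurableT_comp => //; exact: measurable_fubini_G fi.
- apply: (measurable_fun_fubini_tonelli_G (abse \o f)) => //=.
  exact: measurableT_comp.
- by move=> y _; apply: le_abse_integral => //; exact: measurableT_comp.
Qed.

Lemma Rint_fubini2 f : rint (m1 \x m2)%E f ->
  rint m2 (fun y => \int[m1]_x f (x, y)) /\
  \int[(m1 \x m2)%E]_z f z = \int[m2]_y \int[m1]_x f (x, y).
Proof.
move=> fi.
have [h1 h2] := rint_fine (integrable_fubini_snd fi).
split; first exact: h1.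
rewrite [RHS]h2 /Rintegral; congr fine.
by rewrite -(integral21_prod_meas1 fi).
Qed.

Lemma rint_prod (g : T1 -> R) (h : T2 -> R) : rint m1 g -> rint m2 h ->
  (forall x, 0 <= g x) -> (forall y, 0 <= h y) ->
  rint (m1 \x m2)%E (fun z => g z.1 * h z.2).
Proof.
move=> gi hi g0 h0; apply/integrable12ltyP.
  apply/measurable_EFinP; apply: measurable_funM.
    by apply: measurableT_comp (rint_measurable gi) _.
  by apply: measurableT_comp (rint_measurable hi) _.
rewrite (_ : (fun x => _) = (fun x => (g x)%:E * (\int[m2]_y h y)%:E))%E; last first.
  apply/funext => x; rewrite -Rint_EFin// -ge0_integralZl//.
  - by apply: eq_integral => y _; rewrite gee0_abs ?lee_fin ?mulr_ge0// EFinM.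
  - by apply/measurable_EFinP; exact: rint_measurable hi.
  - by move=> y _; rewrite lee_fin.
  - by rewrite lee_fin.
rewrite (_ : (fun x => _) = (fun x => (g x * (\int[m2]_y h y))%:E)); last first.
  by apply/funext => x; rewrite EFinM.
rewrite Rint_EFin ?ltry//.
by under eq_fun do rewrite mulrC; exact: rintZ.
Qed.

Lemma cI_fubini (f : T1 * T2 -> R[i]) : cinteg (m1 \x m2)%E f ->
  cinteg m1 (fun x => cI m2 (fun y => f (x, y))) /\
  cI (m1 \x m2)%E f = cI m1 (fun x => cI m2 (fun y => f (x, y))).
Proof.
move=> [/Rint_fubini[a1 b1] /Rint_fubini[a2 b2]]; split; first by split.
exact: complex_ext.
Qed.

Lemma cI_fubini2 (f : T1 * T2 -> R[i]) : cinteg (m1 \x m2)%E f ->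
  cinteg m2 (fun y => cI m1 (fun x => f (x, y))) /\
  cI (m1 \x m2)%E f = cI m2 (fun y => cI m1 (fun x => f (x, y))).
Proof.
move=> [/Rint_fubini2[a1 b1] /Rint_fubini2[a2 b2]]; split; first by split.
exact: complex_ext.
Qed.

End fubini.

Section leb_succ_integral.
Context {R : realType} (n : nat).
Local Notation mu2 := ((@lebesgue_measure R) \x (leb R n))%E.

Lemma rint_leb_succ (f : n.+1.-tuple R -> R) : measurable_fun setT f ->
  rint mu2 (f \o consR (n:=n)) -> rint (leb R n.+1) f.
Proof.
move=> mf fi; apply: integrable_pushforward => //.
- exact: measurable_consR.
- exact/measurable_EFinP.
Qed.

Lemma Rint_leb_succ (f : n.+1.-tuple R -> R) : measurable_fun setT f ->
  rint mu2 (f \o consR (n:=n)) ->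
  \int[leb R n.+1]_t f t = \int[mu2]_z f (consR z).
Proof.
move=> mf fi; rewrite /Rintegral; congr fine.
transitivity (\int[pushforward mu2 (consR (n:=n))]_t (f t)%:E)%E; first by [].
by rewrite integral_pushforward//; [exact: measurable_consR|exact/measurable_EFinP].
Qed.

Lemma rint_leb_succV (f : n.+1.-tuple R -> R) : rint (leb R n.+1) f ->
  rint mu2 (f \o consR (n:=n)).
Proof.
move=> fi; have mf := rint_measurable fi; apply/integrableP; split.
  apply/measurable_EFinP; apply: measurableT_comp => //; exact: measurable_consR.
move/integrableP : fi => [_]; apply: le_lt_trans.
rewrite (_ : (\int[leb R n.+1]_x _)%E =
  (\int[pushforward mu2 (consR (n:=n))]_t `|(f t)%:E|)%E)//.
rewrite ge0_integral_pushforward//; first exact: measurable_consR.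
by apply: measurableT_comp => //; exact/measurable_EFinP.
Qed.

Lemma cinteg_leb_succV (f : n.+1.-tuple R -> R[i]) : cinteg (leb R n.+1) f ->
  cinteg mu2 (f \o consR (n:=n)).
Proof. by move=> [i1 i2]; split; apply: (@rint_leb_succV (fun t => _ (f t))). Qed.

Lemma cI_leb_succ (f : n.+1.-tuple R -> R[i]) : cinteg (leb R n.+1) f ->
  cI (leb R n.+1) f = cI mu2 (f \o consR (n:=n)).
Proof.
move=> fi; have [m1 m2] := cinteg_meas fi; have [i1 i2] := cinteg_leb_succV fi.
by apply: complex_ext; rewrite /cI; apply: (@Rint_leb_succ (fun t => _ (f t))).
Qed.

End leb_succ_integral.

(** * An integrable weight on R^n *)

Section weight.
Context {R : realType}.

(** A product rather than a power of 1 + |x|: it is integrable by Fubini from the integral of 1 / (1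
    + x^2) on the line, and it is still bounded below by (1 + |x|)^(-2n), see [wtV_le], so that it
    dominates Schwartz functions. *)
Definition wt n (t : n.-tuple R) : R := \prod_(i < n) (1 + tnth t i ^+ 2)^-1.

Lemma wt_gt0 n (t : n.-tuple R) : 0 < wt t.
Proof. by apply: prodr_gt0 => i _; rewrite invr_gt0 ltr_pwDl// sqr_ge0. Qed.

Lemma wt_cons n (z : measurableTypeR R * n.-tuple R) :
  wt (consR z) = (1 + z.1 ^+ 2)^-1 * wt z.2.
Proof.
rewrite /wt big_ord_recl; congr (_ * _).
by apply: eq_bigr => i _; rewrite !(tnth_nth 0).
Qed.

Lemma measurable_wt n : measurable_fun setT (@wt n).
Proof.
have h (i : 'I_n) : measurable_fun setT (fun t : n.-tuple R => (1 + tnth t i ^+ 2)^-1).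
  apply: (@measurableT_comp _ _ _ _ _ _ (fun x : R => (1 + x ^+ 2)^-1)).
    by apply: continuous_measurable_fun; exact: continuous_oneDsqrV.
  exact: measurable_tnth.
rewrite /wt; elim: (index_enum _) => [|i s IH].
  rewrite (_ : (fun t => _) = cst 1); first exact: measurable_cst.
  by apply/funext => t; rewrite big_nil.
rewrite (_ : (fun t => _) = (fun t : n.-tuple R => (1 + tnth t i ^+ 2)^-1 *
    \prod_(j <- s) (1 + tnth t j ^+ 2)^-1)); last first.
  by apply/funext => t; rewrite big_cons.
exact: measurable_funM.
Qed.

Lemma rint_oneDsqrV : rint (@lebesgue_measure R) (fun x => (1 + x ^+ 2)^-1) /\
  \int[@lebesgue_measure R]_x (1 + x ^+ 2)^-1 = pi.
Proof.
have E : (\int[@lebesgue_measure R]_x ((1 + x ^+ 2)^-1)%:E = pi%:E)%E.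
  rewrite (@ge0_symfun_integralT R (fun x => (1 + x ^+ 2)^-1)).
  - rewrite -set_itvcy.
    by rewrite (@integral0y_oneDsqr R) -EFinM; congr (_%:E); rewrite mulrC divfK.
  - by move=> x; rewrite invr_ge0 addr_ge0// sqr_ge0.
  - exact: continuous_oneDsqrV.
  - by move=> x /=; rewrite sqrrN.
split; last by rewrite /Rintegral E.
apply/integrableP; split.
  by apply/measurable_EFinP; apply: continuous_measurable_fun; exact: continuous_oneDsqrV.
under eq_integral do rewrite gee0_abs ?lee_fin ?invr_ge0 ?addr_ge0 ?sqr_ge0//.
by rewrite E ltry.
Qed.

Lemma rint_wt n : rint (leb R n) (@wt n).
Proof.
elim: n => [|n IH].
  apply/integrableP; split.
    by apply/measurable_EFinP; exact: measurable_wt.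
  have mw : measurable_fun setT (fun t => `|(@wt 0 t)%:E|%E).
    by apply: measurableT_comp => //; apply/measurable_EFinP; exact: measurable_wt.
  rewrite [X in (X < _)%E](_ : _ = \int[\d_ ([tuple] : 0.-tuple R)]_x `|(@wt 0 x)%:E|)%E//.
  by rewrite integral_dirac// diracT mul1e ltry.
apply: rint_leb_succ; first exact: measurable_wt.
rewrite (_ : _ \o _ = fun z => (1 + z.1 ^+ 2)^-1 * wt z.2); last first.
  by apply/funext => z; rewrite /= wt_cons.
apply: (rint_prod (g := fun x : measurableTypeR R => (1 + x ^+ 2)^-1) (h := @wt n) _ IH).
- exact: rint_oneDsqrV.1.
- by move=> x; rewrite invr_ge0 addr_ge0// sqr_ge0.
- by move=> t; exact: ltW (wt_gt0 t).
Qed.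

End weight.

(** * Measurability of Lipschitz functions on tuples *)

Section lipschitz_measurable.
Context {R : realType}.

(* The McShane formula [g x = inf_q (g q + L |x - q|_1)], over rational [q]. *)
Lemma lipschitz_measurable n (g : 'rV[R]_n -> R) (L : R) : 0 <= L ->
  (forall x y, `|g x - g y| <= L * \sum_(i < n) `|x 0 i - y 0 i|) ->
  measurable_fun setT (fun t : n.-tuple R => g (point t)).
Proof.
move=> L0 gL.
move=> _; apply: (measurability _ (RGenInftyO.measurableE R)) => //.
move=> _ [_ [c ->] <-]; rewrite setTI.
(* The points at which the competitor [q] of the McShane formula is already below [c]; each such set
   is defined by finitely many coordinates, and there are countably many. *)
pose F (q : n.-tuple rat) : set (n.-tuple R) :=
  [set t | g (\row_i ratr (tnth q i)) +
           L * (\sum_(i < n) `|tnth t i - ratr (tnth q i)|) < c].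
rewrite (_ : _ @^-1` _ = \bigcup_q F q); last first.
  apply/seteqP; split => [t /=|t [q _] /=]; rewrite in_itv/=.
    (* Replacing the point by a rational one costs at most [L * n * del] in the value of [g] and as
       much again in the penalty; [del] keeps the total below the gap [c - g (point t)]. *)
    move=> gc; pose del := (c - g (point t)) / (2 * L * n%:R + 1).
    have den0 : 0 < 2 * L * n%:R + 1 by rewrite ltr_wpDl// !mulr_ge0.
    have del0 : 0 < del by rewrite divr_gt0// subr_gt0.
    have /choice[q hq] : forall i, exists r : rat, `|tnth t i - ratr r| < del.
      move=> i; have [r] : {r : rat | ratr r \in `](tnth t i - del), (tnth t i + del)[}.
        by apply: cid; apply: rat_in_itvoo; lra.
      rewrite in_itv/= => /andP[h1 h2]; exists r.
      by rewrite ltr_norml; apply/andP; split; lra.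
    exists (mktuple q) => //; rewrite /F /=.
    have S : \sum_(i < n) `|tnth t i - ratr (tnth (mktuple q) i)| <= n%:R * del.
      rewrite -[n in n%:R]card_ord mulr_natl -sumr_const.
      by apply: ler_sum => i _; rewrite tnth_mktuple ltW.
    set S' := \sum_(i < n) _ in S *.
    have := gL (\row_i ratr (tnth (mktuple q) i)) (point t).
    rewrite (eq_bigr (fun i => `|tnth t i - ratr (tnth (mktuple q) i)|)); last first.
      by move=> i _; rewrite !mxE distrC.
    rewrite -/S' => /ler_normlW h.
    have hS : L * S' <= L * (n%:R * del) by rewrite ler_wpM2l.
    have e : (2 * L * n%:R + 1) * del = c - g (point t).
      by rewrite /del mulrC divfK// gt_eqF.
    by lra.
  rewrite /F/= => h; have := gL (point t) (\row_i ratr (tnth q i)).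
  rewrite (eq_bigr (fun i => `|tnth t i - ratr (tnth q i)|)); last first.
    by move=> i _; rewrite !mxE.
  by move=> /ler_normlW h2; apply: le_lt_trans h; rewrite -lerBlDl.
apply: countable_bigcupT_measurable => //.
move=> q; rewrite -[F q]setTI.
have mF : measurable_fun setT (fun t : n.-tuple R => g (\row_i ratr (tnth q i)) +
    L * (\sum_(i < n) `|tnth t i - ratr (tnth q i)|)).
  apply: measurable_funD => //; apply: measurable_funM => //.
  apply: measurable_sum => i; apply: measurableT_comp => //.
  by apply: measurable_funB => //; exact: measurable_tnth.
have := measurable_fun_ltr mF (measurable_cst c).
by move=> /(_ measurableT [set true]) /(_ I); rewrite preimage_true.
Qed.

End lipschitz_measurable.

(** * Partial derivatives *)

Lemma scaleRE (R : realType) (a b : R) : a *: b = a * b.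
Proof. by []. Qed.

(** A directional derivative sees only the restriction of the function to a line. This transports
    derivatives between lines, slices and translates. *)
Lemma is_derive_eqfun (R : realType) (V W : normedModType R) (f : V -> R) x v
    (g : W -> R) y w d :
  (forall h : R, f (h *: v + x) = g (h *: w + y)) ->
  is_derive x v f d -> is_derive y w g d.
Proof.
move=> fg [h1 h2].
have E : (fun h => h^-1 *: ((f \o shift x) (h *: v) - f x)) =
    (fun h => h^-1 *: ((g \o shift y) (h *: w) - g y)).
  apply/funext => h /=; rewrite fg; congr (_ *: (_ - _)).
  by have := fg 0; rewrite !scale0r !add0r.
by split; [move: h1; rewrite /derivable E|move: h2; rewrite /derive E].
Qed.

Section line_derivatives.
Context {R : realType} {V : normedModType R}.
Implicit Types (f : V -> R) (x v : V).

Lemma is_derive_line f x v (s d : R) : is_derive (x + s *: v) v f d ->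
  is_derive s 1 (fun s => f (x + s *: v)) d.
Proof.
apply: is_derive_eqfun => h.
by rewrite [h *: 1]mulr1 scalerDl addrA [in RHS]addrA [in RHS](addrC x).
Qed.

Lemma is_derive_comp1 (h : R -> R) f x v (dh df : R) :
  is_derive (f x) 1 h dh -> is_derive x v f df ->
  is_derive x v (h \o f) (dh * df).
Proof.
move=> hh hf.
have hl : is_derive (0 : R) 1 (fun s => f (x + s *: v)) df.
  by apply: is_derive_line; rewrite scale0r addr0.
have hh' : is_derive (f (x + (0 : R) *: v)) 1 h dh by rewrite scale0r addr0.
have := @is_derive1_comp _ h (fun s => f (x + s *: v)) 0 dh df hh' hl.
by apply: is_derive_eqfun => s; rewrite /= addr0 [s *: 1]mulr1 addrC.
Qed.

Lemma mean_value_line f x v (L : R) (df : V -> R) :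
  (forall y, is_derive y v f (df y)) -> (forall y, `|df y| <= L) ->
  forall s : R, `|f (x + s *: v) - f x| <= L * `|s|.
Proof.
move=> hd hL s; set g := fun s => f (x + s *: v).
have g0 : f x = g 0 by rewrite /g scale0r addr0.
have gd (t : R) : is_derive t 1 g (df (x + t *: v)) by exact: is_derive_line.
have gc : continuous g.
  by move=> t; apply/differentiable_continuous/derivable1_diffP; exact: (@ex_derive _ _ _ _ _ _ _ (gd t)).
rewrite g0 -/(g s).
have [s0|s0] := leP 0 s.
  have [c _ ->] := MVT_segment s0 (fun t _ => gd t) (continuous_subspaceT gc).
  by rewrite subr0 normrM ler_wpM2r.
have [c _] := MVT_segment (ltW s0) (fun t _ => gd t) (continuous_subspaceT gc).
by rewrite sub0r distrC => ->; rewrite normrM normrN ler_wpM2r.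
Qed.

End line_derivatives.

Section coordinate_lipschitz.
Context {R : realType} {n : nat}.

(** Move from [y] to [x] one coordinate at a time, each move being a mean value estimate in one
    variable. Only derivatives along the axes are assumed, which is what [schwartz] provides; the
    resulting l1 modulus is the one expected by [lipschitz_measurable]. *)
Lemma partial_lipschitz (g : 'rV[R]_n -> R) (dg : 'I_n -> 'rV[R]_n -> R) (L : R) :
  (forall i y, is_derive y (delta_mx 0 i) g (dg i y)) ->
  (forall i y, `|dg i y| <= L) ->
  forall x y, `|g x - g y| <= L * \sum_(i < n) `|x 0 i - y 0 i|.
Proof.
move=> hd hL x y.
(* The first [k] coordinates come from [x], the others from [y]. *)
pose z (k : nat) : 'rV[R]_n := \row_j if (j < k)%N then x 0 j else y 0 j.
have zn : z n = x by apply/rowP => j; rewrite mxE ltn_ord.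
have z0 : z 0%N = y by apply/rowP => j; rewrite mxE ltn0.
have zS (k : 'I_n) : z k.+1 = z k + (x 0 k - y 0 k) *: delta_mx 0 k.
  apply/rowP => j; rewrite !mxE eqxx/= ltnS leq_eqVlt.
  have [->|jk] := eqVneq j k; first by rewrite eqxx ltnn/= mulr1 subrKC.
  have -> : (j == k :> nat) = false by apply/negbTE; rewrite -val_eqE in jk.
  by rewrite /= mulr0 addr0.
have -> : g x - g y = g (z n) - g (z 0%N) by rewrite zn z0.
rewrite -(telescope_sumr (fun k => g (z k))) // big_mkord mulr_sumr.
apply: le_trans (ler_norm_sum _ _ _) _; apply: ler_sum => k _.
rewrite zS; exact: (mean_value_line (z k) (hd k) (hL k)).
Qed.

End coordinate_lipschitz.

Section is_partial.
Context {R : realType} {n : nat}.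
Local Notation C := R[i].
Local Notation E := 'rV[R]_n.
Local Notation e_ i := (delta_mx 0 i : E).
Implicit Types (f g : E -> C) (x : E) (i : 'I_n).

Definition is_partial i f x (c : C) :=
  is_derive x (e_ i) (fun y => complex.Re (f y)) (complex.Re c) /\
  is_derive x (e_ i) (fun y => complex.Im (f y)) (complex.Im c).

Lemma is_partialE i f x c : is_partial i f x c ->
  cderivable f x (e_ i) /\ partial i f x = c.
Proof.
by move=> [[h1 e1] [h2 e2]]; split; [split|apply: complex_ext; rewrite /partial /= ?e1 ?e2].
Qed.

Lemma is_partialP i f x : cderivable f x (e_ i) -> is_partial i f x (partial i f x).
Proof. by move=> [h1 h2]; split; exact: derivableP. Qed.

Lemma is_partial_cst i (c : C) x : is_partial i (fun=> c) x 0.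
Proof. by split; exact: is_derive_cst. Qed.

Lemma is_partialD i f g x c d : is_partial i f x c -> is_partial i g x d ->
  is_partial i (fun y => f y + g y) x (c + d).
Proof.
move=> [f1 f2] [g1 g2]; split; rewrite ?ReD ?ImD.
  by under eq_fun do rewrite ReD; exact: is_deriveD f1 g1.
by under eq_fun do rewrite ImD; exact: is_deriveD f2 g2.
Qed.

Lemma is_partialM i f g x c d : is_partial i f x c -> is_partial i g x d ->
  is_partial i (fun y => f y * g y) x (c * g x + f x * d).
Proof.
move=> [f1 f2] [g1 g2]; split.
  under eq_fun do rewrite ReM.
  have h := is_deriveB (is_deriveM f1 g1) (is_deriveM f2 g2).
  by apply: is_derive_eq h _; rewrite !scaleRE !ReImE /=; ring.
under eq_fun do rewrite ImM.
have h := is_deriveD (is_deriveM f1 g2) (is_deriveM f2 g1).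
by apply: is_derive_eq h _; rewrite !scaleRE !ReImE /=; ring.
Qed.

Lemma is_partialZ i (a : C) f x c : is_partial i f x c ->
  is_partial i (fun y => a * f y) x (a * c).
Proof.
move=> fc; have := is_partialM (is_partial_cst i a x) fc.
by rewrite mul0r add0r.
Qed.

Lemma is_partialJ i f x c : is_partial i f x c ->
  is_partial i (fun y => conjc (f y)) x (conjc c).
Proof.
move=> [f1 f2]; split; rewrite ?ReJ ?ImJ.
  by under eq_fun do rewrite ReJ.
by under eq_fun do rewrite ImJ; exact: is_deriveN.
Qed.

Lemma is_partialR i (g : E -> R) x (d : R) : is_derive x (e_ i) g d ->
  is_partial i (fun y => (g y)%:C) x d%:C.
Proof. by move=> h; split => //=; exact: is_derive_cst. Qed.

Lemma is_derive_coord i (j : 'I_n) x : is_derive x (e_ i) (fun y : E => y 0 j) ((i == j)%:R : R).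
Proof.
have h : is_derive (0 : R) 1 (fun s : R => x 0 j + s * (i == j)%:R) ((i == j)%:R).
  have h1 := is_deriveD (is_derive_cst (x 0 j) (0 : R) 1)
    (is_deriveM (is_derive_id (0 : R) 1) (is_derive_cst ((i == j)%:R : R) (0 : R) 1)).
  by apply: is_derive_eq h1 _; rewrite !scaleRE /=; ring.
apply: is_derive_eqfun h => s.
by rewrite !mxE eqxx /= addr0 [s *: 1]mulr1 addrC eq_sym.
Qed.

Lemma is_derive_dot i (y x : E) : is_derive x (e_ i) (fun z => dot z y) (y 0 i).
Proof.
have -> : (fun z => dot z y) = \sum_(j < n) (fun z : E => z 0 j * y 0 j).
  by apply/funext => z; rewrite fct_sumE.
apply: is_derive_eq.
  apply: is_derive_sum => j; exact: (is_deriveM (is_derive_coord i j x) (is_derive_cst (y 0 j) x (e_ i))).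
rewrite (bigD1 i)//= big1 ?addr0 => [|j ji].
  by rewrite !scaleRE eqxx /=; ring.
by rewrite !scaleRE eq_sym (negbTE ji) /=; ring.
Qed.

Lemma is_derive_sqnorm i (x : E) : is_derive x (e_ i) (fun z => dot z z) (2 * x 0 i).
Proof.
have -> : (fun z : E => dot z z) = \sum_(j < n) (fun z : E => z 0 j * z 0 j).
  by apply/funext => z; rewrite fct_sumE.
apply: is_derive_eq.
  apply: is_derive_sum => j; exact: (is_deriveM (is_derive_coord i j x) (is_derive_coord i j x)).
rewrite (bigD1 i)//= big1 ?addr0 => [|j ji].
  by rewrite !scaleRE eqxx /=; ring.
by rewrite !scaleRE eq_sym (negbTE ji) /=; ring.
Qed.

End is_partial.

(** * Schwartz functions *)

Section schwartz_space.
Context {R : realType} {n : nat}.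
Local Notation C := R[i].
Local Notation E := 'rV[R]_n.
Implicit Types (f g : E -> C) (x y : E) (i : 'I_n).

Lemma dotC x y : dot x y = dot y x.
Proof. by apply: eq_bigr => i _; rewrite mulrC. Qed.

Lemma dot_ge0 x : 0 <= dot x x.
Proof. by apply: sumr_ge0 => i _; rewrite -expr2 sqr_ge0. Qed.

Lemma enorm_ge0 x : 0 <= enorm x.
Proof. exact: sqrtr_ge0. Qed.

Lemma enorm2E x : enorm x ^+ 2 = dot x x.
Proof. by rewrite sqr_sqrtr// dot_ge0. Qed.

Lemma coord_le_enorm i x : `|x 0 i| <= enorm x.
Proof.
rewrite -(ler_sqr (normr_ge0 _) (enorm_ge0 _)) enorm2E real_normK ?num_real//.
rewrite /dot (bigD1 i)//= expr2 lerDl; apply: sumr_ge0 => j _.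
by rewrite -expr2 sqr_ge0.
Qed.

Definition decay f := forall k : nat, exists M : R, forall x,
  (1 + enorm x) ^+ k * normc (f x) <= M.

Lemma decay_le f g (c : R) (j : nat) : 0 <= c ->
  (forall x, normc (g x) <= c * ((1 + enorm x) ^+ j * normc (f x))) ->
  decay f -> decay g.
Proof.
move=> c0 gf df k; have [M hM] := df (k + j)%N; exists (c * M) => x.
apply: (@le_trans _ _ ((1 + enorm x) ^+ k * (c * ((1 + enorm x) ^+ j * normc (f x))))).
  by rewrite ler_wpM2l// exprn_ge0// addr_ge0// enorm_ge0.
rewrite mulrCA ler_wpM2l// mulrA -exprD; exact: hM.
Qed.

Lemma decayD f g : decay f -> decay g -> decay (fun x => f x + g x).
Proof.
move=> df dg k; have [M hM] := df k; have [N hN] := dg k; exists (M + N) => x.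
apply: le_trans (lerD (hM x) (hN x)); rewrite -mulrDr ler_wpM2l ?le_normcD//.
by rewrite exprn_ge0// addr_ge0// enorm_ge0.
Qed.

Lemma decayZ (a : C) f : decay f -> decay (fun x => a * f x).
Proof.
apply: (@decay_le _ _ (normc a) 0%N); first exact: normc_ge0.
by move=> x; rewrite expr0 mul1r normcM.
Qed.

Lemma decay_coord i f : decay f -> decay (fun x => (x 0 i)%:C * f x).
Proof.
apply: (@decay_le _ _ 1 1%N) => // x.
rewrite mul1r expr1 normcM normcR ler_wpM2r ?normc_ge0//.
by apply: le_trans (coord_le_enorm i x) _; rewrite lerDr.
Qed.

(** A coinduction principle: it suffices to exhibit a class of decaying functions containing the
    partial derivatives of its members, and no formula for an iterated derivative is ever
    written. *)
Lemma schwartz_coind (A : (E -> C) -> Prop) :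
  (forall f, A f -> decay f /\
     forall i, exists g, A g /\ forall x, is_partial i f x (g x)) ->
  forall f, A f -> schwartz f.
Proof.
move=> hA f Af.
have hd g i : A g -> A (partial i g) /\ forall x, cderivable g x (delta_mx 0 i).
  move=> Ag; have [_ /(_ i) [h [Ah hh]]] := hA _ Ag.
  have -> : partial i g = h by apply/funext => x; exact: (is_partialE (hh x)).2.
  by split => // x; exact: (is_partialE (hh x)).1.
have Aps s : A (partials s f).
  by elim: s => [//|i s IH]; exact: (hd _ i IH).1.
split=> [s i x|s k]; first exact: (hd _ i (Aps s)).2.
exact: (hA _ (Aps s)).1.
Qed.

Lemma schwartz_partial f i : schwartz f -> schwartz (partial i f).
Proof.
move=> [h1 h2].
have e s : partials s (partial i f) = partials (rcons s i) f.
  by rewrite /partials foldr_rcons.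
by split=> [s j x|s k]; rewrite e; [exact: h1|exact: h2].
Qed.

Lemma schwartz_is_partial f i x : schwartz f -> is_partial i f x (partial i f x).
Proof. by move=> [h1 _]; apply: is_partialP; exact: (h1 [::]). Qed.

Lemma schwartz_decay f : schwartz f -> decay f.
Proof. by move=> [_ h2]; exact: (h2 [::]). Qed.

Lemma schwartzZD (a : C) f g : schwartz f -> schwartz g ->
  schwartz (fun x => a * f x + g x).
Proof.
move=> sf sg; pose A h := exists f g, [/\ schwartz f, schwartz g &
  h = (fun x => a * f x + g x)].
apply: (@schwartz_coind A); last by exists f, g.
move=> _ [{sf} f [{sg} g [sf sg ->]]]; split.
  by apply: decayD; [apply: decayZ|]; exact: schwartz_decay.
move=> i; exists (fun x => a * partial i f x + partial i g x); split.
  by exists (partial i f), (partial i g); split => //; exact: schwartz_partial.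
move=> x; apply: is_partialD; last exact: schwartz_is_partial.
by apply: is_partialZ; exact: schwartz_is_partial.
Qed.

Lemma schwartz0 : schwartz (fun _ : E => 0 : C).
Proof.
apply: (@schwartz_coind (fun h => h = fun=> 0)) => // _ ->; split.
  by move=> k; exists 0 => x; rewrite normc0 mulr0.
by move=> i; exists (fun=> 0); split => // x; exact: is_partial_cst.
Qed.

Lemma schwartzZ (a : C) f : schwartz f -> schwartz (fun x => a * f x).
Proof.
by move=> sf; have := schwartzZD a sf schwartz0; under eq_fun do rewrite addr0.
Qed.

Lemma schwartzD f g : schwartz f -> schwartz g -> schwartz (fun x => f x + g x).
Proof.
by move=> sf sg; have := schwartzZD 1 sf sg; under eq_fun do rewrite mul1r.
Qed.

Lemma schwartzB f g : schwartz f -> schwartz g -> schwartz (fun x => f x - g x).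
Proof.
move=> sf sg; have := schwartzZD (-1) sg sf.
by under eq_fun do rewrite mulN1r addrC.
Qed.

Lemma schwartzJ f : schwartz f -> schwartz (fun x => conjc (f x)).
Proof.
move=> sf; pose A h := exists2 f, schwartz f & h = (fun x => conjc (f x)).
apply: (@schwartz_coind A); last by exists f.
move=> _ [{sf} f sf ->]; split.
  apply: (@decay_le f _ 1 0%N) => //; last exact: schwartz_decay.
  by move=> x; rewrite normcJ mul1r expr0 mul1r.
move=> i; exists (fun x => conjc (partial i f x)); split.
  by exists (partial i f) => //; exact: schwartz_partial.
by move=> x; apply: is_partialJ; exact: schwartz_is_partial.
Qed.

Lemma is_partial_coord i j f x c : is_partial i f x c ->
  is_partial i (fun y => (y 0 j)%:C * f y) x ((i == j)%:R%:C * f x + (x 0 j)%:C * c).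
Proof. by apply: is_partialM; apply: is_partialR; exact: is_derive_coord. Qed.

Lemma schwartz_coord j f : schwartz f -> schwartz (fun x => (x 0 j)%:C * f x).
Proof.
(* The summand [g] makes the class stable: differentiating [x_j f] also produces a term [f] when the
   direction is [j]. *)
move=> sf; pose A h := exists f g, [/\ schwartz f, schwartz g &
  h = (fun x => (x 0 j)%:C * f x + g x)].
apply: (@schwartz_coind A); last first.
  exists f, (fun=> 0); split => //; first exact: schwartz0.
  by apply/funext => x; rewrite addr0.
move=> _ [{sf} f [g [sf sg ->]]]; split.
  by apply: decayD; [apply: decay_coord|]; exact: schwartz_decay.
move=> i; exists (fun x => (x 0 j)%:C * partial i f x +
    ((i == j)%:R%:C * f x + partial i g x)); split.
  exists (partial i f), (fun x => (i == j)%:R%:C * f x + partial i g x).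
  by split => //; [exact: schwartz_partial|apply: schwartzZD => //; exact: schwartz_partial].
move=> x; rewrite addrA [_ + (i == j)%:R%:C * f x]addrC.
apply: is_partialD; last exact: schwartz_is_partial.
by apply: is_partial_coord; exact: schwartz_is_partial.
Qed.

Lemma schwartz_sum (I : Type) (s : seq I) (F : I -> E -> C) :
  (forall j, schwartz (F j)) -> schwartz (fun x => \sum_(j <- s) F j x).
Proof.
move=> sF; elim: s => [|j s IH].
  by under eq_fun do rewrite big_nil; exact: schwartz0.
by under eq_fun do rewrite big_cons; exact: schwartzD.
Qed.

Lemma schwartz_sqnorm f : schwartz f -> schwartz (fun x => (dot x x)%:C * f x).
Proof.
move=> sf.
have -> : (fun x => (dot x x)%:C * f x) =
    (fun x => \sum_(i < n) ((x 0 i)%:C * ((x 0 i)%:C * f x))).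
  apply/funext => x; rewrite /dot rmorph_sum/= mulr_suml.
  by apply: eq_bigr => i _; rewrite mulrA -rmorphM.
by apply: schwartz_sum => i; do 2!apply: schwartz_coord.
Qed.

Lemma schwartz_laplacian f : schwartz f -> schwartz (laplacian f).
Proof.
by move=> sf; apply: schwartz_sum => i; do 2!apply: schwartz_partial.
Qed.

(** The character exp(-i x.y), in the form in which it occurs in [fourier], so that [fourierE] holds
    by conversion. *)
Definition expi (y x : E) : C := cos (dot x y) -i* sin (dot x y).

Lemma normc_expi y x : normc (expi y x) = 1.
Proof. by rewrite /= sqrrN cos2Dsin2 sqrtr1. Qed.

Lemma is_partial_expi i y x : is_partial i (expi y) x ((0 -i* (y 0 i)) * expi y x).
Proof.
have h := is_derive_dot i y x; split => /=.
  have := is_derive_comp1 (f := fun z => dot z y) (is_derive_cos (dot x y)) h.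
  by move=> h'; apply: is_derive_eq h' _; ring.
have := is_deriveN (is_derive_comp1 (f := fun z => dot z y) (is_derive_sin (dot x y)) h).
by move=> h'; apply: is_derive_eq h' _; ring.
Qed.

Lemma schwartz_expi y f : schwartz f -> schwartz (fun x => expi y x * f x).
Proof.
move=> sf; pose A h := exists2 f, schwartz f & h = (fun x => expi y x * f x).
apply: (@schwartz_coind A); last by exists f.
move=> _ [{sf} f sf ->]; split.
  apply: (@decay_le f _ 1 0%N) => //; last exact: schwartz_decay.
  by move=> x; rewrite normcM normc_expi expr0 !mul1r.
move=> i; exists (fun x => expi y x * ((0 -i* (y 0 i)) * f x + partial i f x)); split.
  exists (fun x => (0 -i* (y 0 i)) * f x + partial i f x) => //.
  by apply: schwartzZD => //; exact: schwartz_partial.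
move=> x; rewrite mulrDr mulrA [_ * (0 -i* _)]mulrC.
by apply: is_partialM; [exact: is_partial_expi|exact: schwartz_is_partial].
Qed.

Lemma schwartz_bounded f : schwartz f -> exists2 M : R, 0 <= M & forall x, normc (f x) <= M.
Proof.
move=> /schwartz_decay /(_ 0%N) [M hM]; exists `|M| => // x.
by apply: le_trans (ler_norm _); have := hM x; rewrite expr0 mul1r.
Qed.

Lemma schwartz_lipschitz f : schwartz f -> exists2 L : R, 0 <= L & forall x y,
  `|complex.Re (f x) - complex.Re (f y)| <= L * \sum_(i < n) `|x 0 i - y 0 i| /\
  `|complex.Im (f x) - complex.Im (f y)| <= L * \sum_(i < n) `|x 0 i - y 0 i|.
Proof.
move=> sf.
have /choice[M hM] : forall i, exists M : R, forall x, normc (partial i f x) <= M.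
  by move=> i; have [M _ hM] := schwartz_bounded (schwartz_partial i sf); exists M.
pose L := \sum_i `|M i|; exists L; first exact: sumr_ge0.
have hL i x : normc (partial i f x) <= L.
  apply: le_trans (hM i x) (le_trans (ler_norm _) _).
  by rewrite /L (bigD1 i)//= lerDl sumr_ge0.
move=> x y; split.
  apply: (partial_lipschitz (g := fun x => complex.Re (f x))
      (dg := fun i x => complex.Re (partial i f x))).
    by move=> i z; exact: (schwartz_is_partial i z sf).1.
  by move=> i z; exact: le_trans (Re_le_normc _) _.
apply: (partial_lipschitz (g := fun x => complex.Im (f x))
    (dg := fun i x => complex.Im (partial i f x))).
  by move=> i z; exact: (schwartz_is_partial i z sf).2.
by move=> i z; exact: le_trans (Im_le_normc _) _.
Qed.

(** Bounded partial derivatives give an l1 Lipschitz bound, and this gives measurability for the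
    product structure on tuples. *)
Lemma schwartz_cmeas f : schwartz f -> cmeas (fun t => f (point t)).
Proof.
move=> /schwartz_lipschitz [L L0 hL]; split.
  by apply: (lipschitz_measurable (g := fun x => complex.Re (f x)) L0) => x y; exact: (hL x y).1.
by apply: (lipschitz_measurable (g := fun x => complex.Im (f x)) L0) => x y; exact: (hL x y).2.
Qed.

Lemma wtV_le (t : n.-tuple R) : (wt t)^-1 <= (1 + enorm (point t)) ^+ (n * 2).
Proof.
rewrite /wt prodfV invrK [in leRHS]mulnC exprM.
rewrite -[X in _ ^+ X](card_ord n) -prodr_const.
apply: ler_prod => i _; rewrite addr_ge0 ?sqr_ge0//=.
have := coord_le_enorm i (point t); rewrite mxE => h.
rewrite sqrrD expr1n mul1r -addrA lerD2l.
have h2 : tnth t i ^+ 2 <= enorm (point t) ^+ 2.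
  by rewrite -(real_normK (num_real (tnth t i))) ler_sqr ?nnegrE ?enorm_ge0.
by apply: le_trans h2 _; rewrite lerDr mulrn_wge0// enorm_ge0.
Qed.

Lemma decay_wt f k : decay f -> exists2 M : R, 0 <= M &
  forall t, (1 + enorm (point t)) ^+ k * normc (f (point t)) <= M * wt t.
Proof.
move=> df; have [M hM] := df (n * 2 + k)%N; exists `|M| => // t.
rewrite -ler_pdivrMr ?wt_gt0//.
apply: le_trans (le_trans (hM (point t)) (ler_norm _)).
rewrite exprD [leLHS]mulrC mulrA ler_wpM2r ?normc_ge0// ler_wpM2r ?wtV_le//.
by rewrite exprn_ge0// addr_ge0// enorm_ge0.
Qed.

Lemma schwartz_wt f : schwartz f -> exists2 M : R, 0 <= M &
  forall t, normc (f (point t)) <= M * wt t.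
Proof.
move=> /schwartz_decay /(decay_wt 0) [M M0 hM]; exists M => // t.
by have := hM t; rewrite expr0 mul1r.
Qed.

Lemma schwartz_cinteg f : schwartz f -> cinteg (leb R n) (fun t => f (point t)).
Proof.
move=> sf; have [M _ hM] := schwartz_wt sf.
exact: cinteg_le (schwartz_cmeas sf) (rintZ M (rint_wt n)) hM.
Qed.

Lemma wt_le1 (t : n.-tuple R) : wt t <= 1.
Proof.
apply: (@le_trans _ _ (\prod_(i < n) 1)); last by rewrite big1.
apply: ler_prod => i _; rewrite invr_ge0 addr_ge0 ?sqr_ge0//=.
by rewrite invf_le1 ?ltr_pwDl ?sqr_ge0// lerDl sqr_ge0.
Qed.

Lemma schwartz_sqi f : schwartz f -> sqi (leb R n) (fun t => f (point t)).
Proof.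
move=> sf; have [M M0 hM] := schwartz_wt sf.
apply: (sqi_le (schwartz_cmeas sf) (rintZ (M ^+ 2) (rint_wt n))) => t.
apply: (@le_trans _ _ ((M * wt t) ^+ 2)).
  by rewrite ler_sqr ?nnegrE ?normc_ge0 ?mulr_ge0 ?(ltW (wt_gt0 t)).
rewrite exprMn ler_wpM2l ?sqr_ge0// expr2.
by rewrite ler_piMl ?wt_le1 ?(ltW (wt_gt0 t)).
Qed.

End schwartz_space.

Section partial_computations.
Context {R : realType} {n : nat}.
Local Notation C := R[i].
Local Notation E := 'rV[R]_n.
Implicit Types (f g : E -> C) (x y : E) (i : 'I_n).

Lemma partial_eq f g i : (forall x, is_partial i f x (g x)) -> partial i f = g.
Proof. by move=> h; apply/funext => x; exact: (is_partialE (h x)).2. Qed.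

Lemma partial_expi y f i : schwartz f -> partial i (fun x => expi y x * f x) =
  (fun x => expi y x * partial i f x - (0 +i* (y 0 i)) * (expi y x * f x)).
Proof.
move=> sf; apply: partial_eq => x.
rewrite [_ - _]addrC.
have -> : - ((0 +i* (y 0 i)) * (expi y x * f x)) = (0 -i* (y 0 i)) * expi y x * f x.
  by rewrite -mulNr mulrA; congr (_ * _ * _); apply: complex_ext; rewrite /= ?oppr0.
by apply: is_partialM; [exact: is_partial_expi|exact: schwartz_is_partial].
Qed.

End partial_computations.

(** * Integrals of partial derivatives *)

Section slices.
Context {R : realType} {n : nat}.
Local Notation C := R[i].

Definition consr (x : R) (y : 'rV[R]_n) : 'rV[R]_n.+1 :=
  \row_i oapp (y 0) x (unlift ord0 i).

Lemma consr0 x y : consr x y 0 ord0 = x.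
Proof. by rewrite mxE unlift_none. Qed.

Lemma consrS x y (j : 'I_n) : consr x y 0 (lift ord0 j) = y 0 j.
Proof. by rewrite mxE liftK. Qed.

Lemma consr_ext (u v : 'rV[R]_n.+1) : u 0 ord0 = v 0 ord0 ->
  (forall j : 'I_n, u 0 (lift ord0 j) = v 0 (lift ord0 j)) -> u = v.
Proof. by move=> h0 hS; apply/rowP => i; case: (unliftP ord0 i) => [j|] ->. Qed.

Lemma consr_surj (u : 'rV[R]_n.+1) : u = consr (u 0 ord0) (\row_j u 0 (lift ord0 j)).
Proof. by apply: consr_ext => [|j]; rewrite ?consr0// consrS mxE. Qed.

Lemma point_consR (z : measurableTypeR R * n.-tuple R) :
  point (consR z) = consr z.1 (point z.2).
Proof.
apply: consr_ext => [|j]; rewrite ?consr0 ?consrS !mxE.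
  by rewrite (tnth_nth 0).
by rewrite !(tnth_nth 0).
Qed.

Lemma dot_consr x y a b : dot (consr x y) (consr a b) = x * a + dot y b.
Proof.
rewrite /dot big_ord_recl !consr0; congr (_ + _).
by apply: eq_bigr => j _; rewrite !consrS.
Qed.

Lemma enorm_consr x y : enorm y <= enorm (consr x y).
Proof. by rewrite ler_wsqrtr// dot_consr lerDr -expr2 sqr_ge0. Qed.

Lemma is_derive_head (g : 'rV[R]_n.+1 -> R) x y d :
  is_derive (consr x y) (delta_mx 0 ord0) g d ->
  is_derive x 1 (fun s => g (consr s y)) d.
Proof.
apply: is_derive_eqfun => h; congr g.
apply: consr_ext => [|j]; rewrite !mxE ?unlift_none ?liftK /= ?eqxx.
  by [].
by rewrite mulr0 add0r.
Qed.

Lemma is_derive_tail (g : 'rV[R]_n.+1 -> R) x y j d :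
  is_derive (consr x y) (delta_mx 0 (lift ord0 j)) g d ->
  is_derive y (delta_mx 0 j) (fun y => g (consr x y)) d.
Proof.
apply: is_derive_eqfun => h; congr g.
apply: consr_ext => [|k]; rewrite !mxE ?unlift_none ?liftK /= ?mxE ?eqxx.
  by rewrite mulr0 add0r.
by rewrite (inj_eq lift_inj).
Qed.

Lemma is_partial_tail (f : 'rV[R]_n.+1 -> C) x y j c :
  is_partial (lift ord0 j) f (consr x y) c -> is_partial j (fun y => f (consr x y)) y c.
Proof.
by move=> [h1 h2]; split;
  [exact: (is_derive_tail (g := fun u => complex.Re (f u)) h1)
  |exact: (is_derive_tail (g := fun u => complex.Im (f u)) h2)].
Qed.

Lemma schwartz_slice x (f : 'rV[R]_n.+1 -> C) : schwartz f ->
  schwartz (fun y => f (consr x y)).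
Proof.
move=> sf; pose A h := exists2 f : 'rV[R]_n.+1 -> C, schwartz f & h = (fun y => f (consr x y)).
apply: (@schwartz_coind _ _ A); last by exists f.
move=> _ [{sf} f sf ->]; split.
  move=> k; have [M hM] := schwartz_decay sf k; exists M => y.
  apply: le_trans (hM (consr x y)); rewrite ler_wpM2r ?normc_ge0//.
  by rewrite lerXn2r ?nnegrE ?addr_ge0 ?enorm_ge0// lerD2l enorm_consr.
move=> j; exists (fun y => partial (lift ord0 j) f (consr x y)); split.
  by exists (partial (lift ord0 j) f) => //; exact: schwartz_partial.
by move=> y; apply: is_partial_tail; exact: schwartz_is_partial.
Qed.

Lemma partial_slice x (f : 'rV[R]_n.+1 -> C) j : schwartz f ->
  partial j (fun y => f (consr x y)) = fun y => partial (lift ord0 j) f (consr x y).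
Proof.
move=> sf; apply: partial_eq => y.
by apply: is_partial_tail; exact: schwartz_is_partial.
Qed.

Lemma oneDsqr_le_enorm x y : 1 + x ^+ 2 <= (1 + enorm (consr x y)) ^+ 2.
Proof.
have := coord_le_enorm ord0 (consr x y); rewrite consr0 => h.
have h2 : x ^+ 2 <= enorm (consr x y) ^+ 2.
  by rewrite -(real_normK (num_real x)) ler_sqr ?nnegrE ?enorm_ge0.
have := enorm_ge0 (consr x y); rewrite sqrrD expr1n mul1r; lra.
Qed.

(** The bound is integrable in [x] and uniform in [y], which is what integration along the lines
    parallel to the first axis requires. *)
Lemma schwartz_head (f : 'rV[R]_n.+1 -> C) : schwartz f ->
  exists2 M, 0 <= M & forall x y, normc (f (consr x y)) <= M * (1 + x ^+ 2)^-1.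
Proof.
move=> sf; have [M hM] := schwartz_decay sf 2; exists `|M| => // x y.
rewrite ler_pdivlMr ?ltr_pwDl ?sqr_ge0//.
apply: le_trans (le_trans (hM (consr x y)) (ler_norm _)).
by rewrite mulrC ler_wpM2r ?normc_ge0 ?oneDsqr_le_enorm.
Qed.

End slices.

Section integral_derivative.
Context {R : realType}.
Local Notation mu := (@lebesgue_measure R).

Lemma is_derive_continuous (g dg : R -> R) :
  (forall x : R, is_derive x 1 g (dg x)) -> continuous g.
Proof.
move=> gd t; apply/differentiable_continuous/derivable1_diffP.
exact: (@ex_derive _ _ _ _ _ _ _ (gd t)).
Qed.

Lemma Rint_segment_cvg (f : R -> R) : rint mu f ->
  (\int[mu]_(x in `[- (k.+1%:R), k.+1%:R]) f x) @[k --> \oo] --> \int[mu]_x f x.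
Proof.
move=> fi; have mf := rint_measurable fi.
pose I k : set R := `[- (k.+1%:R), k.+1%:R]%classic.
have mI k : measurable (I k) by exact: measurable_itv.
have ri k : rint mu (fun x => f x * \1_(I k) x).
  apply: (rint_le _ (rint_norm fi)).
    apply: (measurable_funM mf); exact: measurable_indic (mI k).
  by move=> x; rewrite normrM ler_piMr// indicE; case: (_ \in _); rewrite ?normr1 ?normr0.
have E k : \int[mu]_(x in I k) f x = \int[mu]_x (f x * \1_(I k) x).
  rewrite Rintegral_mkcond; apply: eq_Rintegral => x _.
  by rewrite patchE indicE; case: (_ \in _); rewrite ?mulr1 ?mulr0.
apply/subr_cvg0; apply: norm_cvg0.
have h : (\int[mu]_x `|f x - f x * \1_(I k) x|) @[k --> \oo] --> (0 : R).
  apply: (@rdct0 _ _ _ mu (fun k x => `|f x - f x * \1_(I k) x|) (fun x => `|f x|)).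
  - move=> k; apply: measurableT_comp => //; apply: measurable_funB => //.
    exact: rint_measurable (ri k).
  - exact: rint_norm.
  - move=> k x; rewrite normr_ge0/= indicE.
    by case: (_ \in _); rewrite ?mulr1n ?mulr0n ?mulr1 ?mulr0 ?subrr ?subr0 ?normr0.
  move=> x; apply/norm_cvg0P; rewrite -[X in _ --> X](subrr (f x)).
  apply: cvgB; first exact: cvg_cst.
  apply: cvg_near_cst.
  have [N _ hN] := nbhs_infty_gtr `|x|.
  exists N => // k /= Nk; rewrite indicE mem_set ?mulr1// /I /= in_itv/=.
  rewrite -ler_norml ltW//; apply: lt_le_trans (hN k Nk) _.
  by rewrite ler_nat.
apply: squeeze_cvgr (cvg_cst 0) h; apply: nearW => k.
rewrite normr_ge0/= -[X in `|X - _|]/(\int[mu]_(x in I k) f x) E distrC -RintB//.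
by apply: Rint_norm; exact: rintB.
Qed.

(** The integral over a symmetric segment is a difference of boundary values, and the assumed decay
    of [g] makes these tend to 0. *)
Lemma Rint_derive0 (g dg : R -> R) (M : R) :
  (forall x : R, is_derive x 1 g (dg x)) -> continuous dg -> rint mu dg ->
  (forall x, `|g x| <= M * (1 + x ^+ 2)^-1) -> \int[mu]_x dg x = 0.
Proof.
move=> gd dgc dgi gM; have gc := is_derive_continuous gd.
have hk (k : nat) : \int[mu]_(x in `[- (k.+1%:R), k.+1%:R]) dg x = g k.+1%:R - g (- k.+1%:R).
  have k0 : (0 : R) < k.+1%:R by rewrite ltr0n.
  rewrite /Rintegral (@continuous_FTC2 _ dg g)//.
  - by rewrite gtrN.
  - exact: continuous_subspaceT.
  - split.
    + by move=> x _; exact: (@ex_derive _ _ _ _ _ _ _ (gd x)).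
    + by apply: cvg_at_right_filter; exact: gc.
    + by apply: cvg_at_left_filter; exact: gc.
  - by move=> x _; rewrite derive1E; exact: (@derive_val _ _ _ _ _ _ _ (gd x)).
have c1 := Rint_segment_cvg dgi.
have c0 : (\int[mu]_(x in `[- (k.+1%:R), k.+1%:R]) dg x) @[k --> \oo] --> (0 : R).
  have h2 : (2 * M * k.+1%:R^-1) @[k --> \oo] --> (0 : R).
    by apply: cvgZ0; exact: cvg_harmonic.
  apply: norm_cvg0; apply: squeeze_cvgr (cvg_cst 0) h2; apply: nearW => k.
  have M0 : 0 <= M.
    by have := le_trans (normr_ge0 _) (gM 0); rewrite expr0n addr0 invr1 mulr1.
  rewrite normr_ge0/= hk; apply: le_trans (ler_normB _ _) _.
  have h3 : M * (1 + k.+1%:R ^+ 2)^-1 <= M * k.+1%:R^-1.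
    rewrite ler_wpM2l// lef_pV2 ?posrE ?ltr0n ?ltr_pwDl ?sqr_ge0//.
    apply: (@le_trans _ _ (k.+1%:R ^+ 2)); last by rewrite lerDr.
    by rewrite expr2 ler_pMr ?ltr0n// ler1n.
  rewrite -mulrA mulr_natl mulr2n; apply: lerD; first exact: le_trans (gM _) h3.
  by apply: le_trans (gM _) _; rewrite sqrrN.
by rewrite -(cvg_lim (@Rhausdorff R) c1) (cvg_lim (@Rhausdorff R) c0).
Qed.

End integral_derivative.

Section integral_partial.
Context {R : realType}.
Local Notation C := R[i].

Lemma schwartz_head_integral0 n (f : 'rV[R]_n.+1 -> C) y : schwartz f ->
  cI (@lebesgue_measure R) (fun x => partial ord0 f (consr x y)) = 0.
Proof.
move=> sf; have [M M0 hM] := schwartz_head sf.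
set df := partial ord0 f; have sdf : schwartz df by exact: schwartz_partial.
have [N N0 hN] := schwartz_head sdf.
have hd (h : 'rV[R]_n.+1 -> C) (sh : schwartz h) x := schwartz_is_partial ord0 (consr x y) sh.
have reD h (sh : schwartz h) x := is_derive_head (g := fun u => complex.Re (h u)) (hd h sh x).1.
have imD h (sh : schwartz h) x := is_derive_head (g := fun u => complex.Im (h u)) (hd h sh x).2.
have rec := is_derive_continuous (reD _ sdf).
have imc := is_derive_continuous (imD _ sdf).
have rri := rintZ N (@rint_oneDsqrV R).1.
apply: complex_ext => /=.
  apply: (Rint_derive0 (reD _ sf) rec (M := M)).
    apply: (rint_le _ rri); first exact: continuous_measurable_fun.
    by move=> x; exact: le_trans (Re_le_normc _) (hN x y).
  by move=> x; exact: le_trans (Re_le_normc _) (hM x y).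
apply: (Rint_derive0 (imD _ sf) imc (M := M)).
  apply: (rint_le _ rri); first exact: continuous_measurable_fun.
  by move=> x; exact: le_trans (Im_le_normc _) (hN x y).
by move=> x; exact: le_trans (Im_le_normc _) (hM x y).
Qed.

(** The only form of integration by parts used: it is applied to products, for the transform of a
    derivative and for Gaussian moments. *)
Lemma schwartz_integral_partial0 n (f : 'rV[R]_n -> C) i : schwartz f ->
  cI (leb R n) (fun t => partial i f (point t)) = 0.
Proof.
elim: n f i => [|n IH] f i sf; first by case: i.
have sdf := schwartz_partial i sf.
have ci := schwartz_cinteg sdf.
rewrite cI_leb_succ//; have ci2 := cinteg_leb_succV ci.
(* The order of integration depends on the direction: for a tail direction the inner integral over
   the tail vanishes by induction, for the head direction the inner integral over the line
   vanishes. *)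
case: (unliftP ord0 i) => [j|] ij; subst i.
  rewrite (cI_fubini ci2).2 -[RHS](cI0 (@lebesgue_measure R)).
  apply: eq_cI => x; rewrite -[RHS](IH (fun y => f (consr x y)) j); last exact: schwartz_slice.
  by apply: eq_cI => t; rewrite /= point_consR partial_slice.
rewrite (cI_fubini2 ci2).2 -[RHS](cI0 (leb R n)).
apply: eq_cI => t; rewrite -[RHS](schwartz_head_integral0 (point t) sf).
by apply: eq_cI => x; rewrite /= point_consR.
Qed.

End integral_partial.

(** * The Fourier transform on Schwartz functions *)

Section derivative_under_integral.
Context d (T : measurableType d) (R : realType).
Variable mu : {measure set T -> \bar R}.

Lemma is_derive_under (F dF : R -> T -> R) (G : T -> R) (a : R) :
  (forall s, rint mu (F s)) -> (forall (s : R) t, is_derive s 1 (F ^~ t) (dF s t)) ->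
  rint mu G -> (forall s t, `|dF s t| <= G t) ->
  is_derive a 1 (fun s => \int[mu]_t F s t) (\int[mu]_t dF a t).
Proof.
move=> Fi Fd Gi dFG.
have Ia : `](a - 1), (a + 1)[%classic a by rewrite /= in_itv/= ltrBlDr ltrDl ltr01.
have G0 t : 0 <= G t by exact: le_trans (normr_ge0 _) (dFG a t).
have dE x t : derive1 (F ^~ t) x = dF x t.
  by rewrite derive1E; exact: (@derive_val _ _ _ _ _ _ _ (Fd x t)).
have derf : forall x y, `](a - 1), (a + 1)[%classic x -> setT y -> derivable (F ^~ y) x 1.
  by move=> x t _ _; exact: (@ex_derive _ _ _ _ _ _ _ (Fd x t)).
have bnd : forall x y, `](a - 1), (a + 1)[%classic x -> setT y ->
    `|derive1 (F ^~ y) x| <= G y.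
  by move=> x t _ _; rewrite dE.
have h1 := @derivable_under_integral R d T mu F setT measurableT a (a - 1) (a + 1)
  Ia (fun x _ => Fi x) derf G G0 Gi bnd.
have h2 := @differentiation_under_integral R d T mu F setT measurableT a (a - 1) (a + 1)
  Ia (fun x _ => Fi x) derf G G0 Gi bnd.
split; first exact: h1.
rewrite -derive1E h2; apply: eq_Rintegral => t _; exact: dE.
Qed.

Lemma is_partial_under n (Phi dPhi : 'rV[R]_n -> T -> R[i]) (G : T -> R) i xi :
  (forall xi, cinteg mu (Phi xi)) ->
  (forall xi t, is_partial i (Phi ^~ t) xi (dPhi xi t)) ->
  rint mu G -> (forall xi t, normc (dPhi xi t) <= G t) ->
  is_partial i (fun xi => cI mu (Phi xi)) xi (cI mu (dPhi xi)).
Proof.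
move=> Pi Pd Gi PG.
have E0 (u : 'rV[R]_n) : xi + (0 : R) *: u = xi by rewrite scale0r addr0.
have L (g : 'rV[R]_n -> R) dd :
    is_derive (0 : R) 1 (fun s => g (xi + s *: delta_mx 0 i)) dd ->
    is_derive xi (delta_mx 0 i) g dd.
  apply: is_derive_eqfun => s.
  by rewrite addr0 [s *: 1]mulr1 addrC.
split; apply: L; rewrite /=.
  have := @is_derive_under (fun s t => complex.Re (Phi (xi + s *: delta_mx 0 i) t))
    (fun s t => complex.Re (dPhi (xi + s *: delta_mx 0 i) t)) G 0.
  rewrite E0; apply => //.
  - by move=> s; exact: (Pi _).1.
  - move=> s t.
    exact: (is_derive_line (f := fun u => complex.Re (Phi u t)) (Pd _ t).1).
  - by move=> s t; exact: le_trans (Re_le_normc _) (PG _ _).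
have := @is_derive_under (fun s t => complex.Im (Phi (xi + s *: delta_mx 0 i) t))
  (fun s t => complex.Im (dPhi (xi + s *: delta_mx 0 i) t)) G 0.
rewrite E0; apply => //.
- by move=> s; exact: (Pi _).2.
- move=> s t.
  exact: (is_derive_line (f := fun u => complex.Im (Phi u t)) (Pd _ t).2).
- by move=> s t; exact: le_trans (Im_le_normc _) (PG _ _).
Qed.

End derivative_under_integral.

Section fourier_schwartz.
Context {R : realType} {n : nat}.
Local Notation C := R[i].
Local Notation E := 'rV[R]_n.
Local Notation mu := (leb R n).
Implicit Types (f g : E -> C) (x y xi : E) (i : 'I_n).

Lemma fourierE f xi : fourier f xi = cI mu (fun t => expi xi (point t) * f (point t)).
Proof. by []. Qed.

Lemma expiC x y : expi x y = expi y x.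
Proof. by rewrite /expi dotC. Qed.

Lemma fourierZD (a : C) f g : schwartz f -> schwartz g ->
  fourier (fun x => a * f x + g x) = (fun xi => a * fourier f xi + fourier g xi).
Proof.
move=> sf sg; apply/funext => xi; rewrite !fourierE.
have i1 := schwartz_cinteg (schwartz_expi xi sf).
have i2 := schwartz_cinteg (schwartz_expi xi sg).
rewrite -cIZ// -cID//; last exact: cintegZ.
by apply: eq_cI => t; ring.
Qed.

Lemma fourier0 : fourier (fun _ : E => 0 : C) = fun=> 0.
Proof.
apply/funext => xi; rewrite fourierE -[RHS](cI0 mu).
by apply: eq_cI => t; rewrite mulr0.
Qed.

Lemma fourierZ (a : C) f : schwartz f ->
  fourier (fun x => a * f x) = (fun xi => a * fourier f xi).
Proof.
move=> sf; have := fourierZD a sf schwartz0; rewrite fourier0.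
under eq_fun do rewrite addr0.
by move=> ->; apply/funext => xi; rewrite addr0.
Qed.

Lemma fourierD f g : schwartz f -> schwartz g ->
  fourier (fun x => f x + g x) = (fun xi => fourier f xi + fourier g xi).
Proof.
move=> sf sg; have := fourierZD 1 sf sg.
under eq_fun do rewrite mul1r.
by move=> ->; apply/funext => xi; rewrite mul1r.
Qed.

Lemma fourier_sum (I : Type) (s : seq I) (F : I -> E -> C) :
  (forall j, schwartz (F j)) ->
  fourier (fun x => \sum_(j <- s) F j x) = (fun xi => \sum_(j <- s) fourier (F j) xi).
Proof.
move=> sF; elim: s => [|j s IH].
  under eq_fun do rewrite big_nil; rewrite fourier0.
  by apply/funext => xi; rewrite big_nil.
under eq_fun do rewrite big_cons; rewrite fourierD// ?IH; last exact: schwartz_sum.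
by apply/funext => xi; rewrite big_cons.
Qed.

(** The derivative of exp(-i x.xi) f(x) has integral 0; the two terms of its product rule are the
    two sides of the identity. *)
Lemma fourier_partial f i : schwartz f ->
  fourier (partial i f) = (fun xi => (0 +i* (xi 0 i)) * fourier f xi).
Proof.
move=> sf; apply/funext => xi; rewrite !fourierE.
have sef := schwartz_expi xi sf.
have := schwartz_integral_partial0 i sef; rewrite partial_expi//.
have i1 := schwartz_cinteg (schwartz_expi xi (schwartz_partial i sf)).
have i2 := schwartz_cinteg sef.
rewrite cIB//; last exact: cintegZ.
by rewrite cIZ// => /eqP; rewrite subr_eq0 => /eqP.
Qed.

Lemma fourier_laplacian f : schwartz f ->
  fourier (laplacian f) = (fun xi => - ((dot xi xi)%:C * fourier f xi)).
Proof.
move=> sf; rewrite /laplacian fourier_sum; last first.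
  by move=> i; do 2!apply: schwartz_partial.
apply/funext => xi.
rewrite /dot rmorph_sum/= mulr_suml -sumrN; apply: eq_bigr => i _.
rewrite !fourier_partial//; last exact: schwartz_partial.
rewrite mulrA -mulNr; congr (_ * _).
by apply: complex_ext; rewrite !ReImE /=; ring.
Qed.

Definition mulcoord i f : E -> C := fun x => (0 -i* 1) * ((x 0 i)%:C * f x).

Lemma schwartz_mulcoord i f : schwartz f -> schwartz (mulcoord i f).
Proof. by move=> sf; apply: schwartzZ; exact: schwartz_coord. Qed.

Lemma is_partial_fourier i f xi : schwartz f ->
  is_partial i (fourier f) xi (fourier (mulcoord i f) xi).
Proof.
move=> sf.
pose Phi xi (t : n.-tuple R) := expi xi (point t) * f (point t).
pose dPhi xi (t : n.-tuple R) := expi xi (point t) * mulcoord i f (point t).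
have Gi := cinteg_normc (schwartz_cinteg (schwartz_mulcoord i sf)).
apply: (@is_partial_under _ _ _ mu n Phi dPhi _ i xi _ _ Gi).
- by move=> {}xi; exact: schwartz_cinteg (schwartz_expi xi sf).
- move=> {}xi t; rewrite /Phi /dPhi.
  have h := is_partialM (is_partial_expi i (point t) xi)
    (is_partial_cst i (f (point t)) xi).
  have -> : (fun xi => expi xi (point t) * f (point t)) =
      (fun xi => expi (point t) xi * f (point t)).
    by apply/funext => u; rewrite expiC.
  suff -> : expi xi (point t) * mulcoord i f (point t) =
    (0 -i* (point t) 0 i) * expi (point t) xi * f (point t) + expi (point t) xi * 0 by [].
  rewrite mulr0 addr0 expiC /mulcoord.
  rewrite [_ * expi _ _]mulrC -mulrA; congr (_ * _); rewrite mulrA; congr (_ * _).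
  by apply: complex_ext; rewrite !ReImE /=; ring.
- by move=> {}xi t; rewrite /dPhi normcM normc_expi mul1r.
Qed.

Lemma partial_fourier i f : schwartz f ->
  partial i (fourier f) = fourier (mulcoord i f).
Proof. by move=> sf; apply: partial_eq => xi; exact: is_partial_fourier. Qed.

(** The operator 1 - Laplacian has symbol 1 + |xi|^2, so boundedness of the transform of its [k]-th
    iterate is decay of order [2k] of the transform itself. *)
Let onemlap f : E -> C := fun x => f x - laplacian f x.

Let schwartz_onemlap f : schwartz f -> schwartz (onemlap f).
Proof. by move=> sf; apply: schwartzB => //; exact: schwartz_laplacian. Qed.

Let fourier_onemlap f xi : schwartz f ->
  fourier (onemlap f) xi = (1 + dot xi xi)%:C * fourier f xi.
Proof.
move=> sf.
have -> : onemlap f = (fun x => -1 * laplacian f x + f x).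
  by apply/funext => x; rewrite mulN1r addrC.
rewrite fourierZD//; last exact: schwartz_laplacian.
by rewrite fourier_laplacian// rmorphD /=; ring.
Qed.

Lemma fourier_bounded f : schwartz f ->
  exists2 M : R, 0 <= M & forall xi, normc (fourier f xi) <= M.
Proof.
move=> sf; exists (\int[mu]_t normc (f (point t))).
  by apply: Rint_ge0 => t; exact: normc_ge0.
move=> xi; rewrite fourierE.
apply: le_trans (cI_norm (schwartz_cinteg (schwartz_expi xi sf))) _.
under eq_Rintegral do rewrite normcM normc_expi mul1r.
exact: lexx.
Qed.

Lemma fourier_decay f : schwartz f -> decay (fourier f).
Proof.
move=> sf k.
have [s e] : schwartz (iter k onemlap f) /\ forall xi,
    fourier (iter k onemlap f) xi = ((1 + dot xi xi) ^+ k)%:C * fourier f xi.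
  elim: k => [|k [s e]]; first by split => // xi; rewrite expr0 mul1r.
  split; first exact: schwartz_onemlap.
  by move=> xi; rewrite iterS fourier_onemlap// e mulrA -rmorphM -exprS.
(* The factor [2 ^+ k] comes from 1 + r <= 2 (1 + r^2). *)
have [M M0 hM] := fourier_bounded s; exists (2 ^+ k * M) => xi.
apply: le_trans (_ : _ <= 2 ^+ k * normc (fourier (iter k onemlap f) xi)) _; last first.
  by rewrite ler_wpM2l// exprn_ge0.
rewrite e normcM normcR mulrA ler_wpM2r ?normc_ge0//.
rewrite ger0_norm ?exprn_ge0 ?addr_ge0 ?dot_ge0// -exprMn.
rewrite lerXn2r ?nnegrE ?mulr_ge0 ?addr_ge0 ?dot_ge0 ?enorm_ge0//.
rewrite -enorm2E; have := sqr_ge0 (2 * enorm xi - 1); rewrite sqrrB exprMn.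
have := enorm_ge0 xi; nra.
Qed.

Lemma fourier_schwartz f : schwartz f -> schwartz (fourier f).
Proof.
move=> sf; pose A (h : E -> C) := exists2 f : E -> C, schwartz f & h = fourier f.
apply: (@schwartz_coind _ _ A); last by exists f.
move=> _ [{sf} f sf ->]; split; first exact: fourier_decay.
move=> i; exists (fourier (mulcoord i f)); split.
  by exists (mulcoord i f) => //; exact: schwartz_mulcoord.
by move=> xi; exact: is_partial_fourier.
Qed.

Lemma laplacian_fourier f : schwartz f ->
  laplacian (fourier f) = (fun xi => - fourier (fun x => (dot x x)%:C * f x) xi).
Proof.
move=> sf; have ss := schwartz_sqnorm sf.
have -> : (fun xi => - fourier (fun x => (dot x x)%:C * f x) xi) =
    (fun xi => -1 * fourier (fun x => (dot x x)%:C * f x) xi).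
  by apply/funext => xi; rewrite mulN1r.
rewrite -fourierZ//.
have -> : (fun x => -1 * ((dot x x)%:C * f x)) =
    (fun x => \sum_(i < n) mulcoord i (mulcoord i f) x).
  apply/funext => x; rewrite mulrA /dot rmorph_sum/= mulr_sumr mulr_suml.
  apply: eq_bigr => i _; rewrite /mulcoord !mulrA; congr (_ * _).
  by apply: complex_ext; rewrite !ReImE /=; ring.
rewrite fourier_sum; last by move=> i; do 2!apply: schwartz_mulcoord.
apply/funext => xi; apply: eq_bigr => i _.
by rewrite !partial_fourier//; exact: schwartz_mulcoord.
Qed.

End fourier_schwartz.

Section pairing.
Context {R : realType} {n : nat}.
Local Notation C := R[i].
Local Notation E := 'rV[R]_n.
Local Notation mu := (leb R n).
Implicit Types (f g : E -> C) (x y xi : E) (i : 'I_n).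

Lemma measurable_dot : measurable_fun setT
  (fun z : n.-tuple R * n.-tuple R => dot (point z.1) (point z.2)).
Proof.
rewrite /dot; under eq_fun do under eq_bigr do rewrite !mxE.
apply: measurable_sum => i; apply: measurable_funM.
  by apply: (@measurableT_comp _ _ _ _ _ _ (fun t : n.-tuple R => tnth t i)) => //; exact: measurable_tnth.
by apply: (@measurableT_comp _ _ _ _ _ _ (fun t : n.-tuple R => tnth t i)) => //; exact: measurable_tnth.
Qed.

Lemma measurable_sqnorm : measurable_fun setT (fun t : n.-tuple R => dot (point t) (point t)).
Proof.
rewrite /dot; under eq_fun do under eq_bigr do rewrite mxE.
apply: measurable_sum => i; apply: measurable_funM; exact: measurable_tnth.
Qed.

Lemma cmeas_expi d (T : measurableType d) (h : T -> R) : measurable_fun setT h ->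
  cmeas (fun t => cos (h t) -i* sin (h t)).
Proof.
move=> mh; split => /=.
  by apply: measurableT_comp mh; apply: continuous_measurable_fun; exact: continuous_cos.
apply: measurableT_comp => //; apply: measurableT_comp mh.
by apply: continuous_measurable_fun; exact: continuous_sin.
Qed.

Lemma cmeas_comp d1 d2 (T1 : measurableType d1) (T2 : measurableType d2)
    (h : T1 -> T2) (f : T2 -> C) : measurable_fun setT h -> cmeas f ->
  cmeas (fun t => f (h t)).
Proof.
by move=> mh [m1 m2]; split; [exact: measurableT_comp m1 mh|exact: measurableT_comp m2 mh].
Qed.

(** Both sides are iterated integrals of the same absolutely integrable kernel, as exp(-i x.y) is
    symmetric in its two variables. *)
Lemma fourier_pairing f g : schwartz f -> schwartz g ->
  cI mu (fun t => fourier f (point t) * g (point t)) =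
  cI mu (fun t => f (point t) * fourier g (point t)).
Proof.
move=> sf sg.
pose K (z : n.-tuple R * n.-tuple R) : C :=
  expi (point z.2) (point z.1) * (f (point z.1) * g (point z.2)).
have Ki : cinteg (mu \x mu)%E K.
  apply: (cinteg_le (g := fun z => normc (f (point z.1)) * normc (g (point z.2)))).
  - apply: cmeasM; first exact: cmeas_expi measurable_dot.
    apply: cmeasM.
      exact: (cmeas_comp (f := fun t => f (point t)) measurable_fst (schwartz_cmeas sf)).
    exact: (cmeas_comp (f := fun t => g (point t)) measurable_snd (schwartz_cmeas sg)).
  - apply: (rint_prod (g := fun t => normc (f (point t))) (h := fun t => normc (g (point t)))).
    + exact: cinteg_normc (schwartz_cinteg sf).
    + exact: cinteg_normc (schwartz_cinteg sg).
    + by move=> t; exact: normc_ge0.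
    + by move=> t; exact: normc_ge0.
  - by move=> z; rewrite /K !normcM normc_expi mul1r.
have := (cI_fubini Ki).2; rewrite (cI_fubini2 Ki).2 /K /= => e.
transitivity (cI mu (fun t => cI mu (fun s => K (s, t)))).
  apply: eq_cI => t; rewrite fourierE mulrC -cIZ.
    by apply: eq_cI => s; rewrite /K /=; ring.
  exact: schwartz_cinteg (schwartz_expi _ sf).
rewrite e; apply: eq_cI => t; rewrite fourierE -cIZ.
  by apply: eq_cI => s; rewrite /K /= expiC; ring.
exact: schwartz_cinteg (schwartz_expi _ sg).
Qed.

End pairing.

(** * Fourier inversion *)

Section gaussian.
Context {R : realType} {n : nat}.
Local Notation C := R[i].
Local Notation E := 'rV[R]_n.
Local Notation mu := (leb R n).
Implicit Types (f g : E -> C) (x y xi : E) (i : 'I_n).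

Definition gau (a : R) x : R := expR (- (a * dot x x)).

Lemma is_derive_gau a i x :
  is_derive x (delta_mx 0 i) (gau a) (gau a x * (- (2 * a * x 0 i))).
Proof.
have h := is_deriveN (is_deriveZ a (is_derive_sqnorm i x)).
have := is_derive_comp1 (h := expR) (f := fun z => - (a * dot z z)) (is_derive_expR _) h.
by move=> h2; apply: is_derive_eq h2 _; rewrite /gau scaleRE; ring.
Qed.

(** Polynomial functions, generated so that growth and differentiability follow by induction; their
    products with a Gaussian form a class stable under differentiation, as [schwartz_coind] asks. *)
Inductive polyfun : (E -> C) -> Prop :=
| polyfun_cst c : polyfun (fun=> c)
| polyfun_coord i P : polyfun P -> polyfun (fun x => (x 0 i)%:C * P x)
| polyfunD P Q : polyfun P -> polyfun Q -> polyfun (fun x => P x + Q x).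

Lemma polyfun_growth P : polyfun P -> exists M : R, exists m : nat, 0 <= M /\
  forall x, normc (P x) <= M * (1 + enorm x) ^+ m.
Proof.
elim=> [c|i {}P _ [M [m [M0 hM]]]|{}P Q _ [M [m [M0 hM]]] _ [N [k [N0 hN]]]].
- by exists (normc c), 0%N; rewrite normc_ge0; split => // x; rewrite expr0 mulr1.
- exists M, m.+1; split => // x; rewrite normcM normcR exprS mulrCA.
  apply: ler_pM => //; first exact: normc_ge0.
  by apply: le_trans (coord_le_enorm i x) _; rewrite lerDr.
- exists (M + N), (m + k)%N; split; first exact: addr_ge0.
  move=> x; apply: le_trans (le_normcD _ _) _; rewrite mulrDl; apply: lerD.
    apply: le_trans (hM x) _; rewrite ler_wpM2l// ler_weXn2l ?leq_addr//.
    by rewrite lerDl enorm_ge0.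
  apply: le_trans (hN x) _; rewrite ler_wpM2l// ler_weXn2l ?leq_addl//.
  by rewrite lerDl enorm_ge0.
Qed.

Lemma polyfun_partial P i : polyfun P -> exists Q, polyfun Q /\ forall x, is_partial i P x (Q x).
Proof.
elim=> [c|j {}P pP [Q [pQ hQ]]|{}P Q _ [P' [pP hP]] _ [Q' [pQ hQ]]].
- by exists (fun=> 0); split => [|x]; [exact: polyfun_cst|exact: is_partial_cst].
- have [ij|ij] := eqVneq i j.
    exists (fun x => P x + (x 0 j)%:C * Q x); split.
      by apply: polyfunD => //; exact: polyfun_coord.
    move=> x; have := is_partial_coord j (hQ x).
    by rewrite ij eqxx mul1r.
  exists (fun x => (x 0 j)%:C * Q x); split; first exact: polyfun_coord.
  move=> x; have := is_partial_coord j (hQ x).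
  by rewrite (negbTE ij) mul0r add0r.
- exists (fun x => P' x + Q' x); split; first exact: polyfunD.
  by move=> x; exact: is_partialD.
Qed.

Lemma gau_decay (a : R) (k : nat) : 0 < a ->
  exists M : R, forall x, (1 + enorm x) ^+ k * gau a x <= M.
Proof.
(* This constant gives 1 + r <= c (1 + a r / (k+1)) <= c exp(a r / (k+1)), and the power [k.+1] of
   the last exponential is cancelled by the Gaussian. Using [k.+1] avoids dividing by 0. *)
move=> a0; pose c : R := 1 + k.+1%:R / a.
have c1 : 1 <= c by rewrite lerDl divr_ge0// ltW.
exists (2 ^+ k.+1 * c ^+ k.+1) => x; set r := dot x x.
have r0 : 0 <= r by exact: dot_ge0.
have h1 : 1 + enorm x <= 2 * (1 + r).
  rewrite /r -enorm2E; have := sqr_ge0 (2 * enorm x - 1); rewrite sqrrB exprMn.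
  have := enorm_ge0 x; nra.
have h2 : 1 + r <= c * expR (a * r / k.+1%:R).
  apply: (@le_trans _ _ (c * (1 + a * r / k.+1%:R))); last first.
    by rewrite ler_wpM2l ?(le_trans ler01 c1)// expR_ge1Dx.
  have -> : c * (1 + a * r / k.+1%:R) = c + r + a * r / k.+1%:R.
    by rewrite /c; field; rewrite gt_eqF//= gt_eqF// ltr0n.
  have h3 : 0 <= a * r / k.+1%:R by rewrite divr_ge0// mulr_ge0// ltW.
  by apply: (@le_trans _ _ (c + r)); [rewrite lerD2r|rewrite lerDl].
apply: (@le_trans _ _ ((1 + enorm x) ^+ k.+1 * gau a x)).
  rewrite ler_wpM2r ?expR_ge0// ler_weXn2l//.
  by rewrite lerDl enorm_ge0.
apply: (@le_trans _ _ ((2 * (c * expR (a * r / k.+1%:R))) ^+ k.+1 * gau a x)).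
  rewrite ler_wpM2r ?expR_ge0// lerXn2r ?nnegrE ?addr_ge0 ?enorm_ge0//.
    by rewrite !mulr_ge0 ?expR_ge0// (le_trans ler01 c1).
  by apply: le_trans h1 _; rewrite ler_wpM2l.
rewrite !exprMn -expRM_natr divfK ?pnatr_eq0// -!mulrA /gau -/r expRxMexpNx_1.
by rewrite mulr1.
Qed.

Lemma schwartz_gau a : 0 < a -> schwartz (fun x => (gau a x)%:C).
Proof.
move=> a0; pose A (h : E -> C) := exists2 P, polyfun P & h = (fun x => P x * (gau a x)%:C).
apply: (@schwartz_coind _ _ A); last first.
  exists (fun=> 1); first exact: polyfun_cst.
  by apply/funext => x; rewrite mul1r.
move=> _ [P pP ->]; split.
  have [N [m [N0 hN]]] := polyfun_growth pP.
  move=> k; have [M hM] := gau_decay (k + m) a0; exists (N * M) => x.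
  have e0 j : 0 <= (1 + enorm x) ^+ j by rewrite exprn_ge0// addr_ge0// enorm_ge0.
  rewrite normcM normcR (ger0_norm (expR_ge0 _)).
  apply: (@le_trans _ _ ((1 + enorm x) ^+ k * (N * (1 + enorm x) ^+ m * gau a x))).
    by rewrite ler_wpM2l// ler_wpM2r ?expR_ge0.
  rewrite !mulrA [_ * N]mulrC -!mulrA ler_wpM2l// mulrA -exprD; exact: hM.
move=> i; have [Q [pQ hQ]] := polyfun_partial i pP.
exists (fun x => (Q x + (- (2 * a))%:C * ((x 0 i)%:C * P x)) * (gau a x)%:C); split.
  exists (fun x => Q x + (- (2 * a))%:C * ((x 0 i)%:C * P x)) => //.
  apply: polyfunD => //.
  have pc c P' : polyfun P' -> polyfun (fun x => c * P' x).
    elim=> [c'|j {}P' _ IH|P1 P2 _ IH1 _ IH2].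
    - exact: polyfun_cst.
    - by under eq_fun do rewrite mulrCA; exact: polyfun_coord.
    - by under eq_fun do rewrite mulrDr; exact: polyfunD.
  by apply: pc; exact: polyfun_coord.
move=> x; have := is_partialM (hQ x) (is_partialR (is_derive_gau a i x)).
suff -> : (Q x + (- (2 * a))%:C * ((x 0 i)%:C * P x)) * (gau a x)%:C =
  Q x * (gau a x)%:C + P x * (gau a x * - (2 * a * x 0 i))%:C by [].
rewrite mulrDl; congr (_ + _).
by rewrite !rmorphM !rmorphN !rmorphM /=; ring.
Qed.

Lemma partial_gau a i : partial i (fun x => (gau a x)%:C) =
  (fun x => (- (2 * a))%:C * ((x 0 i)%:C * (gau a x)%:C)).
Proof.
apply: partial_eq => x.
have := is_partialR (is_derive_gau a i x).
suff -> : (gau a x * - (2 * a * x 0 i))%:C = (- (2 * a))%:C * ((x 0 i)%:C * (gau a x)%:C) by [].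
by rewrite !rmorphM !rmorphN !rmorphM /=; ring.
Qed.

End gaussian.

Section gaussian_integral.
Context {R : realType}.
Local Notation C := R[i].

(** The value of the integral of exp(-a x^2) over the line. *)
Definition gauK (a : R) : R := Num.sqrt (pi / a).

Lemma gauK_gt0 a : 0 < a -> 0 < gauK a.
Proof. by move=> a0; rewrite sqrtr_gt0 divr_gt0// pi_gt0. Qed.

Lemma Rint_gauss (a m : R) : 0 < a ->
  rint (@lebesgue_measure R) (fun x => expR (- (a * (x - m) ^+ 2))) /\
  \int[@lebesgue_measure R]_x expR (- (a * (x - m) ^+ 2)) = gauK a.
Proof.
(* The standard deviation for which the normal density is proportional to exp(-a (x - m)^2): the
   variance is 1 / (2a). *)
move=> a0; pose s := Num.sqrt ((2 * a)^-1).
have a20 : 0 < (2 * a)^-1 by rewrite invr_gt0 mulr_gt0.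
have s2 : s ^+ 2 = (2 * a)^-1 by rewrite sqr_sqrtr// ltW.
have s0 : s != 0 by rewrite gt_eqF// sqrtr_gt0.
have pE x : normal_pdf m s x = (gauK a)^-1 * expR (- (a * (x - m) ^+ 2)).
  rewrite (normal_pdfE _ s0) /normal_peak /normal_fun s2; congr (_ * expR _).
    rewrite /gauK; congr ((Num.sqrt _)^-1); rewrite -mulr_natl; field; exact: lt0r_neq0.
  by rewrite -mulr_natl; field; exact: lt0r_neq0.
have K0 := lt0r_neq0 (gauK_gt0 a0).
have E : (fun x => expR (- (a * (x - m) ^+ 2))) = (fun x => gauK a * normal_pdf m s x).
  by apply/funext => x; rewrite pE mulVKf.
have ri : rint (@lebesgue_measure R) (normal_pdf m s) by exact: integrable_normal_pdf.
rewrite E; split; first exact: rintZ.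
by rewrite RintZ// /Rintegral integral_normal_pdf mulr1.
Qed.

Lemma Rint_gau n (a : R) (y : 'rV[R]_n) : 0 < a ->
  rint (leb R n) (fun t => gau a (point t - y)) /\
  \int[leb R n]_t gau a (point t - y) = gauK a ^+ n.
Proof.
move=> a0; elim: n y => [|n IH] y.
  have E : (fun t : 0.-tuple R => gau a (point t - y)) = fun t => wt t.
    by apply/funext => t; rewrite /gau /wt /dot !big_ord0 mulr0 oppr0 expR0.
  rewrite E; split; first exact: rint_wt.
  rewrite expr0 /Rintegral.
  rewrite [X in fine X](_ : _ = \int[\d_ ([tuple] : 0.-tuple R)]_t (wt t)%:E)%E//.
  rewrite integral_dirac//; last by apply/measurable_EFinP; exact: measurable_wt.
  by rewrite diracT mul1e /= /wt big_ord0.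
rewrite (consr_surj y); set b := y 0 ord0; set v := (\row_j _).
have [ri rv] := IH v.
have E (z : measurableTypeR R * n.-tuple R) :
    gau a (point (consR z) - consr b v) =
    expR (- (a * (z.1 - b) ^+ 2)) * gau a (point z.2 - v).
  rewrite point_consR.
  have -> : consr z.1 (point z.2) - consr b v = consr (z.1 - b) (point z.2 - v).
    by apply: consr_ext => [|j]; rewrite !mxE ?unlift_none ?liftK//= !mxE.
  by rewrite /gau dot_consr -expRD; congr expR; ring.
have mg : measurable_fun setT (fun t : n.+1.-tuple R => gau a (point t - consr b v)).
  rewrite /gau; apply: measurableT_comp => //; apply: measurableT_comp => //.
  apply: measurable_funM => //; rewrite /dot.
  under eq_fun do under eq_bigr do rewrite !mxE.
  apply: measurable_sum => i; apply: measurable_funM;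
  by apply: measurable_funD => //; exact: measurable_tnth.
have r2 : rint ((@lebesgue_measure R) \x (leb R n))%E
    ((fun t : n.+1.-tuple R => gau a (point t - consr b v)) \o consR (n:=n)).
  rewrite (_ : _ \o _ = fun z => expR (- (a * (z.1 - b) ^+ 2)) * gau a (point z.2 - v)); last first.
    by apply/funext => z /=; rewrite E.
  apply: (rint_prod (g := fun x : measurableTypeR R => expR (- (a * (x - b) ^+ 2)))
    (h := fun t => gau a (point t - v)) _ ri).
  - exact: (Rint_gauss b a0).1.
  - by move=> x; exact: expR_ge0.
  - by move=> t; exact: expR_ge0.
split; first exact: rint_leb_succ.
rewrite Rint_leb_succ// (Rint_fubini r2).2 /=.
under eq_Rintegral => x _.
  under eq_Rintegral do rewrite E /=.
  rewrite RintZ// rv mulrC; over.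
rewrite RintZ; last exact: (Rint_gauss b a0).1.
by rewrite (Rint_gauss b a0).2 exprSr.
Qed.

End gaussian_integral.

Section fourier_gaussian.
Context {R : realType} {n : nat}.
Local Notation C := R[i].
Local Notation E := 'rV[R]_n.
Local Notation mu := (leb R n).
Implicit Types (f g : E -> C) (x y xi : E) (i : 'I_n).

Lemma expi0 x : expi (0 : E) x = 1.
Proof.
rewrite /expi; have -> : dot x (0 : E) = 0 by rewrite /dot big1// => i _; rewrite mxE mulr0.
by rewrite cos0 sin0; apply: complex_ext; rewrite /= ?oppr0.
Qed.

(* Both [gau a] and its transform solve the same first order system, so that
   [fourier (gau a) xi * exp (|xi|^2 / 4a)] is constant. *)
Lemma fourier_gau a xi : 0 < a -> fourier (fun x => (gau a x)%:C) xi =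
  (gauK a ^+ n)%:C * (gau (4 * a)^-1 xi)%:C.
Proof.
move=> a0; set g := fun x : E => (gau a x)%:C.
have sg : schwartz g := schwartz_gau a0.
have a4 : a != 0 by exact: lt0r_neq0.
have Fd i x : is_partial i (fourier g) x ((- (x 0 i / (2 * a)))%:C * fourier g x).
  have := is_partial_fourier i x sg.
  suff -> : fourier (mulcoord i g) x = (- (x 0 i / (2 * a)))%:C * fourier g x by [].
  have -> : mulcoord i g = (fun u => (0 +i* (2 * a)^-1) * partial i g u).
    apply/funext => u; rewrite /mulcoord partial_gau [RHS]mulrA; congr (_ * _).
    by apply: complex_ext; rewrite !ReImE /=; field.
  rewrite fourierZ ?fourier_partial//; last exact: schwartz_partial.
  rewrite mulrA; congr (_ * _).
  by apply: complex_ext; rewrite !ReImE /=; field.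
(* [gau] with a negative parameter is the growing factor exp(|x|^2 / 4a). *)
pose h x : C := fourier g x * (gau (- (4 * a)^-1) x)%:C.
have hd i x : is_partial i h x 0.
  have := is_partialM (Fd i x) (is_partialR (is_derive_gau (- (4 * a)^-1) i x)).
  suff -> : (- (x 0 i / (2 * a)))%:C * fourier g x * (gau (- (4 * a)^-1) x)%:C +
    fourier g x * (gau (- (4 * a)^-1) x * - (2 * - (4 * a)^-1 * x 0 i))%:C = 0 by [].
  have -> : - (2 * - (4 * a)^-1 * x 0 i) = x 0 i / (2 * a) by field.
  by rewrite rmorphM rmorphN /=; ring.
(* A function with vanishing partial derivatives is Lipschitz with constant 0. *)
have hc x : h x = h 0.
  have z0 (i : 'I_n) (y : E) : `|0 : R| <= 0 by rewrite normr0.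
  have H1 := partial_lipschitz (g := fun x => complex.Re (h x)) (fun i y => (hd i y).1) z0 x 0.
  have H2 := partial_lipschitz (g := fun x => complex.Im (h x)) (fun i y => (hd i y).2) z0 x 0.
  rewrite mul0r normr_le0 subr_eq0 in H1; rewrite mul0r normr_le0 subr_eq0 in H2.
  by apply: complex_ext; apply/eqP.
have h0 : h 0 = (gauK a ^+ n)%:C.
  rewrite /h /gau; have -> : dot (0 : E) 0 = 0 by rewrite /dot big1// => i _; rewrite mxE mulr0.
  rewrite mulr0 oppr0 expR0 mulr1 fourierE.
  have [ri rv] := Rint_gau (0 : E) a0.
  have -> : cI mu (fun t => expi (0 : E) (point t) * g (point t)) =
      cI mu (fun t => (gau a (point t))%:C).
    by apply: eq_cI => t; rewrite expi0 mul1r.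
  apply: complex_ext; last by rewrite /= Rint0.
  by rewrite /= -rv; apply: eq_Rintegral => t _; rewrite subr0.
have := hc xi; rewrite h0 /h => <-.
rewrite -mulrA -rmorphM /= /gau -expRD.
by rewrite mulNr opprK addrN expR0 mulr1.
Qed.

End fourier_gaussian.

Section fourier_inversion.
Context {R : realType} {n : nat}.
Local Notation C := R[i].
Local Notation E := 'rV[R]_n.
Local Notation mu := (leb R n).
Implicit Types (f g phi psi : E -> C) (x y xi : E) (i : 'I_n).

Lemma Rint_sum d (T : measurableType d) (nu : {measure set T -> \bar R}) (I : Type)
    (s : seq I) (F : I -> T -> R) : (forall j, rint nu (F j)) ->
  rint nu (fun t => \sum_(j <- s) F j t) /\
  \int[nu]_t (\sum_(j <- s) F j t) = \sum_(j <- s) \int[nu]_t F j t.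
Proof.
move=> Fi; elim: s => [|j s [IH1 IH2]].
  have -> : (fun t => \sum_(j <- [::]) F j t) = fun=> 0.
    by apply/funext => t; rewrite big_nil.
  by split; [exact: rint0|rewrite big_nil Rint0].
have -> : (fun t => \sum_(j <- j :: s) F j t) = fun t => F j t + \sum_(j <- s) F j t.
  by apply/funext => t; rewrite big_cons.
by split; [exact: rintD|rewrite RintD// big_cons IH2].
Qed.

Lemma dotDr x y z : dot x (y + z) = dot x y + dot x z.
Proof. by rewrite /dot -big_split; apply: eq_bigr => i _; rewrite /= mxE mulrDr. Qed.

Lemma dotNr x y : dot x (- y) = - dot x y.
Proof. by rewrite /dot -sumrN; apply: eq_bigr => i _; rewrite mxE mulrN. Qed.

Lemma expiD x y z : expi (y + z) x = expi y x * expi z x.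
Proof.
rewrite /expi dotDr cosD sinD; apply: complex_ext; rewrite !ReImE /=; ring.
Qed.

Lemma conj_expi y x : conjc (expi y x) = expi (- y) x.
Proof. by rewrite /expi dotNr cosN sinN; apply: complex_ext; rewrite /= ?opprK. Qed.

Lemma gauKM (a : R) : 0 < a -> gauK a * gauK (4 * a)^-1 = 2 * pi.
Proof.
move=> a0; have p0 := pi_gt0 R; rewrite /gauK -sqrtrM; last by rewrite divr_ge0// ltW.
have -> : pi / a * (pi / (4 * a)^-1) = (2 * pi) ^+ 2 by field; exact: lt0r_neq0.
by rewrite sqrtr_sqr ger0_norm// mulr_ge0// ltW.
Qed.

Let G b y : E -> C := fun x => (gau b (x - y))%:C.

Lemma fourier_modulated_gau a y : 0 < a ->
  fourier (fun xi => expi (- y) xi * (gau a xi)%:C) =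
  (fun x => (gauK a ^+ n)%:C * G (4 * a)^-1 y x).
Proof.
move=> a0; apply/funext => x; rewrite /G -fourier_gau// !fourierE.
by apply: eq_cI => t; rewrite mulrA -expiD.
Qed.

(** A translated Gaussian is, up to a constant, the transform of a modulated one; the parameter
    (4b)^-1 is the one whose transform has parameter [b]. *)
Let schwartz_G b y : 0 < b -> schwartz (G b y).
Proof.
move=> b0; have a0 : 0 < (4 * b)^-1 by rewrite invr_gt0 mulr_gt0.
have h := fourier_schwartz (schwartz_expi (- y) (schwartz_gau a0)).
rewrite fourier_modulated_gau// in h.
have K0 := lt0r_neq0 (exprn_gt0 n (gauK_gt0 a0)).
have := schwartzZ ((gauK (4 * b)^-1 ^+ n)^-1)%:C h.
have -> : (4 * (4 * b)^-1)^-1 = b by field; exact: lt0r_neq0.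
by under eq_fun do rewrite mulrA -rmorphM /= mulVf// mul1r.
Qed.

(** Integration by parts: the derivative of (x_i - y_i) G is G - 2b (x_i - y_i)^2 G, and its
    integral vanishes. *)
Lemma gau_moment b y i : 0 < b ->
  rint mu (fun t => (point t 0 i - y 0 i) ^+ 2 * gau b (point t - y)) /\
  \int[mu]_t ((point t 0 i - y 0 i) ^+ 2 * gau b (point t - y)) =
  (2 * b)^-1 * gauK b ^+ n.
Proof.
move=> b0; have sG := schwartz_G y b0.
pose c x : C := (x 0 i - y 0 i)%:C.
have sc f : schwartz f -> schwartz (fun x => c x * f x).
  move=> sf; have := schwartzZD (- (y 0 i)%:C) sf (schwartz_coord i sf).
  by under eq_fun do rewrite addrC mulNr -mulrBl -rmorphB.
have sf := sc _ sG; have sff := sc _ sf.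
have cp x : is_partial i c x 1.
  apply: is_partialR; have h := is_deriveB (is_derive_coord i i x) (is_derive_cst (y 0 i) x (delta_mx 0 i)).
  by apply: is_derive_eq h _; rewrite eqxx subr0.
have Gp x : is_partial i (G b y) x ((gau b (x - y) * - (2 * b * (x 0 i - y 0 i)))%:C).
  apply: is_partialR; have := is_derive_gau b i (x - y).
  rewrite !mxE; apply: is_derive_eqfun => h; by rewrite addrA.
have pE : partial i (fun x => c x * G b y x) =
    (fun x => G b y x - (2 * b)%:C * (c x * (c x * G b y x))).
  apply: partial_eq => x; have := is_partialM (cp x) (Gp x).
  suff -> : G b y x - (2 * b)%:C * (c x * (c x * G b y x)) = 1 * G b y x +
    c x * (gau b (x - y) * - (2 * b * (x 0 i - y 0 i)))%:C by [].
  rewrite mul1r; congr (_ + _); rewrite /c /G !rmorphM rmorphN !rmorphM /=; ring.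
have i1 := schwartz_cinteg sG; have i2 := schwartz_cinteg sff.
have E t : complex.Re (c (point t) * (c (point t) * G b y (point t))) =
    (point t 0 i - y 0 i) ^+ 2 * gau b (point t - y).
  by rewrite /c /G -!rmorphM /=; ring.
have ri : rint mu (fun t => (point t 0 i - y 0 i) ^+ 2 * gau b (point t - y)).
  by have := i2.1; under eq_fun do rewrite E.
split => //.
have := schwartz_integral_partial0 i sf; rewrite pE cIB//; last exact: cintegZ.
rewrite cIZ// => /(congr1 (@complex.Re R)).
have e1 : complex.Re (cI mu (fun t => G b y (point t))) = gauK b ^+ n.
  exact: (Rint_gau y b0).2.
have e2 : complex.Re (cI mu (fun t => c (point t) * (c (point t) * G b y (point t)))) =
    \int[mu]_t ((point t 0 i - y 0 i) ^+ 2 * gau b (point t - y)).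
  by apply: eq_Rintegral => t _; rewrite E.
rewrite ReD ReN ReM e1 e2 -[complex.Re (2 * b)%:C]/(2 * b) -[complex.Im (2 * b)%:C]/(0 : R).
rewrite mul0r subr0 => h; have {h} : gauK b ^+ n - 2 * b * (\int[mu]_t
  ((point t 0 i - y 0 i) ^+ 2 * gau b (point t - y))) = 0 by [].
move=> /eqP; rewrite subr_eq0 => /eqP ->; rewrite mulKf//.
by rewrite mulf_neq0// lt0r_neq0.
Qed.

(** With v a coordinate of x - y, the inequality 2 |v| <= del + v^2 / del replaces the Lipschitz
    modulus by quantities with known Gaussian integrals, the mass and the second moments. The free
    parameter [del] is matched to the width of the Gaussian afterwards. *)
Lemma gau_approx f y (L b del : R) : schwartz f -> 0 < b -> 0 < del -> 0 <= L ->
  (forall x, normc (f x - f y) <= 2 * L * \sum_(i < n) `|x 0 i - y 0 i|) ->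
  normc (cI mu (fun t => f (point t) * G b y (point t)) - (gauK b ^+ n)%:C * f y) <=
  L * n%:R * (del + del^-1 * (2 * b)^-1) * gauK b ^+ n.
Proof.
move=> sf b0 d0 L0 fL; have sG := schwartz_G y b0.
have iG := schwartz_cinteg sG; have [riG rG] := Rint_gau y b0.
have sfG : cinteg mu (fun t => f (point t) * G b y (point t)).
  exact: sqiM (schwartz_sqi sf) (schwartz_sqi sG).
have GE : cI mu (fun t => G b y (point t)) = (gauK b ^+ n)%:C.
  by apply: complex_ext; rewrite /= ?Rint0.
rewrite -GE [_ * f y]mulrC -cIZ// -cIB//; last exact: cintegZ.
pose w t := gau b (point t - y).
have w0 t : 0 <= w t by exact: expR_ge0.
pose u i (t : n.-tuple R) := (point t 0 i - y 0 i) ^+ 2 * w t.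
have [ru eu] : rint mu (fun t => \sum_i u i t) /\
    \int[mu]_t (\sum_i u i t) = n%:R * ((2 * b)^-1 * gauK b ^+ n).
  have [|r e] := @Rint_sum _ _ mu _ (index_enum 'I_n) u.
    by move=> i; exact: (gau_moment y i b0).1.
  split; first exact: r.
  rewrite e (eq_bigr (fun=> (2 * b)^-1 * gauK b ^+ n)); last first.
    by move=> i _; exact: (gau_moment y i b0).2.
  by rewrite sumr_const card_ord [RHS]mulr_natl.
pose g t := (L * n%:R * del) * w t + (L * del^-1) * \sum_i u i t.
have gi : rint mu g by apply: rintD; apply: rintZ.
apply: le_trans (cI_norm_le (g := g) _ gi _) _.
- by apply: cmeasB; [exact: cinteg_meas sfG|apply: cmeasM; [exact: cmeas_cst|exact: cinteg_meas iG]].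
- move=> t; rewrite -mulrBl normcM normcR (ger0_norm (w0 t)).
  have h : normc (f (point t) - f y) <= L * n%:R * del +
      (L * del^-1) * \sum_i (point t 0 i - y 0 i) ^+ 2.
    apply: le_trans (fL _) _.
    rewrite -!mulrA -mulrDr mulrCA ler_wpM2l// mulr_sumr.
    have -> : n%:R * del = \sum_(i < n) del by rewrite sumr_const card_ord mulr_natl.
    rewrite mulr_sumr -big_split /=; apply: ler_sum => i _.
    set v := point t 0 i - y 0 i.
    have : 0 <= (del - `|v|) ^+ 2 / del by rewrite divr_ge0 ?sqr_ge0// ltW.
    rewrite sqrrB real_normK ?num_real//.
    have -> : (del ^+ 2 - del * `|v| *+ 2 + v ^+ 2) / del = del - 2 * `|v| + del^-1 * v ^+ 2.
      by rewrite -mulr_natl; field; exact: lt0r_neq0.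
    lra.
  apply: le_trans (ler_wpM2r (w0 t) h) _.
  by rewrite /g /u -mulr_suml mulrDl -!mulrA.
rewrite /g RintD; [|exact: rintZ..].
rewrite !RintZ// eu rG.
by rewrite le_eqVlt; apply/orP; left; apply/eqP; ring.
Qed.

(** Insert a flat Gaussian factor into the integral. As it tends to 1 the integral converges to the
    original one by dominated convergence; moving the transform onto the Gaussian by
    [fourier_pairing] turns it into the mean of [f] against a Gaussian that concentrates at [y]. *)
Lemma fourier_inversion_pairing f y : schwartz f ->
  cI mu (fun t => fourier f (point t) * expi (- y) (point t)) =
  ((2 * pi) ^+ n)%:C * f y.
Proof.
move=> sf; have [L L0 hL] := schwartz_lipschitz sf.
have fL x : normc (f x - f y) <= 2 * L * \sum_(i < n) `|x 0 i - y 0 i|.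
  apply: le_trans (normc_le_ReIm _) _; rewrite ReD ImD ReN ImN.
  by have [h1 h2] := hL x y; rewrite -mulrA mulr_natl mulr2n; apply: lerD.
set I := cI mu _.
(* Chosen so that the dual parameter [b = (4 * a k)^-1] has [(2 * b)^-1 = (k+1)^-2]; with
   [del = 1 / (k+1)] both error terms of [gau_approx] are of order 1 / (k+1). *)
pose a (k : nat) : R := (2 * k.+1%:R ^+ 2)^-1.
have k0 k : (0 : R) < k.+1%:R by rewrite ltr0n.
have a0 k : 0 < a k by rewrite invr_gt0 mulr_gt0// exprn_gt0.
pose psi k xi := expi (- y) xi * (gau (a k) xi)%:C : C.
have spsi k : schwartz (psi k) by apply: schwartz_expi; exact: schwartz_gau.
have sFf := fourier_schwartz sf.
pose Ik k := cI mu (fun t => fourier f (point t) * psi k (point t)).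
have close k : normc (Ik k - ((2 * pi) ^+ n)%:C * f y) <=
    (2 * pi) ^+ n * (L * n%:R * 2) * k.+1%:R^-1.
  rewrite /Ik fourier_pairing// /psi fourier_modulated_gau//.
  set b := (4 * a k)^-1.
  have b0 : 0 < b by rewrite invr_gt0 mulr_gt0.
  have iG : cinteg mu (fun t => f (point t) * G b y (point t)).
    exact: sqiM (schwartz_sqi sf) (schwartz_sqi (schwartz_G y b0)).
  have -> : cI mu (fun t => f (point t) * ((gauK (a k) ^+ n)%:C * G b y (point t))) =
      (gauK (a k) ^+ n)%:C * cI mu (fun t => f (point t) * G b y (point t)).
    by rewrite -cIZ//; apply: eq_cI => t; rewrite mulrCA.
  have -> : (2 * pi) ^+ n = gauK (a k) ^+ n * gauK b ^+ n by rewrite -exprMn gauKM.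
  rewrite rmorphM -[_ * _ * f y]mulrA -mulrBr normcM normcR.
  have Kk0 : 0 <= gauK (a k) ^+ n by rewrite exprn_ge0// ltW// gauK_gt0.
  rewrite (ger0_norm Kk0) -!mulrA ler_wpM2l//.
  have d0 : 0 < k.+1%:R^-1 :> R by rewrite invr_gt0.
  apply: le_trans (gau_approx sf b0 d0 L0 fL) _.
  have -> : (2 * b)^-1 = k.+1%:R^-1 ^+ 2.
    have := lt0r_neq0 (k0 k); rewrite /b /a; move: (k.+1%:R : R) => N N0; by field.
  rewrite invrK le_eqVlt; apply/orP; left; apply/eqP.
  have := lt0r_neq0 (k0 k); move: (k.+1%:R : R) => N N0; by field.
have conv : normc (Ik k - I) @[k --> \oo] --> (0 : R).
  apply: (@cI_dct _ _ _ mu (fun k t => fourier f (point t) * psi k (point t))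
     (fun t => fourier f (point t) * expi (- y) (point t))
     (fun t => normc (fourier f (point t))) _ _ _ _).2.
  - by move=> k; apply: cmeasM; exact: schwartz_cmeas.
  - exact: cinteg_normc (schwartz_cinteg sFf).
  - move=> k t; rewrite normcM ler_piMr ?normc_ge0// /psi normcM normc_expi mul1r.
    rewrite normcR ger0_norm ?expR_ge0// -[leRHS]expR0 ler_expR oppr_le0.
    by rewrite mulr_ge0 ?dot_ge0// ltW.
  move=> t; set c := normc (fourier f (point t)).
  have -> : (fun k => normc (fourier f (point t) * psi k (point t) -
      fourier f (point t) * expi (- y) (point t))) =
      (fun k => c * `|gau (a k) (point t) - 1|).
    apply/funext => k; rewrite -mulrBr normcM /psi -[X in _ - X]mulr1 -mulrBr.
    by rewrite normcM normc_expi mul1r -rmorphB normcR.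
  apply: cvgZ0; apply/norm_cvg0P; apply/subr_cvg0.
  rewrite -(@expR0 R); apply: cvg_comp; last exact: continuous_expR.
  rewrite -oppr0; apply: cvgN; apply: cvg0Z.
  apply: squeeze_cvgr (cvg_cst 0) (@cvg_harmonic R); apply: nearW => k.
  rewrite ltW//= lef_pV2 ?posrE ?mulr_gt0 ?exprn_gt0//.
  have : (1 : R) <= k.+1%:R by rewrite ler1n.
  by move: (k.+1%:R : R) => N N1; nra.
apply/eqP; rewrite -subr_eq0 -normc_eq0; apply/eqP.
apply: (@cst_le_cvg0 _ _ (fun k => normc (Ik k - I) +
  (2 * pi) ^+ n * (L * n%:R * 2) * k.+1%:R^-1)).
  move=> k; rewrite ger0_norm ?normc_ge0//.
  have -> : I - ((2 * pi) ^+ n)%:C * f y = - (Ik k - I) + (Ik k - ((2 * pi) ^+ n)%:C * f y).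
    by ring.
  by apply: le_trans (le_normcD _ _) _; rewrite normcN lerD.
by apply: cvgD0 => //; apply: cvgZ0; exact: cvg_harmonic.
Qed.

(** The inverse transform, written with conjugations so that all properties of [fourier] apply to
    it; on test functions it lets [T phi] be read as [T (fourier (finv phi))]. *)
Definition finv f : E -> C := fun y =>
  (((2 * pi) ^+ n)^-1)%:C * conjc (fourier (fun x => conjc (f x)) y).

Let c0 : (2 * pi) ^+ n != 0 :> R.
Proof. by rewrite expf_neq0// mulf_neq0// lt0r_neq0// pi_gt0. Qed.

Lemma finv_schwartz f : schwartz f -> schwartz (finv f).
Proof.
by move=> sf; apply: schwartzZ; apply: schwartzJ; apply: fourier_schwartz; exact: schwartzJ.
Qed.

Lemma fourierK f : schwartz f -> finv (fourier f) = f.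
Proof.
move=> sf; apply/funext => y; rewrite /finv fourierE -cIJ; last first.
  by apply: (schwartz_cinteg (schwartz_expi y (schwartzJ (fourier_schwartz sf)))).
rewrite (eq_cI _ (g := fun t => fourier f (point t) * expi (- y) (point t))).
  by rewrite fourier_inversion_pairing// mulrA -rmorphM mulVf ?mul1r.
by move=> t; rewrite conjcM conjcK conj_expi mulrC.
Qed.

Lemma finvK f : schwartz f -> fourier (finv f) = f.
Proof.
move=> sf; have sJ := schwartzJ sf; have := fourierK sJ.
rewrite /finv fourierZ; last by apply/schwartzJ/fourier_schwartz.
move=> h; apply/funext => y; apply: (can_inj (@conjcK R)); rewrite conjcM.
apply: etrans (congr1 (fun g : E -> C => g y) h); congr (_ * _).
by apply: complex_ext; rewrite /= ?oppr0.
Qed.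

Lemma finvZD (a : C) f g : schwartz f -> schwartz g ->
  finv (fun x => a * f x + g x) = (fun xi => a * finv f xi + finv g xi).
Proof.
move=> sf sg; rewrite -[RHS]fourierK; last by apply: schwartzZD; exact: finv_schwartz.
by rewrite fourierZD ?finvK//; exact: finv_schwartz.
Qed.

(** Apply the pairing formula to [f] and the conjugate of its transform; by inversion the transform
    of the latter is [(2 pi)^n] times the conjugate of [f]. *)
Lemma plancherel f : schwartz f ->
  nrm2 mu (fun t => fourier f (point t)) = (2 * pi) ^+ n * nrm2 mu (fun t => f (point t)).
Proof.
move=> sf; have sF := fourier_schwartz sf; have sJ := schwartzJ sF.
have n2 g : nrm2 mu (fun t => g (point t)) =
    complex.Re (cI mu (fun t => g (point t) * conjc (g (point t)))).
  by rewrite /nrm2; apply: eq_Rintegral => t _; rewrite mulcJ.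
rewrite n2 (fourier_pairing sf sJ).
have e : fourier (fun x => conjc (fourier f x)) =
    (fun y => ((2 * pi) ^+ n)%:C * conjc (f y)).
  apply/funext => y; rewrite -[f in RHS](fourierK sf) /finv conjcM conjcK mulrA.
  rewrite (_ : _ * conjc _ = 1) ?mul1r//.
  by apply: complex_ext; rewrite !ReImE /= ?oppr0 ?mul0r ?mulr0 ?addr0 ?subr0// mulfV.
rewrite e n2 -[RHS]/(_ * _).
rewrite (eq_cI _ (g := fun t => ((2 * pi) ^+ n)%:C * (f (point t) * conjc (f (point t))))).
  rewrite cIZ; last by apply: sqiM; [|apply: sqiJ]; exact: schwartz_sqi.
  by rewrite ReM /= mul0r subr0.
by move=> t; rewrite mulrCA.
Qed.

End fourier_inversion.

(** * The Fourier transform on L^2 *)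

(** Dominated convergence in the form [rdct0] concerns sequences. Composing [g] with the maximum
    with 0 extends it to the whole line, where the sequential criterion applies. *)
Lemma cvg_within_halfline (R : realType) (g : R -> R) (t : R) : 0 <= t ->
  (forall u : nat -> R, (forall k, 0 <= u k) -> u k @[k --> \oo] --> t ->
     g (u k) @[k --> \oo] --> (0 : R)) ->
  g s @[s --> within halfline (nbhs t)] --> (0 : R).
Proof.
move=> t0 gu; pose h s := g (Num.max s 0).
(* The filter is not punctured, so the value at [t] matters; the constant sequence shows that it is
   0. *)
have ht : h t = 0.
  apply: (@cst_le_cvg0 _ _ (fun=> `|g t|)); first by move=> k; rewrite /h max_l.
  by apply/norm_cvg0P; apply: gu => //; exact: cvg_cst.
have mc : {for t, continuous ((id : R -> R) \max cst 0)}.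
  by apply: continuous_max; [exact: cvg_id|exact: cst_continuous].
have h0 : h s @[s --> t] --> (0 : R).
  rewrite -ht; apply/continuous_withinNx; rewrite ht; apply/cvgr_dnbhsP => u [_ ut].
  apply: gu; first by move=> k; rewrite le_max lexx orbT.
  by rewrite -[X in _ --> X](max_l t0); exact: (cvg_comp _ _ ut mc).
have H : h s @[s --> within halfline (nbhs t)] --> (0 : R) by exact: cvg_within_filter.
apply: cvg_trans H; apply: near_eq_cvg; apply: filterS (@withinT _ (nbhs t) halfline _).
by move=> s; rewrite /halfline /= /h => s0; rewrite max_l.
Qed.

Section fourier_L2.
Context {R : realType} {n : nat}.
Local Notation C := R[i].
Local Notation E := 'rV[R]_n.
Local Notation mu := (leb R n).
Implicit Types (f g phi psi : E -> C).

Definition sqE f := sqi mu (fun t => f (point t)).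
Definition nE f : R := nrm2 mu (fun t => f (point t)).

Lemma L2_sqE f : L2 f <-> sqE f.
Proof. by split => /sqiP. Qed.

Lemma L2normE f : sqE f -> L2norm f = (Num.sqrt (nE f))%:E.
Proof. exact: Lnorm2_normc. Qed.

Definition closureE f := in_closure mu (@point R n) schwartz (fun t => f (point t)).

Lemma riesz_schwartz (ell : (E -> C) -> C) (K : R) :
  (forall (a : C) phi psi, schwartz phi -> schwartz psi ->
     ell (fun x => a * phi x + psi x) = a * ell phi + ell psi) ->
  (forall phi, schwartz phi -> normc (ell phi) <= K * Num.sqrt (nE phi)) ->
  exists f, closureE f /\ forall phi, schwartz phi ->
    cI mu (fun t => f (point t) * phi (point t)) = ell phi.
Proof.
move=> lin bnd.
have [g [cg hg]] := riesz schwartz0 (fun a phi psi => @schwartzZD _ _ a phi psi)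
  (fun phi => @schwartzJ _ _ phi) (fun phi => @schwartz_sqi _ _ phi) lin bnd.
(* The representative lives on tuples; it is read as a function of row vectors through their
   coordinates. *)
pose f (x : E) := g [tuple x 0 i | i < n].
have fg t : f (point t) = g t.
  by rewrite /f; congr g; apply: eq_from_tnth => i; rewrite tnth_mktuple mxE.
exists f; split; first by rewrite /closureE; under eq_fun do rewrite fg.
by move=> phi /hg <-; apply: eq_cI => t; rewrite fg.
Qed.

Lemma cauchy_schwarzE f phi : sqE f -> sqE phi ->
  normc (cI mu (fun t => f (point t) * phi (point t))) <=
  Num.sqrt (nE f) * Num.sqrt (nE phi).
Proof. exact: cauchy_schwarz. Qed.

Lemma pairing_linear f : sqE f -> forall (a : C) phi psi, sqE phi -> sqE psi ->
  cI mu (fun t => f (point t) * (a * phi (point t) + psi (point t))) =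
  a * cI mu (fun t => f (point t) * phi (point t)) +
  cI mu (fun t => f (point t) * psi (point t)).
Proof.
move=> sf a phi psi sphi spsi.
rewrite -cIZ; last exact: sqiM.
rewrite -cID; [|by apply: cintegZ; exact: sqiM|exact: sqiM].
by apply: eq_cI => t; ring.
Qed.

(** The transform is defined by duality: Plancherel bounds the functional in the L2 norm of [phi],
    and Riesz represents it. *)
Lemma fourier_L2 f : sqE f -> exists F, sqE F /\ forall phi, schwartz phi ->
  cI mu (fun t => f (point t) * fourier phi (point t)) =
  cI mu (fun t => F (point t) * phi (point t)).
Proof.
move=> sf.
have [a phi psi sphi spsi|phi sphi|F [[sF _] hF]] := @riesz_schwartz
  (fun phi => cI mu (fun t => f (point t) * fourier phi (point t)))
  (Num.sqrt (nE f) * Num.sqrt ((2 * pi) ^+ n)).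
- rewrite fourierZD// (pairing_linear sf)//; exact: schwartz_sqi (fourier_schwartz _).
- apply: le_trans (cauchy_schwarzE sf (schwartz_sqi (fourier_schwartz sphi))) _.
  rewrite /nE plancherel// -mulrA ler_wpM2l ?sqrtr_ge0// sqrtrM//.
  by rewrite exprn_ge0// mulr_ge0// ltW// pi_gt0.
by exists F; split => // phi /hF.
Qed.

Lemma nE_finv phi : schwartz phi -> nE (finv phi) = ((2 * pi) ^+ n)^-1 * nE phi.
Proof.
move=> sphi; have := plancherel (finv_schwartz sphi); rewrite finvK// /nE => ->.
by rewrite mulKf// expf_neq0// mulf_neq0// lt0r_neq0// pi_gt0.
Qed.

Lemma finv_pairing_bound f phi : sqE f -> schwartz phi ->
  normc (cI mu (fun t => f (point t) * finv phi (point t))) <=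
  Num.sqrt (nE f) * Num.sqrt ((2 * pi) ^+ n)^-1 * Num.sqrt (nE phi).
Proof.
move=> sf sphi.
apply: le_trans (cauchy_schwarzE sf (schwartz_sqi (finv_schwartz sphi))) _.
rewrite nE_finv// -mulrA ler_wpM2l ?sqrtr_ge0// sqrtrM//.
by rewrite invr_ge0 exprn_ge0// mulr_ge0// ltW// pi_gt0.
Qed.

Lemma finv_L2 f : sqE f -> exists F, closureE F /\ forall phi, schwartz phi ->
  cI mu (fun t => F (point t) * phi (point t)) =
  cI mu (fun t => f (point t) * finv phi (point t)).
Proof.
move=> sf.
have [a phi psi sphi spsi|phi sphi|F hF] := @riesz_schwartz
  (fun phi => cI mu (fun t => f (point t) * finv phi (point t)))
  (Num.sqrt (nE f) * Num.sqrt ((2 * pi) ^+ n)^-1).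
- rewrite finvZD// (pairing_linear sf)//; exact: schwartz_sqi (finv_schwartz _).
- exact: finv_pairing_bound.
by exists F.
Qed.

(** The representatives in space are known only through their pairings with Schwartz functions.
    Their differences lie in the closure of these, so [closure_bound] converts the bound on pairings
    into an L2 bound by the difference on the Fourier side. *)
Lemma C_L2_of_multiplier (u : R -> distr R n) (V : R -> E -> C) :
  (forall t : R, 0 <= t -> sqE (V t)) ->
  (forall t : R, 0 <= t -> nE (fun x => V s x - V t x)
     @[s --> within halfline (nbhs t)] --> (0 : R)) ->
  (forall t phi, 0 <= t -> schwartz phi ->
     u t phi = cI mu (fun s => V t (point s) * finv phi (point s))) ->
  C_L2 u.
Proof.
move=> sV cV uV.
have /choice[f hf] : forall t : R, exists F, 0 <= t -> closureE F /\
    forall phi, schwartz phi -> cI mu (fun s => F (point s) * phi (point s)) = u t phi.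
  move=> t; have [t0|t0] := leP 0 t; last by exists (fun=> 0).
  have [F [cF hF]] := finv_L2 (sV _ t0); exists F => _; split => // phi sphi.
  by rewrite hF// uV.
have sf t : 0 <= t -> sqE (f t) by move=> t0; exact: (hf t t0).1.1.
pose c : R := 2 * ((2 * pi) ^+ n)^-1.
have bnd s t : 0 <= s -> 0 <= t ->
    nE (fun x => f s x - f t x) <= c * nE (fun x => V s x - V t x).
  move=> s0 t0; have [cs hs] := hf s s0; have [ct ht] := hf t t0.
  have sVV : sqE (fun x => V s x - V t x) by apply: sqiB; exact: sV.
  have i0 : 0 <= ((2 * pi) ^+ n)^-1 :> R.
    by rewrite invr_ge0 exprn_ge0// mulr_ge0// ltW// pi_gt0.
  have -> : c * nE (fun x => V s x - V t x) =
      2 * (Num.sqrt (nE (fun x => V s x - V t x)) * Num.sqrt ((2 * pi) ^+ n)^-1) ^+ 2.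
    by rewrite exprMn !sqr_sqrtr ?nrm2_ge0// /c mulrA mulrAC.
  have PZD := (fun a phi psi => @schwartzZD R n a phi psi).
  apply: (closure_bound (fun phi => @schwartzJ R n phi) (fun phi => @schwartz_sqi _ _ phi)).
  - by rewrite mulr_ge0 ?sqrtr_ge0.
  - exact: (in_closureB PZD (fun phi => @schwartz_sqi _ _ phi) cs ct).
  - move=> phi sphi; apply: le_trans (finv_pairing_bound sVV sphi).
    have e : cI mu (fun r => (f s (point r) - f t (point r)) * phi (point r)) =
        cI mu (fun r => (V s (point r) - V t (point r)) * finv phi (point r)).
      have s1 := schwartz_sqi sphi; have s2 := schwartz_sqi (finv_schwartz sphi).
      transitivity (u s phi - u t phi).
        rewrite -hs// -ht// -cIB; [|by apply: sqiM => //; exact: sf..].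
        by apply: eq_cI => r; rewrite mulrBl.
      rewrite !uV// -cIB; [|by apply: sqiM => //; exact: sV..].
      by apply: eq_cI => r; rewrite mulrBl.
    by rewrite e.
exists f.
  move=> t t0; split; first by apply/L2_sqE; exact: sf.
  by move=> phi sphi; rewrite -(hf t t0).2.
move=> t t0.
have h : Num.sqrt (nE (fun x => f s x - f t x)) @[s --> within halfline (nbhs t)] --> (0 : R).
  rewrite -(@sqrtr0 R); apply: cvg_comp; last exact: sqrt_continuous.
  have h1 : c * nE (fun x => V s x - V t x) @[s --> within halfline (nbhs t)] --> (0 : R).
    by rewrite -(mulr0 c); apply: cvgMl_tmp; exact: cV.
  apply: (squeeze_cvgr _ (cvg_cst 0) h1).
  apply: filterS (@withinT _ (nbhs t) halfline _) => s s0.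
  by rewrite nrm2_ge0/=; exact: bnd.
have h2 : (Num.sqrt (nE (fun x => f s x - f t x)))%:E @[s --> within halfline (nbhs t)] --> (0%E : \bar R).
  exact: (cvg_comp _ _ h).
apply: cvg_trans h2; apply: near_eq_cvg.
apply: filterS (@withinT _ (nbhs t) halfline _) => s s0.
by rewrite L2normE//; apply: sqiB; exact: sf.
Qed.

End fourier_L2.

(** * The system at a fixed frequency *)

Section real_lemmas.
Context {R : realType}.

Lemma MVT_between (f df : R -> R) (s t : R) : (forall x : R, is_derive x 1 f (df x)) ->
  exists c, [/\ Num.min s t <= c, `|c - t| <= `|s - t| & f s - f t = df c * (s - t)].
Proof.
move=> fd; have fc := is_derive_continuous fd.
have [st|st] := leP s t.
  have [c] := MVT_segment st (fun x _ => fd x) (continuous_subspaceT fc).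
  rewrite in_itv/= => /andP[sc ct] e; exists c; split => //.
    by rewrite distrC [`|s - t|]distrC !ger0_norm ?subr_ge0// lerB.
  by rewrite -opprB e -mulrN opprB.
have [c] := MVT_segment (ltW st) (fun x _ => fd x) (continuous_subspaceT fc).
rewrite in_itv/= => /andP[sc ct] e; exists c; split => //.
by rewrite !ger0_norm ?subr_ge0// ?(ltW st)// lerB.
Qed.

Lemma taylor2 (g g1 g2 : R -> R) (M s t : R) :
  (forall x : R, is_derive x 1 g (g1 x)) -> (forall x : R, is_derive x 1 g1 (g2 x)) ->
  (forall x, 0 <= x -> `|g2 x| <= M) -> 0 <= s -> 0 <= t ->
  `|g s - g t - (s - t) * g1 t| <= M * (s - t) ^+ 2.
Proof.
move=> gd1 gd2 hM s0 t0.
have [c [c0 cst ->]] := MVT_between s t gd1.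
have [d [d0 dst e]] := MVT_between c t gd2.
have c00 : 0 <= c by apply: le_trans c0; rewrite le_min s0.
have d00 : 0 <= d by apply: le_trans d0; rewrite le_min c00.
have -> : g1 c * (s - t) - (s - t) * g1 t = (g1 c - g1 t) * (s - t) by ring.
rewrite e !normrM -mulrA -(real_normK (num_real (s - t))) expr2.
by apply: ler_pM; rewrite ?mulr_ge0 ?hM ?ler_wpM2r.
Qed.

Lemma pseries_cvg (c : nat -> R) (M b : R) : 0 <= M -> 0 <= b ->
  (forall k, `|c k| <= M * (b ^+ k / k`!%:R)) -> forall K, cvgn (pseries c K).
Proof.
move=> M0 b0 hc K; apply: normed_cvg.
apply: (@series_le_cvg _ _ (fun k => M * exp_coeff (b * `|K|) k)).
- by move=> k; exact: normr_ge0.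
- by move=> k; rewrite mulr_ge0// exp_coeff_ge0// mulr_ge0.
- move=> k; rewrite /exp_coeff /= normrM normrX exprMn.
  by rewrite [_ * _ / _]mulrAC mulrA ler_wpM2r ?exprn_ge0.
- by apply: is_cvg_seriesZ; exact: is_cvg_series_exp_coeff.
Qed.

End real_lemmas.

Section linear_ode.
Context {R : realType}.
Variables (r m : R).
Hypotheses (r0 : 0 <= r) (m0 : 0 <= m).

Definition state := (R * R * R * R)%type.
Definition sU (x : state) : R := x.1.1.1.
Definition sZ (x : state) : R := x.1.1.2.
Definition sV (x : state) : R := x.1.2.
Definition sH (x : state) : R := x.2.

(* A state is the value at one frequency xi of the Fourier transforms of
   [(u - u0, |D|^2 u, u_t, theta)], with [r = |xi|^2] and [m = |xi|^(2 sigma)]. *)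
Definition vfield (x : state) : state :=
  (sV x, r * sV x, - (r * sZ x) + r * sH x - m * sV x, - (r * sH x) - r * sV x).

Let norm1 (x : state) : R := `|sU x| + `|sZ x| + `|sV x| + `|sH x|.
(** Bounds the operator norm of [vfield] in the l1 norm; it serves the convergence of the
    exponential series only, the uniform estimates coming from [flow_energy]. *)
Let b : R := 1 + 2 * r + m.

Let b0 : 0 <= b. Proof. by rewrite /b !addr_ge0// mulr_ge0. Qed.

Let norm1_vfield x : norm1 (vfield x) <= b * norm1 x.
Proof.
rewrite /norm1 /vfield /= /sU /sZ /sV /sH /=; case: x => [[[u z] v] h] /=.
have h1 : `|r * v| <= r * `|v| by rewrite normrM (ger0_norm r0).
have h2 : `|- (r * z) + r * h - m * v| <= r * `|z| + r * `|h| + m * `|v|.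
  apply: le_trans (ler_normB _ _) _; apply: lerD; last by rewrite normrM (ger0_norm m0).
  by apply: le_trans (ler_normD _ _) _; rewrite normrN !normrM (ger0_norm r0).
have h3 : `|- (r * h) - r * v| <= r * `|h| + r * `|v|.
  by apply: le_trans (ler_normB _ _) _; rewrite normrN !normrM (ger0_norm r0).
have hb : b * (`|u| + `|z| + `|v| + `|h|) = `|v| + r * `|v| + (r * `|z| + r * `|h| + m * `|v|) +
  (r * `|h| + r * `|v|) + (b * `|u| + (1 + r + m) * `|z| + (1 + m) * `|h|).
  by rewrite /b; ring.
rewrite hb; have : 0 <= b * `|u| + (1 + r + m) * `|z| + (1 + m) * `|h|.
  by rewrite !addr_ge0// mulr_ge0// !addr_ge0.
lra.
Qed.

Let norm1_iter x k : norm1 (iter k vfield x) <= b ^+ k * norm1 x.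
Proof.
elim: k => [|k IH]; first by rewrite expr0 mul1r.
by rewrite iterS exprS -mulrA; apply: le_trans (norm1_vfield _) _; rewrite ler_wpM2l.
Qed.

(** The coordinate [p] of exp(t [vfield]) applied to [x]. As a series whose coefficients are
    polynomials in [r], [m] and the data, it is measurable in the frequency, see
    [flow_measurable]. *)
Definition flow (p : state -> R) (x : state) (t : R) : R :=
  limn (pseries (fun k => p (iter k vfield x) / k`!%:R) t).

Let bounded_by_norm (p : state -> R) := forall x, `|p x| <= norm1 x.

Let flow_is_cvg (p : state -> R) x t : bounded_by_norm p ->
  cvgn (pseries (fun k => p (iter k vfield x) / k`!%:R) t).
Proof.
move=> hp; apply: (@pseries_cvg _ _ (norm1 x) b) => //.
  by rewrite /norm1 !addr_ge0.
move=> k; rewrite normrM normfV (ger0_norm (ler0n _ _)) mulrA ler_wpM2r ?invr_ge0//.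
by apply: le_trans (hp _) _; rewrite mulrC; exact: norm1_iter.
Qed.

Lemma flow_diffs (p : state -> R) x : pseries_diffs (fun k => p (iter k vfield x) / k`!%:R) =
  (fun k => p (iter k vfield (vfield x)) / k`!%:R).
Proof.
apply/funext => k; rewrite /pseries_diffs -iterSr factS natrM invfM.
by rewrite mulrCA mulVKf ?pnatr_eq0.
Qed.

Let is_derive_flow0 (p : state -> R) x (t : R) : bounded_by_norm p ->
  is_derive t 1 (flow p x) (flow p (vfield x) t).
Proof.
move=> hp.
have h := @pseries_snd_diffs R (fun k => p (iter k vfield x) / k`!%:R) (`|t| + 1) t.
rewrite flow_diffs in h; apply: h.
- exact: flow_is_cvg.
- exact: flow_is_cvg.
- by rewrite flow_diffs; exact: flow_is_cvg.
- by rewrite [ltRHS]ger0_norm ?addr_ge0// ltrDl.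
Qed.

Lemma flow0 (p : state -> R) x : flow p x 0 = p x.
Proof.
apply/cvg_lim => //; rewrite -cvg_shiftS.
rewrite (_ : (fun k => _) = cst (p x)); first exact: cvg_cst.
apply/funext => k /=; rewrite /pseries /series /= big_nat_recl//= expr0 mulr1 fact0 divr1.
by rewrite big1 ?addr0// => i _; rewrite exprS mul0r mulr0.
Qed.

Let bU : bounded_by_norm sU.
Proof. by move=> x; rewrite /norm1 -!addrA lerDl !addr_ge0. Qed.
Let bZ : bounded_by_norm sZ.
Proof. by move=> x; rewrite /norm1 -!addrA addrCA lerDl !addr_ge0. Qed.
Let bV : bounded_by_norm sV.
Proof. by move=> x; rewrite /norm1 -addrA addrCA lerDl !addr_ge0. Qed.
Let bH : bounded_by_norm sH.
Proof. by move=> x; rewrite /norm1 lerDr !addr_ge0. Qed.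

Let cvg_flow (p : state -> R) x t : bounded_by_norm p ->
  pseries (fun k => p (iter k vfield x) / k`!%:R) t @ \oo --> flow p x t.
Proof. by move=> hp; exact: flow_is_cvg. Qed.

(** The derivative of a coordinate is the series started at [vfield x]; expressing it through the
    series started at [x] closes the system of differential equations. *)
Let flow_comb (q : state -> R) (a1 a2 a3 : R) x t :
  (forall y, q (vfield y) = a1 * sZ y + a2 * sV y + a3 * sH y) ->
  flow q (vfield x) t = a1 * flow sZ x t + a2 * flow sV x t + a3 * flow sH x t.
Proof.
move=> hq; apply/cvg_lim => //.
have -> : pseries (fun k => q (iter k vfield (vfield x)) / k`!%:R) t = (fun N =>
    a1 * pseries (fun k => sZ (iter k vfield x) / k`!%:R) t N +
    a2 * pseries (fun k => sV (iter k vfield x) / k`!%:R) t N +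
    a3 * pseries (fun k => sH (iter k vfield x) / k`!%:R) t N).
  apply/funext => N; rewrite /pseries /series /= !mulr_sumr -!big_split /=.
  by apply: eq_bigr => k _; rewrite -iterSr iterS hq; ring.
by apply: cvgD; [apply: cvgD|]; apply: cvgMl_tmp; exact: cvg_flow.
Qed.

Lemma is_derive_flowU x (t : R) : is_derive t 1 (flow sU x) (flow sV x t).
Proof.
have := is_derive_flow0 x t bU; rewrite (@flow_comb sU 0 1 0); last first.
  by move=> y; rewrite /sU /=; ring.
by rewrite !mul0r mul1r add0r addr0.
Qed.

Lemma is_derive_flowZ x (t : R) : is_derive t 1 (flow sZ x) (r * flow sV x t).
Proof.
have := is_derive_flow0 x t bZ; rewrite (@flow_comb sZ 0 r 0); last first.
  by move=> y; rewrite {1}/sZ /=; ring.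
by rewrite !mul0r add0r addr0.
Qed.

Definition accV x t := - (r * flow sZ x t) + r * flow sH x t - m * flow sV x t.

Lemma is_derive_flowV x (t : R) : is_derive t 1 (flow sV x) (accV x t).
Proof.
have := is_derive_flow0 x t bV; rewrite (@flow_comb sV (- r) (- m) r); last first.
  by move=> y; rewrite {1}/sV /=; ring.
by move=> h; apply: is_derive_eq h _; rewrite /accV; ring.
Qed.

Definition accH x t := - (r * flow sH x t) - r * flow sV x t.

Lemma is_derive_flowH x (t : R) : is_derive t 1 (flow sH x) (accH x t).
Proof.
have := is_derive_flow0 x t bH; rewrite (@flow_comb sH 0 (- r) (- r)); last first.
  by move=> y; rewrite {1}/sH /=; ring.
by move=> h; apply: is_derive_eq h _; rewrite /accH; ring.
Qed.

(** The quantity Z - r U is conserved and U starts at 0. Hence |xi|^2 times the increment is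
    recovered from Z without dividing by |xi|^2. *)
Lemma flowU_eq z v h t : r * flow sU (0, z, v, h) t = flow sZ (0, z, v, h) t - z.
Proof.
set x := (0, z, v, h).
pose g t := flow sZ x t - r * flow sU x t.
have gd (s : R) : is_derive s 1 g 0.
  have := is_deriveB (is_derive_flowZ x s) (is_deriveZ r (is_derive_flowU x s)).
  by move=> h'; apply: is_derive_eq h' _; rewrite scaleRE subrr.
have := is_derive_0_is_cst t 0 gd; rewrite /g !flow0 /sZ /sU /= mulr0 subr0 => e.
by rewrite -e; ring.
Qed.

(** The couplings are antisymmetric and cancel in the derivative of the energy, leaving -2 m V^2 - 2
    r H^2. The bound therefore depends neither on [r] nor on [m]. *)
Lemma flow_energy u z v h t : 0 <= t ->
  flow sZ (u, z, v, h) t ^+ 2 + flow sV (u, z, v, h) t ^+ 2 + flow sH (u, z, v, h) t ^+ 2 <=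
  (`|z| + `|v| + `|h|) ^+ 2.
Proof.
move=> t0; set x := (u, z, v, h).
pose g := fun s => flow sZ x s ^+ 2 + flow sV x s ^+ 2 + flow sH x s ^+ 2.
pose dg s := - (2 * m * flow sV x s ^+ 2 + 2 * r * flow sH x s ^+ 2).
have gd (s : R) : is_derive s 1 g (dg s).
  have h1 := is_deriveX 2 (is_derive_flowZ x s).
  have h2 := is_deriveX 2 (is_derive_flowV x s).
  have h3 := is_deriveX 2 (is_derive_flowH x s).
  have := is_deriveD (is_deriveD h1 h2) h3.
  move=> h'; apply: is_derive_eq h' _.
  by rewrite !scaleRE /dg /accV /accH /=; ring.
have [c [c0 _ e]] := MVT_between t 0 gd.
apply: (@le_trans _ _ (g 0)).
  rewrite -/(g t) -subr_le0 e subr0 mulr_le0_ge0// /dg oppr_le0.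
  by rewrite addr_ge0// mulr_ge0 ?sqr_ge0// mulr_ge0.
rewrite /g !flow0 /sZ /sV /sH /=.
rewrite -(real_normK (num_real z)) -(real_normK (num_real v)) -(real_normK (num_real h)).
have := mulr_ge0 (normr_ge0 z) (normr_ge0 v).
have := mulr_ge0 (normr_ge0 z) (normr_ge0 h).
have := mulr_ge0 (normr_ge0 v) (normr_ge0 h).
nra.
Qed.

Lemma flow_bound (p : state -> R) u z v h t : 0 <= t ->
  (p = sZ \/ p = sV \/ p = sH) ->
  `|flow p (u, z, v, h) t| <= `|z| + `|v| + `|h|.
Proof.
move=> t0 hp; have := @flow_energy u z v h t t0.
rewrite -(ler_sqr (normr_ge0 _)) ?nnegrE ?addr_ge0// real_normK ?num_real//.
by case: hp => [->|[->|->]]; apply: le_trans;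
  [rewrite -addrA lerDl|rewrite addrAC lerDr|rewrite lerDr]; rewrite ?addr_ge0 ?sqr_ge0.
Qed.

Lemma flow_cvg (p : state -> R) x t : p = sU \/ p = sZ \/ p = sV \/ p = sH ->
  pseries (fun k => p (iter k vfield x) / k`!%:R) t @ \oo --> flow p x t.
Proof. by move=> [->|[->|[->|->]]]; exact: cvg_flow. Qed.

End linear_ode.

Section flow_estimates.
Context {R : realType}.
Local Notation C := R[i].
Variables (r m : R).
Hypotheses (r0 : 0 <= r) (m0 : 0 <= m).

Let rho : R := 1 + r + m.

Let rho1 : 1 <= rho. Proof. by rewrite /rho -addrA lerDl addr_ge0. Qed.

Section real_data.
Variables (z v h D : R).
Hypothesis hD : `|z| + `|v| + `|h| <= D.
Let x : state := (0, z, v, h).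
Local Notation fl p := (flow r m p x).

Let D0 : 0 <= D. Proof. by apply: le_trans hD; rewrite !addr_ge0. Qed.

Lemma flow_le p t : 0 <= t -> p = sZ \/ p = sV \/ p = sH -> `|fl p t| <= D.
Proof. by move=> t0 hp; apply: le_trans hD; exact: flow_bound. Qed.

Let bZ t : 0 <= t -> `|fl sZ t| <= D. Proof. by move=> ?; apply: flow_le; auto. Qed.
Let bV t : 0 <= t -> `|fl sV t| <= D. Proof. by move=> ?; apply: flow_le; auto. Qed.
Let bH t : 0 <= t -> `|fl sH t| <= D. Proof. by move=> ?; apply: flow_le; auto. Qed.

Let mul_le (a y B : R) : 0 <= a -> `|y| <= B -> `|a * y| <= a * B.
Proof. by move=> a0 yB; rewrite normrM (ger0_norm a0) ler_wpM2l. Qed.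

Let accV_le t : 0 <= t -> `|accV r m x t| <= 2 * rho * D.
Proof.
move=> t0; rewrite /accV; apply: le_trans (ler_normB _ _) _.
have h1 := mul_le r0 (bZ t0); have h2 := mul_le r0 (bH t0); have h3 := mul_le m0 (bV t0).
have h4 : `|- (r * fl sZ t) + r * fl sH t| <= r * D + r * D.
  by apply: le_trans (ler_normD _ _) _; rewrite normrN lerD.
apply: le_trans (lerD h4 h3) _.
have := mulr_ge0 m0 D0; rewrite /rho; move: D0; lra.
Qed.

Let accH_le t : 0 <= t -> `|accH r m x t| <= 2 * rho * D.
Proof.
move=> t0; rewrite /accH; apply: le_trans (ler_normB _ _) _; rewrite normrN.
have h1 := mul_le r0 (bH t0); have h2 := mul_le r0 (bV t0).
apply: le_trans (lerD h1 h2) _.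
have := mulr_ge0 m0 D0; rewrite /rho; move: D0; lra.
Qed.

Lemma flowU_le t : 0 <= t -> `|fl sU t| <= D * t.
Proof.
move=> t0; have [c [c0 _]] := MVT_between t 0 (is_derive_flowU r0 m0 x).
rewrite flow0 // subr0 {2}/sU /= subr0 => ->.
rewrite normrM (ger0_norm t0) ler_wpM2r// bV//.
by apply: le_trans c0; rewrite le_min t0 lexx.
Qed.

Let taylor_const s t : 0 <= s -> 0 <= t -> 2 * rho * D * (s - t) ^+ 2 <= 4 * rho ^+ 2 * D * (s - t) ^+ 2.
Proof.
move=> s0 t0; rewrite ler_wpM2r ?sqr_ge0// ler_wpM2r// expr2.
by move: rho1; nra.
Qed.

(** The three remainders share one constant, of order [rho ^+ 2]: it grows polynomially with the
    frequency, so the expansion can be integrated against Schwartz functions. *)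
Lemma flowU_taylor s t : 0 <= s -> 0 <= t ->
  `|fl sU s - fl sU t - (s - t) * fl sV t| <= 4 * rho ^+ 2 * D * (s - t) ^+ 2.
Proof.
move=> s0 t0; apply: le_trans (taylor_const s0 t0).
exact: (taylor2 (is_derive_flowU r0 m0 x) (is_derive_flowV r0 m0 x) accV_le).
Qed.

Lemma flowV_taylor s t : 0 <= s -> 0 <= t ->
  `|fl sV s - fl sV t - (s - t) * accV r m x t| <= 4 * rho ^+ 2 * D * (s - t) ^+ 2.
Proof.
move=> s0 t0.
(* The second derivative of V, obtained by differentiating [accV] with the equations. *)
pose g2 s := - (r * (r * fl sV s)) + r * accH r m x s - m * accV r m x s.
apply: (taylor2 (g2 := g2) (is_derive_flowV r0 m0 x)) => // [y|y y0].
  have := is_deriveB (is_deriveD (is_deriveN (is_deriveZ r (is_derive_flowZ r0 m0 x y)))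
    (is_deriveZ r (is_derive_flowH r0 m0 x y))) (is_deriveZ m (is_derive_flowV r0 m0 x y)).
  by move=> h'; apply: is_derive_eq h' _; rewrite !scaleRE.
rewrite /g2; apply: le_trans (ler_normB _ _) _.
have h1 := mul_le r0 (mul_le r0 (bV y0)).
have h2 := mul_le r0 (accH_le y0); have h3 := mul_le m0 (accV_le y0).
have h4 : `|- (r * (r * fl sV y)) + r * accH r m x y| <= r * (r * D) + r * (2 * rho * D).
  by apply: le_trans (ler_normD _ _) _; rewrite normrN lerD.
apply: le_trans (lerD h4 h3) _.
have -> : r * (r * D) + r * (2 * rho * D) + m * (2 * rho * D) =
  (r * r + 2 * (r + m) * rho) * D by ring.
rewrite ler_wpM2r//.
have h5 := mulr_ge0 r0 m0; have h6 := mulr_ge0 r0 r0; have h7 := mulr_ge0 m0 m0.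
have -> : 4 * rho ^+ 2 = r * r + 2 * (r + m) * rho +
   (r * r + 2 * (m * m) + 4 * (r * m) + 6 * r + 6 * m + 4) by rewrite /rho; ring.
move: r0 m0 h5 h6 h7; lra.
Qed.

Lemma flowH_taylor s t : 0 <= s -> 0 <= t ->
  `|fl sH s - fl sH t - (s - t) * accH r m x t| <= 4 * rho ^+ 2 * D * (s - t) ^+ 2.
Proof.
move=> s0 t0.
pose g2 s := - (r * accH r m x s) - r * accV r m x s.
apply: (taylor2 (g2 := g2) (is_derive_flowH r0 m0 x)) => // [y|y y0].
  have := is_deriveB (is_deriveN (is_deriveZ r (is_derive_flowH r0 m0 x y)))
    (is_deriveZ r (is_derive_flowV r0 m0 x y)).
  by move=> h'; apply: is_derive_eq h' _; rewrite !scaleRE.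
rewrite /g2; apply: le_trans (ler_normB _ _) _; rewrite normrN.
have h2 := mul_le r0 (accH_le y0); have h3 := mul_le r0 (accV_le y0).
apply: le_trans (lerD h2 h3) _.
have -> : r * (2 * rho * D) + r * (2 * rho * D) = (4 * r * rho) * D by ring.
rewrite ler_wpM2r// expr2 mulrA ler_wpM2r ?(le_trans ler01 rho1)// ler_wpM2l//.
by rewrite /rho addrAC lerDr addr_ge0.
Qed.

Lemma flow_seq_cvg p (u : nat -> R) t : p = sZ \/ p = sV \/ p = sH ->
  u k @[k --> \oo] --> t -> fl p (u k) @[k --> \oo] --> fl p t.
Proof.
move=> hp ut; apply: (cvg_comp _ _ ut); case: hp => [->|[->|->]].
- exact: (is_derive_continuous (is_derive_flowZ r0 m0 x)).
- exact: (is_derive_continuous (is_derive_flowV r0 m0 x)).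
- exact: (is_derive_continuous (is_derive_flowH r0 m0 x)).
Qed.

End real_data.

(** The system has real coefficients, so complex data are propagated through their real and
    imaginary parts; the initial 0 is the increment of u. *)
Definition sol p (z v h : C) (t : R) : C :=
  flow r m p (0, complex.Re z, complex.Re v, complex.Re h) t +i*
  flow r m p (0, complex.Im z, complex.Im v, complex.Im h) t.

Definition data_size (z v h : C) : R := normc z + normc v + normc h.

Variables (z v h : C).
Local Notation D := (data_size z v h).

Let hRe : `|complex.Re z| + `|complex.Re v| + `|complex.Re h| <= D.
Proof. by rewrite !lerD// Re_le_normc. Qed.

Let hIm : `|complex.Im z| + `|complex.Im v| + `|complex.Im h| <= D.
Proof. by rewrite !lerD// Im_le_normc. Qed.

Definition dV t : C := - (r%:C * sol sZ z v h t) + r%:C * sol sH z v h t - m%:C * sol sV z v h t.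

Definition dH t : C := - (r%:C * sol sH z v h t) - r%:C * sol sV z v h t.

Lemma sol0 p (q : C -> C -> C -> C) : 
  (forall a b c, complex.Re (q a b c) = p (0, complex.Re a, complex.Re b, complex.Re c) /\
                 complex.Im (q a b c) = p (0, complex.Im a, complex.Im b, complex.Im c)) ->
  sol p z v h 0 = q z v h.
Proof. by move=> hq; have [h1 h2] := hq z v h; apply: complex_ext; rewrite /= flow0. Qed.

Lemma solU_eq t : r%:C * sol sU z v h t = sol sZ z v h t - z.
Proof.
apply: complex_ext; rewrite !ReImE /= mul0r ?subr0 ?addr0 -(flowU_eq r0 m0)//.
Qed.

Lemma sol_le p t : 0 <= t -> p = sZ \/ p = sV \/ p = sH -> normc (sol p z v h t) <= 2 * D.
Proof.
move=> t0 hp; apply: le_trans (normc_le_ReIm _) _.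
by rewrite mulr_natl mulr2n; apply: lerD; [exact: (flow_le hRe)|exact: (flow_le hIm)].
Qed.

Lemma solU_le t : 0 <= t -> normc (sol sU z v h t) <= 2 * (D * t).
Proof.
move=> t0; apply: le_trans (normc_le_ReIm _) _.
by rewrite mulr_natl mulr2n; apply: lerD; [exact: (flowU_le hRe)|exact: (flowU_le hIm)].
Qed.

Let taylor_join (w : C) (B : R) : `|complex.Re w| <= 4 * rho ^+ 2 * D * B ->
  `|complex.Im w| <= 4 * rho ^+ 2 * D * B -> normc w <= 8 * rho ^+ 2 * D * B.
Proof. by move=> h1 h2; apply: le_trans (normc_le_ReIm _) _; lra. Qed.

Lemma solU_taylor s t : 0 <= s -> 0 <= t ->
  normc (sol sU z v h s - sol sU z v h t - (s - t)%:C * sol sV z v h t) <=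
  8 * rho ^+ 2 * D * (s - t) ^+ 2.
Proof.
move=> s0 t0; apply: taylor_join; rewrite !ReImE /= mul0r ?subr0 ?addr0.
  exact: (flowU_taylor hRe).
exact: (flowU_taylor hIm).
Qed.

Lemma solV_taylor s t : 0 <= s -> 0 <= t ->
  normc (sol sV z v h s - sol sV z v h t - (s - t)%:C * dV t) <=
  8 * rho ^+ 2 * D * (s - t) ^+ 2.
Proof.
move=> s0 t0; apply: taylor_join; rewrite !ReImE /= !mul0r ?subr0 ?addr0.
  exact: (flowV_taylor hRe).
exact: (flowV_taylor hIm).
Qed.

Lemma solH_taylor s t : 0 <= s -> 0 <= t ->
  normc (sol sH z v h s - sol sH z v h t - (s - t)%:C * dH t) <=
  8 * rho ^+ 2 * D * (s - t) ^+ 2.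
Proof.
move=> s0 t0; apply: taylor_join; rewrite !ReImE /= !mul0r ?subr0 ?addr0.
  exact: (flowH_taylor hRe).
exact: (flowH_taylor hIm).
Qed.

Lemma sol_seq_cvg p (u : nat -> R) t : p = sZ \/ p = sV \/ p = sH ->
  u k @[k --> \oo] --> t ->
  normc (sol p z v h (u k) - sol p z v h t) @[k --> \oo] --> (0 : R).
Proof.
move=> hp ut.
pose fr := flow r m p (0, complex.Re z, complex.Re v, complex.Re h).
pose fi := flow r m p (0, complex.Im z, complex.Im v, complex.Im h).
have hs : (`|fr (u k) - fr t| + `|fi (u k) - fi t|) @[k --> \oo] --> (0 : R).
  by apply: cvgD0; apply/norm_cvg0P; apply/subr_cvg0; exact: flow_seq_cvg.
apply: squeeze_cvgr (cvg_cst 0) hs; apply: nearW => k.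
by rewrite normc_ge0; apply: le_trans (normc_le_ReIm _) _; rewrite ReD ImD ReN ImN.
Qed.

End flow_estimates.

(** * Measurability of the flow in the frequency *)

Section sol_measurable.
Context d (T : measurableType d) (R : realType).
Variables (r m : T -> R).
Hypotheses (mr : measurable_fun setT r) (mm : measurable_fun setT m).
Hypotheses (r0 : forall x, 0 <= r x) (m0 : forall x, 0 <= m x).

Lemma flow_measurable p (z v h : T -> R) t : p = sU \/ p = sZ \/ p = sV \/ p = sH ->
  measurable_fun setT z -> measurable_fun setT v -> measurable_fun setT h ->
  measurable_fun setT (fun x => flow (r x) (m x) p (0, z x, v x, h x) t).
Proof.
move=> hp mz mv mh.
have mi k : [/\ measurable_fun setT (fun x => sU (iter k (vfield (r x) (m x)) (0, z x, v x, h x))),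
    measurable_fun setT (fun x => sZ (iter k (vfield (r x) (m x)) (0, z x, v x, h x))),
    measurable_fun setT (fun x => sV (iter k (vfield (r x) (m x)) (0, z x, v x, h x))) &
    measurable_fun setT (fun x => sH (iter k (vfield (r x) (m x)) (0, z x, v x, h x)))].
  elim: k => [|k [h1 h2 h3 h4]]; first by split.
  split; under eq_fun do rewrite iterS /vfield /sU /sZ /sV /sH /=.
  - exact: h3.
  - exact: measurable_funM.
  - apply: measurable_funB; last exact: measurable_funM.
    apply: measurable_funD; last exact: measurable_funM.
    by apply: measurable_funN; exact: measurable_funM.
  - apply: measurable_funB; last exact: measurable_funM.
    by apply: measurable_funN; exact: measurable_funM.
have mp k : measurable_fun setT (fun x => p (iter k (vfield (r x) (m x)) (0, z x, v x, h x))).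
  by have [h1 h2 h3 h4] := mi k; case: hp => [->|[->|[->|->]]].
apply: (@measurable_fun_cvg _ _ _ setT (fun N x =>
  pseries (fun k => p (iter k (vfield (r x) (m x)) (0, z x, v x, h x)) / k`!%:R) t N)).
  move=> N; rewrite /pseries /series /=.
  elim: N => [|N IH].
    by under eq_fun do rewrite big_geq//; exact: measurable_cst.
  under eq_fun do rewrite big_nat_recr//=.
  apply: measurable_funD => //; apply: measurable_funM => //.
  by apply: measurable_funM.
by move=> x _; exact: flow_cvg.
Qed.

Lemma sol_cmeas p (z v h : T -> R[i]) t : p = sU \/ p = sZ \/ p = sV \/ p = sH ->
  cmeas z -> cmeas v -> cmeas h ->
  cmeas (fun x => sol (r x) (m x) p (z x) (v x) (h x) t).
Proof. by move=> hp [? ?] [? ?] [? ?]; split; exact: flow_measurable. Qed.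

End sol_measurable.

(** * Fourier multipliers and time derivatives *)

Section multipliers.
Context {R : realType} {n : nat}.
Local Notation C := R[i].
Local Notation E := 'rV[R]_n.
Local Notation mu := (leb R n).
Implicit Types (f phi psi : E -> C) (T S : distr R n).

Definition rr (xi : E) : R := dot xi xi.
Definition mm (sigma : R) (xi : E) : R := enorm xi `^ (2 * sigma).

Lemma rr_ge0 xi : 0 <= rr xi. Proof. exact: dot_ge0. Qed.

Lemma mm_ge0 sigma xi : 0 <= mm sigma xi. Proof. exact: powR_ge0. Qed.

Lemma rr_le xi : rr xi <= (1 + enorm xi) ^+ 2.
Proof. by rewrite /rr -enorm2E lerXn2r ?nnegrE ?addr_ge0 ?enorm_ge0// lerDr. Qed.

Lemma mm_le sigma xi : 0 <= sigma <= 2 -> mm sigma xi <= (1 + enorm xi) ^+ 4.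
Proof.
move=> /andP[s0 s2]; have e0 := enorm_ge0 xi.
apply: (@le_trans _ _ ((1 + enorm xi) `^ (2 * sigma))).
  by apply: ge0_ler_powR; rewrite ?nnegrE ?mulr_ge0 ?addr_ge0// lerDr.
rewrite -powR_mulrn ?addr_ge0// ler_powR ?lerDl//.
by rewrite (_ : 4%:R = 2 * 2 :> R) ?ler_pM2l// -natrM.
Qed.

Lemma measurable_rr : measurable_fun setT (fun t : n.-tuple R => rr (point t)).
Proof. exact: measurable_sqnorm. Qed.

Lemma measurable_mm sigma : measurable_fun setT (fun t : n.-tuple R => mm sigma (point t)).
Proof.
apply: (measurableT_comp (measurable_powR _)).
apply: (@measurableT_comp _ _ _ _ _ _ (@Num.sqrt R)); last exact: measurable_sqnorm.
by apply: continuous_measurable_fun; exact: sqrt_continuous.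
Qed.

Lemma sqE_multiplier (g : E -> R) (c : R) (j : nat) psi : 0 <= c ->
  measurable_fun setT (fun t : n.-tuple R => g (point t)) ->
  (forall xi, `|g xi| <= c * (1 + enorm xi) ^+ j) -> schwartz psi ->
  sqE (fun xi => (g xi)%:C * psi xi).
Proof.
move=> c0 mg hg spsi; have [M M0 hM] := decay_wt j (schwartz_decay spsi).
apply: (@sqi_le _ _ _ _ _ (fun t => (c * M) ^+ 2 * wt t)).
- by apply: cmeasM; [exact: cmeasR|exact: schwartz_cmeas].
- exact: rintZ (rint_wt n).
move=> t; rewrite normcM normcR.
apply: (@le_trans _ _ ((c * M * wt t) ^+ 2)).
  rewrite lerXn2r ?nnegrE ?mulr_ge0 ?normc_ge0 ?(ltW (wt_gt0 _))//.
  rewrite -mulrA; apply: le_trans (ler_wpM2l c0 (hM t)).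
  by rewrite mulrA ler_wpM2r ?normc_ge0.
rewrite exprMn ler_wpM2l ?sqr_ge0// expr2.
by rewrite ler_piMl ?wt_le1 ?(ltW (wt_gt0 t)).
Qed.

Lemma sqE_rr psi : schwartz psi -> sqE (fun xi => (rr xi)%:C * psi xi).
Proof. by move=> spsi; apply: schwartz_sqi; exact: schwartz_sqnorm. Qed.

Lemma sqE_mm sigma psi : 0 <= sigma <= 2 -> schwartz psi ->
  sqE (fun xi => (mm sigma xi)%:C * psi xi).
Proof.
move=> hs; apply: (@sqE_multiplier _ 1 4) => //; first exact: measurable_mm.
by move=> xi; rewrite ger0_norm ?mm_ge0// mul1r mm_le.
Qed.

Lemma laplacian_fourier_rr psi : schwartz psi ->
  laplacian (fourier psi) = fourier (fun xi => -1 * ((rr xi)%:C * psi xi)).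
Proof.
move=> spsi; rewrite laplacian_fourier// fourierZ; last exact: schwartz_sqnorm.
by apply/funext => xi; rewrite mulN1r.
Qed.

Lemma fourier_bilaplacian psi : schwartz psi -> laplacian (laplacian (fourier psi)) =
  fourier (fun x => (rr x)%:C * ((rr x)%:C * psi x)).
Proof.
move=> spsi; have sr := schwartz_sqnorm spsi.
rewrite laplacian_fourier_rr// laplacian_fourier_rr; last exact: schwartzZ.
by congr fourier; apply/funext => x; ring.
Qed.

Lemma enorm_powR2 (xi : E) : enorm xi `^ 2 = rr xi.
Proof. by rewrite powR_mulrn ?enorm_ge0// enorm2E. Qed.

(** Both alternatives of [is_multiplier] lead to this tested identity, because |xi|^2 phi is again a
    Schwartz function. *)
Lemma is_absD_pairing T S : is_absD 2 T S -> forall phi, schwartz phi ->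
  S (fourier phi) = T (fourier (fun xi => (rr xi)%:C * phi xi)).
Proof.
move=> [[_ h]|[g [_ _ _ hT] [_ _ _ hS]]] phi sphi.
  have := h _ sphi; rewrite /dfourier => ->; congr (T (fourier _)).
  by apply/funext => xi; rewrite enorm_powR2.
have := hS _ sphi; rewrite /dfourier => ->.
have := hT _ (schwartz_sqnorm sphi); rewrite /dfourier /rr => ->.
rewrite /distr_of; congr cint; apply/funext => xi.
by rewrite enorm_powR2 /rr; ring.
Qed.

Lemma pairing_is_absD T S : (forall phi, schwartz phi ->
  S (fourier phi) = T (fourier (fun xi => (rr xi)%:C * phi xi))) -> is_absD 2 T S.
Proof.
move=> h; left; split => phi sphi.
  by under eq_fun do rewrite enorm_powR2; exact: schwartz_sqnorm.
rewrite /dfourier h//; congr (T (fourier _)).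
by apply/funext => xi; rewrite enorm_powR2.
Qed.

Lemma tempered_finv f : sqE f ->
  tempered (fun phi => cI mu (fun s => f (point s) * finv phi (point s))).
Proof.
move=> sf; split.
  move=> a phi psi sphi spsi; rewrite finvZD// (pairing_linear sf)//;
  by apply: schwartz_sqi; exact: finv_schwartz.
set W := \int[mu]_t wt t.
(* Order [2n] is what bounds [phi] by [B * wt]; as [wt <= 1], the squared L2 norm of [phi] is then
   at most [B ^+ 2 * W]. *)
exists (n * 2)%N, (Num.sqrt (nE f) * Num.sqrt ((2 * pi) ^+ n)^-1 * Num.sqrt W).
move=> phi B sphi hB.
have B0 : 0 <= B.
  apply: le_trans (hB [::] 0 _) => //.
  by rewrite mulr_ge0 ?normc_ge0// exprn_ge0// addr_ge0// enorm_ge0.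
apply: le_trans (finv_pairing_bound sf sphi) _.
rewrite -!mulrA; do 2!rewrite ler_wpM2l ?sqrtr_ge0//.
have -> : Num.sqrt W * B = Num.sqrt (B ^+ 2 * W).
  by rewrite sqrtrM ?sqr_ge0// sqrtr_sqr ger0_norm// mulrC.
rewrite ler_wsqrtr// /nE /nrm2 -RintZ; last exact: rint_wt.
apply: Rint_le; [exact: (schwartz_sqi sphi).2|apply: rintZ; exact: rint_wt|].
move=> t; have h := hB [::] (point t) isT.
have w0 := wt_gt0 t.
have h2 : normc (phi (point t)) <= B * wt t.
  rewrite -ler_pdivrMr//; apply: le_trans h; rewrite mulrC ler_wpM2r ?normc_ge0//.
  exact: wtV_le.
apply: (@le_trans _ _ ((B * wt t) ^+ 2)).
  by rewrite lerXn2r ?nnegrE ?normc_ge0 ?mulr_ge0// ltW.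
rewrite exprMn ler_wpM2l ?sqr_ge0// expr2.
by rewrite ler_piMl ?wt_le1 ?(ltW w0).
Qed.

Lemma temperedD T S : tempered T -> tempered S -> tempered (fun phi => T phi + S phi).
Proof.
move=> [lT [N [M hT]]] [lS [N' [M' hS]]]; split.
  by move=> a phi psi sphi spsi; rewrite lT// lS//; ring.
exists (N + N')%N, (M + M') => phi B sphi hB.
have e1 (xi : E) : 1 <= 1 + enorm xi by rewrite lerDl enorm_ge0.
apply: le_trans (le_normcD _ _) _; rewrite mulrDl; apply: lerD.
  apply: hT => // s xi hs.
  apply: le_trans (hB s xi (leq_trans hs (leq_addr _ _))).
  by rewrite ler_wpM2r ?normc_ge0// ler_weXn2l ?leq_addr.
apply: hS => // s xi hs.
apply: le_trans (hB s xi (leq_trans hs (leq_addl _ _))).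
by rewrite ler_wpM2r ?normc_ge0// ler_weXn2l ?leq_addl.
Qed.

Lemma is_tderiv_quadratic (u : R -> distr R n) (t : R) S :
  (forall phi, schwartz phi -> exists K : R, forall s, 0 <= s ->
     normc (u s phi - u t phi - (s - t)%:C * S phi) <= K * (s - t) ^+ 2) ->
  is_tderiv u t S.
Proof.
move=> h phi sphi; have [K hK] := h _ sphi.
have c1 : `|s - t| @[s --> t^'] --> (0 : R).
  by apply/norm_cvg0P; apply/subr_cvg0; exact: (@nbhs_dnbhs _ t).
have c2 : (K * `|s - t|) @[s --> t^'] --> (0 : R).
  by rewrite -(mulr0 K); exact: cvgMl_tmp c1.
have c0 : (K * `|s - t|) @[s --> within halfline t^'] --> (0 : R) by exact: cvg_within_filter.
apply: squeeze_cvgr (cvg_cst 0) c0.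
have : \forall s \near within halfline t^', s != t.
  by apply: cvg_within; exact: (@withinT _ (nbhs t) (fun y => y != t) _).
apply: filterS2 (@withinT _ t^' halfline _) => s s0 st.
rewrite normc_ge0 /=.
have st0 : s - t != 0 by rewrite subr_eq0.
have e : u s phi - u t phi - (s - t)%:C * S phi =
    (s - t)%:C * ((s - t)^-1%:C * (u s phi - u t phi) - S phi).
  by rewrite mulrBr mulrA -rmorphM mulfV// mul1r.
have := hK s s0; rewrite e normcM normcR.
rewrite -[in X in _ <= X](real_normK (num_real (s - t))) expr2 mulrA mulrC.
by rewrite ler_pM2r// normr_gt0.
Qed.

(** The derivative and the remainder weight need only be integrable against Schwartz functions, not
    in L2, which leaves room for their growth in the frequency. The constant [c] carries [u0] in the
    case of [exU]. *)
Lemma is_tderiv_pairing (S : R -> E -> C) (dS : E -> C) (W : E -> R)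
    (c : distr R n) (t : R) : 0 <= t ->
  (forall s, 0 <= s -> sqE (S s)) ->
  (forall psi, schwartz psi -> cinteg mu (fun r => dS (point r) * psi (point r))) ->
  (forall psi, schwartz psi -> rint mu (fun r => W (point r) * normc (psi (point r)))) ->
  (forall s xi, 0 <= s ->
     normc (S s xi - S t xi - (s - t)%:C * dS xi) <= W xi * (s - t) ^+ 2) ->
  is_tderiv (fun s phi => c phi + cI mu (fun r => S s (point r) * finv phi (point r))) t
    (fun phi => cI mu (fun r => dS (point r) * finv phi (point r))).
Proof.
move=> t0 sS dSi Wi hS; apply: is_tderiv_quadratic => phi sphi.
have sf := finv_schwartz sphi; set psi := finv phi in sf *.
have i1 s (s0 : 0 <= s) : cinteg mu (fun r => S s (point r) * psi (point r)).
  by apply: sqiM; [exact: sS|exact: schwartz_sqi].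
have i2 := dSi _ sf; have i3 := Wi _ sf.
exists (\int[mu]_r (W (point r) * normc (psi (point r)))) => s s0.
pose F1 r := S s (point r) * psi (point r) : C.
pose F2 r := S t (point r) * psi (point r) : C.
pose F3 r := dS (point r) * psi (point r) : C.
have -> : c phi + cI mu F1 - (c phi + cI mu F2) - (s - t)%:C * cI mu F3 =
    cI mu (fun r => F1 r - F2 r - (s - t)%:C * F3 r).
  rewrite cIB; [|by apply: cintegB; exact: i1|exact: cintegZ].
  by rewrite cIB; [rewrite cIZ//; ring|exact: i1|exact: i1].
rewrite mulrC -RintZ//.
apply: cI_norm_le.
- apply: (@cinteg_meas _ _ _ mu).
  by apply: cintegB; [apply: cintegB; exact: i1|exact: cintegZ].
- exact: rintZ.
move=> r; have -> : F1 r - F2 r - (s - t)%:C * F3 r =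
    (S s (point r) - S t (point r) - (s - t)%:C * dS (point r)) * psi (point r).
  by rewrite /F1 /F2 /F3; ring.
by rewrite normcM mulrA ler_wpM2r ?normc_ge0// [leRHS]mulrC; exact: hS.
Qed.

End multipliers.

(** * Existence *)

Section existence.
Context {R : realType} {n : nat}.
Local Notation C := R[i].
Local Notation E := 'rV[R]_n.
Local Notation mu := (leb R n).
Variable sigma : R.
Hypothesis hsigma : 0 <= sigma <= 2.
Variables (a0 a1 a2 : E -> C).
Hypotheses (sa0 : sqE a0) (sa1 : sqE a1) (sa2 : sqE a2).

Let m (xi : E) := mm sigma xi.

Definition Fsol (p : @state R -> R) (t : R) (xi : E) : C :=
  sol (rr xi) (m xi) p (a0 xi) (a1 xi) (a2 xi) t.

Let D (xi : E) := data_size (a0 xi) (a1 xi) (a2 xi).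

Let D_ge0 (xi : E) : 0 <= D xi.
Proof. by rewrite /D /data_size; apply: addr_ge0; [apply: addr_ge0|]; exact: normc_ge0. Qed.

Lemma sqE_normc f : sqE f -> sqE (fun xi : E => (normc (f xi))%:C).
Proof.
move=> [mf fi]; apply: (sqi_le _ fi).
  by apply: cmeasR; exact: measurable_normc.
by move=> t; rewrite normcR ger0_norm ?normc_ge0.
Qed.

Let sD : sqE (fun xi => (D xi)%:C).
Proof.
rewrite /D /data_size; under eq_fun do rewrite !rmorphD.
by apply: sqiD; [apply: sqiD|]; exact: sqE_normc.
Qed.

Let D2 : rint mu (fun t => D (point t) ^+ 2).
Proof.
have := sD.2; rewrite (_ : (fun t => _) = (fun t => D (point t) ^+ 2))//.
by apply/funext => t; rewrite normcR real_normK ?num_real.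
Qed.

Let mr := @measurable_rr R n.
Let mm' := @measurable_mm R n sigma.

Lemma Fsol_cmeas p t : p = sU \/ p = sZ \/ p = sV \/ p = sH ->
  cmeas (fun s => Fsol p t (point s)).
Proof.
move=> hp; apply: (sol_cmeas mr mm') => //.
- by move=> s; exact: rr_ge0.
- by move=> s; exact: mm_ge0.
- exact: sa0.1.
- exact: sa1.1.
- exact: sa2.1.
Qed.

Lemma Fsol_sqE p t : 0 <= t -> p = sZ \/ p = sV \/ p = sH -> sqE (Fsol p t).
Proof.
move=> t0 hp; apply: (sqi_le _ (rintZ 4 D2)).
  by apply: Fsol_cmeas; right.
move=> s; have := sol_le (rr_ge0 (point s)) (mm_ge0 sigma (point s))
  (a0 (point s)) (a1 (point s)) (a2 (point s)) t0 hp.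
rewrite -/(D _) -(ler_sqr (normc_ge0 _)) ?nnegrE ?mulr_ge0// exprMn.
by rewrite (_ : 2 ^+ 2 = 4 :> R)// -natrX.
Qed.

Lemma FsolU_sqE t : 0 <= t -> sqE (Fsol sU t).
Proof.
move=> t0; apply: (sqi_le _ (rintZ ((2 * t) ^+ 2) D2)).
  by apply: Fsol_cmeas; left.
move=> s; have := solU_le (rr_ge0 (point s)) (mm_ge0 sigma (point s))
  (a0 (point s)) (a1 (point s)) (a2 (point s)) t0.
rewrite -/(D _) => h; rewrite -exprMn lerXn2r ?nnegrE ?normc_ge0 ?mulr_ge0//.
by apply: le_trans h _; rewrite [D _ * t]mulrC mulrA.
Qed.

Lemma Fsol_continuous p t : 0 <= t -> p = sZ \/ p = sV \/ p = sH ->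
  nE (fun x => Fsol p s x - Fsol p t x) @[s --> within halfline (nbhs t)] --> (0 : R).
Proof.
move=> t0 hp; apply: cvg_within_halfline => // u u0 ut.
(* Each of the two values is bounded by [2 * D] uniformly in time, whence the dominating function
   [(4 * D)^2]. *)
apply: (@rdct0 _ _ _ mu (fun k s => normc (Fsol p (u k) (point s) - Fsol p t (point s)) ^+ 2)
  (fun s => 16 * D (point s) ^+ 2)).
- move=> k; apply: measurable_normc2; apply: cmeasB; apply: Fsol_cmeas; by right.
- exact: rintZ.
- move=> k s; rewrite sqr_ge0 /=.
  have h s' (s0 : 0 <= s') := sol_le (rr_ge0 (point s)) (mm_ge0 sigma (point s))
    (a0 (point s)) (a1 (point s)) (a2 (point s)) s0 hp.
  have h2 : normc (Fsol p (u k) (point s) - Fsol p t (point s)) <= 4 * D (point s).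
    apply: le_trans (le_normcD _ _) _; rewrite normcN.
    by have := h _ (u0 k); have := h _ t0; rewrite /Fsol -/m -/(D _); lra.
  rewrite (_ : 16 * _ = (4 * D (point s)) ^+ 2); last by ring.
  by rewrite lerXn2r ?nnegrE ?normc_ge0 ?mulr_ge0.
- move=> s; rewrite -(mul0r 0); under eq_fun do rewrite expr2.
  by apply: cvgM; apply: sol_seq_cvg => //; [exact: rr_ge0|exact: mm_ge0|exact: rr_ge0|exact: mm_ge0].
Qed.

Lemma rr_FsolU t psi : 0 <= t -> schwartz psi ->
  cI mu (fun s => Fsol sU t (point s) * ((rr (point s))%:C * psi (point s))) =
  cI mu (fun s => Fsol sZ t (point s) * psi (point s)) -
  cI mu (fun s => a0 (point s) * psi (point s)).
Proof.
move=> t0 spsi; have s1 := schwartz_sqi spsi.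
rewrite -cIB; [|by apply: sqiM => //; apply: Fsol_sqE => //; left|exact: sqiM].
apply: eq_cI => s; rewrite mulrA [_ * _%:C]mulrC /Fsol solU_eq ?mulrBl//.
  exact: rr_ge0.
exact: mm_ge0.
Qed.

Let sZP : @sZ R = @sZ R \/ @sZ R = @sV R \/ @sZ R = @sH R. Proof. by left. Qed.
Let sVP : @sV R = @sZ R \/ @sV R = @sV R \/ @sV R = @sH R. Proof. by right; left. Qed.
Let sHP : @sH R = @sZ R \/ @sH R = @sV R \/ @sH R = @sH R. Proof. by right; right. Qed.

Definition FdV t (xi : E) : C := dV (rr xi) (m xi) (a0 xi) (a1 xi) (a2 xi) t.
Definition FdH t (xi : E) : C := dH (rr xi) (m xi) (a0 xi) (a1 xi) (a2 xi) t.

(** The components of the solution are in L2 but their products with the symbols need not be; the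
    symbols are moved onto the test function. *)
Lemma FdV_pairing t psi : 0 <= t -> schwartz psi ->
  cinteg mu (fun s => FdV t (point s) * psi (point s)) /\
  cI mu (fun s => FdV t (point s) * psi (point s)) =
  - cI mu (fun s => Fsol sZ t (point s) * ((rr (point s))%:C * psi (point s))) +
  cI mu (fun s => Fsol sH t (point s) * ((rr (point s))%:C * psi (point s))) -
  cI mu (fun s => Fsol sV t (point s) * ((m (point s))%:C * psi (point s))).
Proof.
move=> t0 spsi; have sr := sqE_rr spsi; have sm := sqE_mm hsigma spsi.
have iZ := sqiM (Fsol_sqE t0 sZP) sr.
have iH := sqiM (Fsol_sqE t0 sHP) sr.
have iV := sqiM (Fsol_sqE t0 sVP) sm.
have e : (fun s => FdV t (point s) * psi (point s)) = (fun s : n.-tuple R =>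
    - (Fsol sZ t (point s) * ((rr (point s))%:C * psi (point s))) +
    Fsol sH t (point s) * ((rr (point s))%:C * psi (point s)) -
    Fsol sV t (point s) * ((m (point s))%:C * psi (point s))).
  by apply/funext => s; rewrite /FdV /dV /Fsol; ring.
have i1 := cintegN iZ; have i2 := cintegD i1 iH.
by rewrite e; split; [exact: cintegB|rewrite cIB// cID// cIN].
Qed.

Lemma FdH_pairing t psi : 0 <= t -> schwartz psi ->
  cinteg mu (fun s => FdH t (point s) * psi (point s)) /\
  cI mu (fun s => FdH t (point s) * psi (point s)) =
  - cI mu (fun s => Fsol sH t (point s) * ((rr (point s))%:C * psi (point s))) -
  cI mu (fun s => Fsol sV t (point s) * ((rr (point s))%:C * psi (point s))).
Proof.
move=> t0 spsi; have sr := sqE_rr spsi.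
have iH := sqiM (Fsol_sqE t0 sHP) sr.
have iV := sqiM (Fsol_sqE t0 sVP) sr.
have e : (fun s => FdH t (point s) * psi (point s)) = (fun s : n.-tuple R =>
    - (Fsol sH t (point s) * ((rr (point s))%:C * psi (point s))) -
    Fsol sV t (point s) * ((rr (point s))%:C * psi (point s))).
  by apply/funext => s; rewrite /FdH /dH /Fsol; ring.
have i1 := cintegN iH.
by rewrite e; split; [exact: cintegB|rewrite cIB// cIN].
Qed.

Definition Ftaylor (xi : E) : R := 8 * (1 + rr xi + m xi) ^+ 2 * D xi.

Lemma Ftaylor_rint psi : schwartz psi ->
  rint mu (fun s => Ftaylor (point s) * normc (psi (point s))).
Proof.
move=> spsi; pose g xi : R := (1 + rr xi + m xi) ^+ 2.
have g0 xi : 0 <= g xi by exact: sqr_ge0.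
have sg : sqE (fun xi => (g xi)%:C * psi xi).
  (* Since [sigma <= 2], each of 1, |xi|^2 and |xi|^(2 sigma) is at most (1 + |xi|)^4; squaring
     three times this bound gives the constants 9 and 8. *)
  apply: (@sqE_multiplier _ _ g 9 8) => //.
    apply: measurable_funX; apply: measurable_funD; last exact: mm'.
    by apply: measurable_funD => //; exact: mr.
  move=> xi; rewrite ger0_norm// /g.
  have -> : 9 * (1 + enorm xi) ^+ 8 = (3 * (1 + enorm xi) ^+ 4) ^+ 2 :> R.
    by rewrite exprMn -exprM; congr (_ * _); rewrite -natrX.
  have e1 : 1 <= 1 + enorm xi by rewrite lerDl enorm_ge0.
  have h1 : 1 <= (1 + enorm xi) ^+ 4 by rewrite exprn_ege1.
  have h2 : rr xi <= (1 + enorm xi) ^+ 4.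
    by apply: le_trans (rr_le xi) _; rewrite ler_weXn2l.
  have h3 := mm_le xi hsigma; have h4 := rr_ge0 xi; have h5 := mm_ge0 sigma xi.
  rewrite lerXn2r ?nnegrE ?mulr_ge0 ?addr_ge0 ?exprn_ge0 ?addr_ge0 ?enorm_ge0//.
  by rewrite /m; lra.
have := rintZ 8 (sqiM_norm sD sg).
rewrite (_ : (fun t => _) = (fun s => Ftaylor (point s) * normc (psi (point s))))//.
apply/funext => s; rewrite normcR normcM normcR !ger0_norm//.
by rewrite /Ftaylor /g; ring.
Qed.

Variables (u0 : distr R n).
Hypothesis tu0 : tempered u0.
Hypothesis hu0 : forall phi, schwartz phi ->
  u0 (fourier (fun xi => (rr xi)%:C * phi xi)) =
  cI mu (fun s => a0 (point s) * phi (point s)).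

Definition exU (t : R) : distr R n := fun phi =>
  u0 phi + cI mu (fun s => Fsol sU t (point s) * finv phi (point s)).
Definition exP p (t : R) : distr R n := fun phi =>
  cI mu (fun s => Fsol p t (point s) * finv phi (point s)).

(** Identifies |D|^2 of [exU t]: the conservation law [solU_eq] gives the change of Z, and the data
    [a0] its initial value. *)
Lemma exU_rr t phi : 0 <= t -> schwartz phi ->
  exU t (fourier (fun xi => (rr xi)%:C * phi xi)) = exP sZ t (fourier phi).
Proof.
move=> t0 sphi; rewrite /exU /exP hu0// !fourierK//; last exact: schwartz_sqnorm.
by rewrite rr_FsolU//; ring.
Qed.

Lemma exP_tempered p t : 0 <= t -> p = sZ \/ p = sV \/ p = sH -> tempered (exP p t).
Proof. by move=> t0 hp; apply: tempered_finv; exact: Fsol_sqE. Qed.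

Lemma exU_tempered t : 0 <= t -> tempered (exU t).
Proof.
by move=> t0; apply: temperedD => //; apply: tempered_finv; exact: FsolU_sqE.
Qed.

Lemma exU_tderiv t : 0 <= t -> is_tderiv exU t (exP sV t).
Proof.
move=> t0; apply: (is_tderiv_pairing (S := Fsol sU) (dS := Fsol sV t) (W := Ftaylor) u0 t0).
- exact: FsolU_sqE.
- by move=> psi spsi; apply: sqiM; [exact: Fsol_sqE|exact: schwartz_sqi].
- exact: Ftaylor_rint.
- by move=> s xi s0; apply: solU_taylor => //; [exact: rr_ge0|exact: mm_ge0].
Qed.

Lemma exV_tderiv t : 0 <= t ->
  is_tderiv (exP sV) t (fun phi => cI mu (fun r => FdV t (point r) * finv phi (point r))).
Proof.
move=> t0.
have -> : exP sV = (fun s phi => 0 + cI mu (fun r => Fsol sV s (point r) * finv phi (point r))).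
  by apply/funext => s; apply/funext => phi; rewrite add0r.
apply: (is_tderiv_pairing (S := Fsol sV) (dS := FdV t) (W := Ftaylor) (fun=> 0) t0).
- by move=> s s0; exact: Fsol_sqE.
- by move=> psi spsi; exact: (FdV_pairing t0 spsi).1.
- exact: Ftaylor_rint.
- by move=> s xi s0; apply: solV_taylor => //; [exact: rr_ge0|exact: mm_ge0].
Qed.

Lemma exH_tderiv t : 0 <= t ->
  is_tderiv (exP sH) t (fun phi => cI mu (fun r => FdH t (point r) * finv phi (point r))).
Proof.
move=> t0.
have -> : exP sH = (fun s phi => 0 + cI mu (fun r => Fsol sH s (point r) * finv phi (point r))).
  by apply/funext => s; apply/funext => phi; rewrite add0r.
apply: (is_tderiv_pairing (S := Fsol sH) (dS := FdH t) (W := Ftaylor) (fun=> 0) t0).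
- by move=> s s0; exact: Fsol_sqE.
- by move=> psi spsi; exact: (FdH_pairing t0 spsi).1.
- exact: Ftaylor_rint.
- by move=> s xi s0; apply: solH_taylor => //; [exact: rr_ge0|exact: mm_ge0].
Qed.

Lemma ex_C_L2 p : p = sZ \/ p = sV \/ p = sH -> C_L2 (exP p).
Proof.
move=> hp; apply: (C_L2_of_multiplier (V := Fsol p)) => //.
  by move=> t t0; exact: Fsol_sqE.
by move=> t t0; exact: Fsol_continuous.
Qed.

Lemma ex_C_H2dot : C_H2dot exU.
Proof.
exists (exP sZ); last exact: ex_C_L2.
by move=> t t0; apply: pairing_is_absD => phi sphi; rewrite exU_rr.
Qed.

Lemma exP_laplacian p t psi : 0 <= t -> p = sZ \/ p = sV \/ p = sH -> schwartz psi ->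
  exP p t (laplacian (fourier psi)) =
  - cI mu (fun s => Fsol p t (point s) * ((rr (point s))%:C * psi (point s))).
Proof.
move=> t0 hp spsi; rewrite laplacian_fourier_rr// /exP fourierK; last first.
  by apply: schwartzZ; exact: schwartz_sqnorm.
rewrite -[RHS]mulN1r -[RHS]cIZ; last by apply: sqiM; [exact: Fsol_sqE|exact: sqE_rr].
by apply: eq_cI => s; ring.
Qed.

Lemma exU_bilaplacian t psi : 0 <= t -> schwartz psi ->
  exU t (laplacian (laplacian (fourier psi))) =
  cI mu (fun s => Fsol sZ t (point s) * ((rr (point s))%:C * psi (point s))).
Proof.
move=> t0 spsi; have sr := schwartz_sqnorm spsi.
by rewrite fourier_bilaplacian// (exU_rr t0 sr) /exP fourierK.
Qed.

(** The second alternative of [is_multiplier] applies: |xi|^(2 sigma) may fail to be smooth at 0,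
    but the transform of u_t is a function. *)
Lemma ex_frac t : 0 <= t -> is_fracLap sigma (exP sV t)
  (fun phi => cI mu (fun s => Fsol sV t (point s) * ((m (point s))%:C * finv phi (point s)))).
Proof.
move=> t0; have sV' := Fsol_sqE t0 sVP; right; exists (Fsol sV t).
  split; [exact: sV'.1.1|exact: sV'.1.2| |].
    by move=> phi sphi; apply: sqiM => //; exact: schwartz_sqi.
  by move=> phi sphi; rewrite /dfourier /exP fourierK.
have ms := cmeasM (cmeasR mm') sV'.1.
have e phi : (fun x => (enorm x `^ (2 * sigma))%:C * Fsol sV t x * phi x) =
    (fun x => Fsol sV t x * ((m x)%:C * phi x)) :> (E -> C).
  by apply/funext => x; rewrite /m /mm; ring.
split; [exact: ms.1|exact: ms.2| |].
  move=> phi sphi; rewrite e; apply: sqiM => //; exact: sqE_mm.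
by move=> phi sphi; rewrite /dfourier fourierK// /distr_of e.
Qed.

Lemma existence (u1 theta0 : distr R n) :
  (forall phi, schwartz phi ->
     u1 phi = cI mu (fun s => a1 (point s) * finv phi (point s))) ->
  (forall phi, schwartz phi ->
     theta0 phi = cI mu (fun s => a2 (point s) * finv phi (point s))) ->
  [/\ solves_P sigma u0 u1 theta0 exU (exP sV) (exP sH),
      C_H2dot exU, C_L2 (exP sV) & C_L2 (exP sH)].
Proof.
move=> hu1 hth; split; [|exact: ex_C_H2dot|exact: ex_C_L2|exact: ex_C_L2].
split.
- by move=> t t0; split; [exact: exU_tempered|exact: exP_tempered|exact: exP_tempered].
- by move=> t t0; exact: exU_tderiv.
- move=> t /ltW t0.
  exists (fun phi => cI mu (fun r => FdV t (point r) * finv phi (point r))).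
  exists (fun phi => cI mu (fun r => FdH t (point r) * finv phi (point r))).
  exists (fun phi => cI mu (fun s => Fsol sV t (point s) * ((m (point s))%:C * finv phi (point s)))).
  split; [exact: exV_tderiv|exact: exH_tderiv|exact: ex_frac| |].
    (* Writing [phi] as the transform of [finv phi] turns each term of the equation into an integral
       over frequencies, and the equation holds pointwise there. *)
    move=> phi sphi; have sf := finv_schwartz sphi.
    have := exU_bilaplacian t0 sf; have := exP_laplacian t0 sHP sf.
    by rewrite /dlaplacian (FdV_pairing t0 sf).2 finvK// => -> ->; ring.
  move=> phi sphi; have sf := finv_schwartz sphi.
  have := exP_laplacian t0 sVP sf; have := exP_laplacian t0 sHP sf.
  by rewrite /dlaplacian (FdH_pairing t0 sf).2 finvK// => -> ->; ring.
- have F0 p q phi : (forall xi, Fsol p 0 xi = q xi) ->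
      cI mu (fun s => Fsol p 0 (point s) * finv phi (point s)) =
      cI mu (fun s => q (point s) * finv phi (point s)).
    by move=> h; apply: eq_cI => s; rewrite h.
  split=> phi sphi.
  + rewrite /exU (F0 _ (fun=> 0)).
      by rewrite (_ : cI _ _ = 0) ?addr0// -[RHS](cI0 mu); apply: eq_cI => s; rewrite mul0r.
    by move=> xi; rewrite /Fsol (@sol0 _ _ _ _ _ _ _ (fun _ _ _ => 0)).
  + rewrite /exP (F0 _ a1) -?hu1//.
    by move=> xi; rewrite /Fsol (@sol0 _ _ _ _ _ _ _ (fun _ b _ => b)).
  + rewrite /exP (F0 _ a2) -?hth//.
    by move=> xi; rewrite /Fsol (@sol0 _ _ _ _ _ _ _ (fun _ _ c => c)).
Qed.

End existence.

(** * Smooth functions supported in an annulus *)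

Section flat_function.
Context {R : realType}.
Implicit Types (x y : R) (j : nat).

(** The powers of 1/x in front of exp(-1/x) make the family closed under differentiation up to
    linear combinations, so smoothness needs one derivative formula. *)
Definition flat j x : R := if 0 < x then x^-1 ^+ j * expR (- x^-1) else 0.

Lemma flat_le0 j x : x <= 0 -> flat j x = 0.
Proof. by move=> x0; rewrite /flat ltNge x0. Qed.

Lemma flat_ge0 j x : 0 <= flat j x.
Proof.
rewrite /flat; case: ifP => // x0.
by rewrite mulr_ge0 ?expR_ge0// exprn_ge0// invr_ge0 ltW.
Qed.

Lemma flat_le j x : flat j x <= j`!%:R.
Proof.
rewrite /flat; case: ifP => // x0; have y0 : 0 <= x^-1 by rewrite invr_ge0 ltW.
rewrite expRN ler_pdivrMr ?expR_gt0// -ler_pdivrMl ?ltr0n ?fact_gt0// mulrC.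
case: j => [|j]; first by rewrite expr0 fact0 divr1 -expR0 ler_expR.
by apply: le_trans (expR_ge1Dxn j y0); rewrite lerDr.
Qed.

Lemma flat0_le1 x : flat 0 x <= 1.
Proof. by have := flat_le 0 x; rewrite fact0. Qed.

(** Trading two powers of 1/x for a factor x^2 shows that [flat j] is O(x^2) at 0, which settles the
    derivative there. *)
Lemma flat_shift j x : flat j x = x ^+ 2 * flat j.+2 x.
Proof.
rewrite /flat; case: ifP => x0; last by rewrite mulr0.
have xn : x != 0 by rewrite gt_eqF.
rewrite (_ : j.+2 = 2 + j)%N// exprD (exprVn x 2) !mulrA mulfV ?mul1r//.
by rewrite expf_neq0.
Qed.

Lemma is_derive_flat j x : is_derive x 1 (flat j) (flat j.+2 x - j%:R * flat j.+1 x).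
Proof.
have [x0|x0|->] := ltgtP x 0.
- rewrite !flat_le0 ?ltW// mulr0 subr0.
  apply: (@near_eq_is_derive _ _ _ (cst 0)).
  by near=> y; rewrite flat_le0// ltW//; near: y; exact: lt_nbhsl.
- have e k : flat k x = x^-1 ^+ k * expR (- x^-1) by rewrite /flat x0.
  rewrite !e.
  apply: (@near_eq_is_derive _ _ _ (fun y => (y^-1) ^+ j * expR (- y^-1))).
    near=> y; rewrite /flat ifT//; near: y; exact: lt_nbhsr.
  have xn : x != 0 by rewrite gt_eqF.
  have h1 := is_deriveV (f := id) xn (is_derive_id x 1).
  have h2 := is_derive1_comp (f := expR) (g := fun y => - y^-1) (is_derive_expR _) (is_deriveN h1).
  have h3 := is_deriveM (is_deriveX j h1) h2.
  have -> : (fun y : R => y^-1 ^+ j * expR (- y^-1)) =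
      ([eta GRing.inv] ^+ j : R -> R) * (expR \o (fun y : R => - y^-1)).
    by apply/funext => y; rewrite /= !fctE.
  apply: is_derive_eq h3 _; rewrite !scaleRE /= -exprVn.
  rewrite (_ : ([eta GRing.inv] ^+ j : R -> R) x = x^-1 ^+ j); last by rewrite fctE.
  by case: (j) => [|i] /=; rewrite ?expr0 ?exprS; ring.
- rewrite !flat_le0// mulr0 subr0.
  have h : (fun h : R => h^-1 *: ((flat j \o shift 0) (h *: 1) - flat j 0)) @ 0^' --> (0 : R).
    have c1 : `|h| @[h --> (0 : R)^'] --> (0 : R).
      by apply/norm_cvg0P; exact: (@nbhs_dnbhs _ (0 : R)).
    have c0 : (j.+2`!%:R * `|h|) @[h --> (0 : R)^'] --> (0 : R).
      have := cvgMl_tmp (a := j.+2`!%:R) c1; rewrite mulr0; apply.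
    apply/norm_cvg0P; apply: squeeze_cvgr (cvg_cst 0) c0.
    near=> y; rewrite normr_ge0 /= addr0 [y *: 1]mulr1 [flat j 0]flat_le0// subr0.
    have yn : y != 0 by near: y; exact: nbhs_dnbhs_neq.
    rewrite scaleRE flat_shift expr2 mulrA mulKf// normrM mulrC.
    by rewrite ler_wpM2r// ger0_norm ?flat_ge0// flat_le.
  by split; [apply/cvg_ex; exists 0|exact/cvg_lim].
Unshelve. all: by end_near. Qed.

End flat_function.

Section bump_functions.
Context {R : realType}.
Variables (a b l : R).
Hypotheses (a0 : 0 < a) (l0 : 0 < l).
Implicit Types (s tau : R) (h k : R -> R).

Definition band tau (i j : nat) s : R :=
  s `^ tau * flat i (l * (s - a)) * flat j (l * (b - s)).

Inductive bump : (R -> R) -> Prop :=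
| bump_band tau i j : bump (band tau i j)
| bump_lin c h k : bump h -> bump k -> bump (fun s => c * h s + k s).

Lemma band_supp tau i j s : s <= a \/ b <= s -> band tau i j s = 0.
Proof.
rewrite /band => -[h|h].
  by rewrite [flat i _]flat_le0 ?mulr0 ?mul0r// pmulr_rle0// subr_le0.
by rewrite [flat j _]flat_le0 ?mulr0// pmulr_rle0// subr_le0.
Qed.

Lemma bump_supp h s : bump h -> s <= a \/ b <= s -> h s = 0.
Proof.
by move=> + hs; elim=> [tau i j|c {}h k _ IH1 _ IH2]; [exact: band_supp|rewrite IH1 IH2 mulr0 addr0].
Qed.

Lemma bump_bounded h : bump h -> exists M : R, forall s, `|h s| <= M.
Proof.
elim=> [tau i j|c {}h k _ [M hM] _ [N hN]].
  exists (expR (`|tau| * (`|ln a| + `|ln b|)) * i`!%:R * j`!%:R) => s.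
  have [sa|sa] := leP s a.
    by rewrite band_supp ?normr0 ?mulr_ge0 ?expR_ge0//; left.
  have [sb|sb] := leP b s.
    by rewrite band_supp ?normr0 ?mulr_ge0 ?expR_ge0//; right.
  have s0 : 0 < s by exact: lt_trans sa.
  rewrite /band !normrM !(ger0_norm (flat_ge0 _ _)) (ger0_norm (powR_ge0 _ _)).
  rewrite ler_pM ?mulr_ge0 ?flat_ge0 ?powR_ge0 ?flat_le//.
  rewrite ler_pM ?flat_ge0 ?powR_ge0 ?flat_le//.
  (* Between [a] and [b] the logarithm is at most [|ln a| + |ln b|] in absolute value, which bounds
     the power for either sign of [tau]. *)
  rewrite /powR gt_eqF// ler_expR; apply: le_trans (ler_norm _) _.
  rewrite normrM ler_wpM2l//.
  have h1 : ln a <= ln s by rewrite ler_ln ?posrE// ltW.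
  have h2 : ln s <= ln b by rewrite ler_ln ?posrE// ?ltW// (lt_trans s0).
  have h3 := ler_norm (ln b); have h4 := ler_norm (- ln a); rewrite normrN in h4.
  have h5 := normr_ge0 (ln a); have h6 := normr_ge0 (ln b).
  by rewrite ler_norml; apply/andP; split; lra.
exists (`|c| * M + N) => s; apply: le_trans (ler_normD _ _) _.
by rewrite normrM lerD// ler_wpM2l.
Qed.

Let bump0 : bump (fun=> 0).
Proof.
have := bump_lin (-1) (bump_band 0 0 0) (bump_band 0 0 0).
by under eq_fun do rewrite mulN1r addNr.
Qed.

Lemma bump_derive h : bump h -> exists h', bump h' /\ forall s, is_derive s 1 h (h' s).
Proof.
elim=> [tau i j|c {}h k _ [h' [bh hd]] _ [k' [bk kd]]]; last first.
  exists (fun s => c * h' s + k' s); split; first exact: bump_lin.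
  by move=> s; exact: is_deriveD (is_deriveZ c (hd s)) (kd s).
(* One term comes from the power and two from each flat factor; the final 0 ends the chain of
   [bump_lin]. *)
exists (fun s => tau * band (tau - 1) i j s + (l * band tau i.+2 j s +
  (- l * i%:R * band tau i.+1 j s + (- l * band tau i j.+2 s +
  (l * j%:R * band tau i j.+1 s + 0))))); split.
  by do 5?[apply: bump_lin; first exact: bump_band].
(* Below [a] the band vanishes in a neighbourhood; from [a] on, [s] is positive and the power is
   differentiable. *)
move=> s; have [sa|sa] := ltP s a.
  rewrite !band_supp; try by left; exact: ltW.
  rewrite !mulr0 !addr0.
  apply: (@near_eq_is_derive _ _ _ (cst 0)).
  near=> y; rewrite band_supp//; left; apply: ltW; near: y; exact: lt_nbhsl.
have s0 : 0 < s by exact: lt_le_trans sa.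
have hi : is_derive s 1 (fun s => l * (s - a)) l.
  have := is_deriveZ l (is_deriveB (is_derive_id s 1) (is_derive_cst a s 1)).
  by move=> hi; apply: is_derive_eq hi _; rewrite scaleRE subr0 mulr1.
have hj : is_derive s 1 (fun s => l * (b - s)) (- l).
  have := is_deriveZ l (is_deriveB (is_derive_cst b s 1) (is_derive_id s 1)).
  by move=> hj; apply: is_derive_eq hj _; rewrite scaleRE sub0r mulrN1.
have h1 := is_derive1_comp (g := fun s => l * (s - a)) (is_derive_flat i _) hi.
have h2 := is_derive1_comp (g := fun s => l * (b - s)) (is_derive_flat j _) hj.
have := is_deriveM (is_deriveM (is_derive1_powR tau s0) h1) h2.
move=> h3; apply: is_derive_eq h3 _; rewrite !scaleRE /band !fctE /=.
by ring.
Unshelve. all: by end_near. Qed.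

Lemma bump_powR tau h : bump h -> bump (fun s => s `^ tau * h s).
Proof.
elim=> [tau' i j|c {}h k _ IH1 _ IH2].
  have -> : (fun s => s `^ tau * band tau' i j s) = band (tau + tau') i j.
    apply/funext => s; have [sa|sa] := leP s a.
      by rewrite !band_supp ?mulr0//; left.
    have sn : s != 0 by rewrite gt_eqF// (lt_trans a0).
    by rewrite /band !mulrA -powRD// sn implybT.
  exact: bump_band.
have -> : (fun s => s `^ tau * (c * h s + k s)) =
    (fun s => c * (s `^ tau * h s) + s `^ tau * k s) by apply/funext => s; ring.
exact: bump_lin.
Qed.

End bump_functions.

Section radial_cutoffs.
Context {R : realType} {n : nat}.
Local Notation C := R[i].
Local Notation E := 'rV[R]_n.
Implicit Types (f g phi psi : E -> C) (i : 'I_n).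
Variables (a b l : R).
Hypotheses (a0 : 0 < a) (l0 : 0 < l).

(** Sums are included because the product rule for h(|x|^2) phi gives two terms, with cutoffs [h']
    and [h]. *)
Inductive radial : (E -> C) -> Prop :=
| radial_mul h phi : bump a b l h -> schwartz phi -> radial (fun x => (h (rr x))%:C * phi x)
| radial_add f g : radial f -> radial g -> radial (fun x => f x + g x).

Lemma schwartz_radial f : radial f -> schwartz f.
Proof.
apply: schwartz_coind => {}f; elim=> [h phi bh sphi|{}f g _ [df pf] _ [dg pg]]; last first.
  split; first exact: decayD.
  move=> i; have [f' [rf hf]] := pf i; have [g' [rg hg]] := pg i.
  exists (fun x => f' x + g' x); split; first exact: radial_add.
  by move=> x; exact: is_partialD.
split.
  have [M hM] := bump_bounded a0 l0 bh.
  apply: (@decay_le _ _ phi _ `|M| 0%N) => //; last exact: schwartz_decay.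
  move=> x; rewrite expr0 mul1r normcM normcR ler_wpM2r ?normc_ge0//.
  exact: le_trans (hM _) (ler_norm _).
move=> i; have [h' [bh' hd]] := bump_derive a0 l0 bh.
exists (fun x => (h' (rr x))%:C * (2%:C * ((x 0 i)%:C * phi x)) + (h (rr x))%:C * partial i phi x).
split.
  apply: radial_add; apply: radial_mul => //; last exact: schwartz_partial.
  by apply: schwartzZ; exact: schwartz_coord.
move=> x.
have -> : (h' (rr x))%:C * (2%:C * ((x 0 i)%:C * phi x)) = (h' (rr x) * (2 * x 0 i))%:C * phi x.
  by rewrite !rmorphM !mulrA.
apply: is_partialM; last exact: schwartz_is_partial.
by apply: is_partialR; exact: is_derive_comp1 (hd _) (is_derive_sqnorm i x).
Qed.

End radial_cutoffs.

(** The origin lies in the hyperplane where the first coordinate is 0, null because of the factor on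
    the line; this uses that the dimension is positive. *)
Lemma leb_sqnorm0 (R : realType) (n : nat) :
  leb R n.+1 [set t | rr (point t) = 0] = 0%E.
Proof.
have m0 : measurable [set t : n.+1.-tuple R | rr (point t) = 0].
  rewrite -[X in measurable X]setTI; exact: (measurable_rr measurableT (measurable_set1 0)).
apply/eqP; rewrite -measure_le0.
have mX : measurable ([set (0 : R)] `*` [set: n.-tuple R]) by exact: measurableX.
have -> : 0%E = ((@lebesgue_measure R) \x leb R n)%E ([set 0] `*` setT).
  by rewrite product_measure1E//= lebesgue_measure_set1 mul0e.
change (leb_succ (leb R n) [set t | rr (point t) = (0 : R)%R] <= 
  ((@lebesgue_measure R) \x leb R n)%E ([set (0 : R)%R] `*` [set: n.-tuple R]))%E.
rewrite /leb_succ /pushforward; apply: le_measure; rewrite ?inE//.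
  rewrite -[X in measurable X]setTI; apply: measurable_consR => //.
move=> [x t] /= h; split => //.
have := coord_le_enorm ord0 (point (consR (x, t))).
by rewrite /enorm -/(rr _) h sqrtr0 mxE normr_le0 /tnth /= => /eqP.
Qed.

(** * Test functions supported in an annulus and their density *)

Section band_limited.
Context {R : realType} {n : nat}.
Local Notation C := R[i].
Local Notation E := 'rV[R]_n.
Local Notation mu := (leb R n).
Implicit Types (f g phi psi : E -> C).

Lemma mm_powR sigma (xi : E) : mm sigma xi = rr xi `^ sigma.
Proof. by rewrite /mm /enorm -powR12_sqrt ?rr_ge0// -powRrM mulrA mulVf// mul1r. Qed.

Lemma nE_le (c : R) f g : 0 <= c -> sqE f -> sqE g ->
  (forall x, normc (g x) <= c * normc (f x)) -> Num.sqrt (nE g) <= c * Num.sqrt (nE f).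
Proof.
move=> c0 sf sg h.
rewrite -[X in X * _](ger0_norm c0) -sqrtr_sqr -sqrtrM ?sqr_ge0// ler_wsqrtr//.
rewrite /nE /nrm2 -RintZ; last exact: sf.2.
apply: Rint_le; [exact: sg.2|apply: rintZ; exact: sf.2|] => t.
by rewrite -exprMn lerXn2r ?nnegrE ?normc_ge0 ?mulr_ge0 ?normc_ge0.
Qed.

Section fixed_band.
Variables (a b l : R).
Hypotheses (a0 : 0 < a) (b0 : 0 <= b) (l0 : 0 < l).

Definition blim psi := exists h phi, [/\ bump a b l h, schwartz phi &
  psi = (fun x => (h (rr x))%:C * phi x)].

Lemma blim_schwartz psi : blim psi -> schwartz psi.
Proof.
by move=> [h [phi [bh sphi ->]]]; exact: (schwartz_radial a0 l0 (radial_mul bh sphi)).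
Qed.

Lemma blim_mm sigma psi : blim psi -> blim (fun x => (mm sigma x)%:C * psi x).
Proof.
move=> [h [phi [bh sphi ->]]]; exists (fun s => s `^ sigma * h s), phi; split => //.
  exact: bump_powR.
by apply/funext => x; rewrite mm_powR rmorphM mulrA.
Qed.

Lemma blim_rr psi : blim psi -> blim (fun x => (rr x)%:C * psi x).
Proof.
move=> /(blim_mm 1); rewrite (_ : (fun x => _) = (fun x => (rr x)%:C * psi x))//.
by apply/funext => x; rewrite mm_powR powRr1 ?rr_ge0.
Qed.

Lemma blim_mm_le sigma psi : 0 <= sigma -> blim psi ->
  forall x, normc ((mm sigma x)%:C * psi x) <= b `^ sigma * normc (psi x).
Proof.
move=> s0 [h [phi [bh sphi ->]]] x; rewrite normcM normcR ger0_norm ?mm_ge0//.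
have [xb|xb] := leP b (rr x).
  by rewrite (bump_supp l0 bh); [rewrite rmorph0 mul0r normc0 !mulr0|right].
rewrite ler_wpM2r ?normc_ge0// mm_powR; apply: ge0_ler_powR => //.
  by rewrite nnegrE rr_ge0.
exact: ltW.
Qed.

Lemma blim_rr_le psi : blim psi ->
  forall x, normc ((rr x)%:C * psi x) <= b * normc (psi x).
Proof.
by move=> /(blim_mm_le ler01) h x; have := h x; rewrite mm_powR (powRr1 b0) (powRr1 (rr_ge0 x)).
Qed.

End fixed_band.

(** The steepness grows together with the annulus: each factor has the form exp(-1/y) with y tending
    to infinity at every fixed positive [s], so that the limit is 1. *)
Definition cutoff (k : nat) : R -> R := band k.+1%:R^-1 k.+1%:R k.+1%:R 0 0 0.

Lemma cutoff01 k s : 0 <= cutoff k s <= 1.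
Proof.
rewrite /cutoff /band powRr0 mul1r mulr_ge0 ?flat_ge0//=.
by rewrite mulr_ile1 ?flat_ge0 ?flat0_le1.
Qed.

Lemma flat0_ge (x : R) : 0 < x -> 1 - x^-1 <= flat 0 x.
Proof. by move=> x0; rewrite /flat x0 mul1r; exact: expR_ge1Dx. Qed.

Lemma cutoff_cvg s : 0 < s -> cutoff k s @[k --> \oo] --> (1 : R).
Proof.
move=> s0.
(* The two flat factors are at least 1 - (2/s)/(k+1) and 1 - 1/(k+1) for large [k], and for numbers
   at most 1 the product F1 F2 is at least F1 + F2 - 1. *)
have h : (1 - (2 / s + 1) * k.+1%:R^-1) @[k --> \oo] --> (1 : R).
  have := cvgB (cvg_cst (1 : R)) (cvgMl_tmp (a := 2 / s + 1) (@cvg_harmonic R)).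
  by rewrite mulr0 subr0; apply.
apply: squeeze_cvgr h (cvg_cst (1 : R)).
near=> k; have /andP[_ ->] := cutoff01 k s; rewrite andbT.
have k0 : 0 < k.+1%:R :> R by rewrite ltr0n.
have kn : k.+1%:R != 0 :> R by rewrite gt_eqF.
have ks : 2 / s + s + 1 <= k.+1%:R.
  have kr : 2 / s + s + 1 <= k%:R by near: k; exact: nbhs_infty_ger.
  by apply: le_trans kr _; rewrite ler_nat.
have h2 : 0 < 2 / s by rewrite divr_gt0.
have e1 : 2 <= k.+1%:R * s by rewrite -ler_pdivrMr//; move: s0; lra.
have e2 : 1 <= k.+1%:R - s by move: h2; lra.
have f1 : 1 - 2 / s * k.+1%:R^-1 <= flat 0 (k.+1%:R * (s - k.+1%:R^-1)).
  have p : 0 < k.+1%:R * (s - k.+1%:R^-1) by rewrite mulrBr mulfV//; lra.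
  apply: le_trans (flat0_ge p); rewrite lerD2l lerN2.
  rewrite -[leLHS]mul1r ler_pdivrMr//.
  have -> : 2 / s * k.+1%:R^-1 * (k.+1%:R * (s - k.+1%:R^-1)) = 2 - 2 / (k.+1%:R * s).
    have sn : s != 0 by rewrite gt_eqF.
    by move: (k.+1%:R : R) kn => K Kn; field; rewrite ?sn ?Kn.
  have : 2 / (k.+1%:R * s) <= 1 by rewrite ler_pdivrMr ?mulr_gt0// mul1r.
  by move: (2 / (k.+1%:R * s)) => y; lra.
have f2 : 1 - k.+1%:R^-1 <= flat 0 (k.+1%:R * (k.+1%:R - s)).
  have p : 0 < k.+1%:R * (k.+1%:R - s) by rewrite mulr_gt0//; lra.
  apply: le_trans (flat0_ge p); rewrite lerD2l lerN2 lef_pV2 ?posrE//.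
  by rewrite ler_peMr// ltW.
rewrite /cutoff /band powRr0 mul1r.
have g1 := flat0_le1 (k.+1%:R * (s - k.+1%:R^-1)).
have g2 := flat0_le1 (k.+1%:R * (k.+1%:R - s)).
move: (flat 0 _) (flat 0 _) f1 f2 g1 g2 => F1 F2.
move: (2 / s) (k.+1%:R^-1 : R) => c d f1 f2; rewrite -!(subr_ge0 _ 1) => g1 g2.
have := mulr_ge0 g1 g2; lra.
Unshelve. all: by end_near. Qed.

Lemma cutoff_blim k phi : schwartz phi ->
  blim k.+1%:R^-1 k.+1%:R k.+1%:R (fun x => (cutoff k (rr x))%:C * phi x).
Proof. by move=> sphi; exists (cutoff k), phi; split => //; exact: bump_band. Qed.

Lemma cutoff_dense phi : (1 <= n)%N -> schwartz phi ->
  nE (fun x => phi x - (cutoff k (rr x))%:C * phi x) @[k --> \oo] --> (0 : R).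
Proof.
move=> n1 sphi; have s1 := schwartz_sqi sphi.
have sk k : sqE (fun x => phi x - (cutoff k (rr x))%:C * phi x).
  apply: sqiB => //; apply: (schwartz_sqi (f := fun x => (cutoff k (rr x))%:C * phi x)).
  by apply: (blim_schwartz _ _ (cutoff_blim k sphi)); rewrite ?invr_gt0 ltr0n.
have e k x : normc (phi x - (cutoff k (rr x))%:C * phi x) =
    (1 - cutoff k (rr x)) * normc (phi x).
  have /andP[c0 c1] := cutoff01 k (rr x).
  rewrite -[X in X - _]mul1r -mulrBl normcM -[1]/(1%:C) -rmorphB normcR.
  by rewrite ger0_norm// subr_ge0.
apply: (@rdct0_ae _ _ _ mu (fun k t => normc (phi (point t) -
  (cutoff k (rr (point t)))%:C * phi (point t)) ^+ 2) (fun t => normc (phi (point t)) ^+ 2)).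
- by move=> k; apply: measurable_normc2; exact: (sk k).1.
- exact: s1.2.
- move=> k t; rewrite sqr_ge0 /= e; have /andP[c0 c1] := cutoff01 k (rr (point t)).
  rewrite lerXn2r ?nnegrE ?mulr_ge0 ?normc_ge0 ?subr_ge0//.
  by rewrite ler_piMl ?normc_ge0// gerBl.
have : {ae mu, forall t, rr (point t) <> 0}.
  case: n n1 {phi sphi s1 sk e} => // p _.
  exists [set t | rr (point t) = 0]; split.
  - rewrite -[X in measurable X]setTI; exact: (measurable_rr measurableT (measurable_set1 0)).
  - exact: leb_sqnorm0.
  - by move=> t /= /contrapT.
apply: filterS => t t0.
have rp : 0 < rr (point t) by rewrite lt_neqAle rr_ge0 andbT eq_sym; apply/eqP.
have h : (1 - cutoff k (rr (point t))) * normc (phi (point t)) @[k --> \oo] --> (0 : R).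
  have := cvgM (cvgB (cvg_cst (1 : R)) (cutoff_cvg rp)) (cvg_cst (normc (phi (point t)))).
  by rewrite subrr mul0r; apply.
have h2 := cvgM h h; rewrite mul0r in h2.
apply: cvg_trans (h2 _); apply: near_eq_cvg; apply: nearW => k; by rewrite e expr2.
Qed.

End band_limited.

(** * Uniqueness *)

Section paths.
Context {R : realType}.
Local Notation C := R[i].
Implicit Types (f df : R -> C) (t s : R).

Definition cder f t (d : C) :=
  is_derive t 1 (fun s => complex.Re (f s)) (complex.Re d) /\
  is_derive t 1 (fun s => complex.Im (f s)) (complex.Im d).

Definition ccont f := forall t, 0 <= t ->
  normc (f s - f t) @[s --> within halfline (nbhs t)] --> (0 : R).

Lemma cderB f g t c d : cder f t c -> cder g t d -> cder (fun s => f s - g s) t (c - d).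
Proof.
move=> [f1 f2] [g1 g2]; split; rewrite ?ReD ?ImD ?ReN ?ImN.
  by under eq_fun do rewrite ReD ReN; exact: is_deriveB f1 g1.
by under eq_fun do rewrite ImD ImN; exact: is_deriveB f2 g2.
Qed.

Lemma ccontB f g : ccont f -> ccont g -> ccont (fun s => f s - g s).
Proof.
move=> cf cg t t0.
have h : (normc (f s - f t) + normc (g s - g t)) @[s --> within halfline (nbhs t)] --> (0 : R).
  by rewrite -[X in _ --> X](addr0 0); apply: cvgD; [exact: cf|exact: cg].
apply: squeeze_cvgr (cvg_cst 0) h.
apply: nearW => s; rewrite normc_ge0 /=.
have -> : f s - g s - (f t - g t) = (f s - f t) + (- (g s - g t)) by ring.
by apply: le_trans (le_normcD _ _) _; rewrite normcN.
Qed.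

(** The difference between the exponential and [g] has a nonnegative derivative. Differentiability
    is assumed for positive times only, and continuity up to 0 connects it with the initial
    value. *)
Lemma exp_comparison (g dg : R -> R) (T K lambda : R) : 0 < lambda -> 0 <= K ->
  {within `[0, T], continuous g} -> g 0 = 0 ->
  (forall t, 0 < t -> is_derive t 1 g (dg t)) ->
  (forall t, 0 < t <= T -> `|dg t| <= K * expR (lambda * t)) ->
  forall t, 0 <= t <= T -> g t <= K / lambda * expR (lambda * t).
Proof.
move=> l0 K0 cg g0 gd hK t /andP[]; rewrite le_eqVlt => /predU1P[<- _|t0 tT].
  by rewrite g0 mulr_ge0 ?expR_ge0// divr_ge0// ltW.
pose G s := K / lambda * expR (lambda * s) - g s.
have ed (s : R) : is_derive s 1 (fun s => K / lambda * expR (lambda * s)) (K * expR (lambda * s)).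
  have h1 : is_derive s 1 (fun s => lambda * s) lambda.
    by have h := is_deriveZ lambda (is_derive_id s 1); apply: is_derive_eq h _; rewrite scaleRE mulr1.
  have := is_deriveZ (K / lambda) (is_derive1_comp (is_derive_expR (lambda * s)) h1).
  move=> h; apply: is_derive_eq h _; rewrite scaleRE.
  by field; rewrite gt_eqF.
have Gd s : s \in `]0, t[ -> is_derive s 1 G (K * expR (lambda * s) - dg s).
  by rewrite in_itv /= => /andP[s0 st]; exact: is_deriveB (ed s) (gd s s0).
have cG : {within `[0, t], continuous G}.
  have c1 : {within `[0, t], continuous g}.
    by apply: continuous_subspaceW cg; apply: subset_itvl; rewrite bnd_simp.
  have c2 : {within `[0, t], continuous (fun s => K / lambda * expR (lambda * s))}.
    by apply: continuous_subspaceT; exact: is_derive_continuous ed.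
  by move=> s; apply: cvgB; [exact: c2|exact: c1].
have [c] := MVT t0 Gd cG; rewrite in_itv /= => /andP[c0 ct] e.
have : 0 <= G t - G 0.
  rewrite e subr0 mulr_ge0 ?(ltW t0)// subr_ge0.
  by apply: le_trans (ler_norm _) (hK _ _); rewrite c0 (ltW (lt_le_trans ct tT)).
rewrite /G g0 mulr0 expR0 mulr1 => h.
have : 0 <= K / lambda by rewrite divr_ge0// ltW.
by move: h; move: (K / lambda) (expR _) (g t) => x y z; lra.
Qed.

Lemma within_continuous_path (g : R -> R) (T : R) :
  (forall t, 0 <= t -> `|g s - g t| @[s --> within halfline (nbhs t)] --> (0 : R)) ->
  {within `[0, T], continuous g}.
Proof.
move=> h; apply/subspace_continuousP => t; rewrite /= in_itv /= => /andP[t0 tT].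
apply/subr_cvg0; apply/norm_cvg0P.
apply: cvg_trans (h t t0); apply: cvg_app; apply: within_subset.
by move=> s; rewrite /halfline /= in_itv /= => /andP[].
Qed.

(** The gain is the division by [lambda]: in an exponentially weighted norm, integration in time is
    small. The factor 2 joins real and imaginary parts. *)
Lemma path_bound f df (T K lambda : R) : 0 < lambda -> 0 <= K ->
  ccont f -> f 0 = 0 ->
  (forall t, 0 < t -> cder f t (df t)) ->
  (forall t, 0 < t <= T -> normc (df t) <= K * expR (lambda * t)) ->
  forall t, 0 <= t <= T -> normc (f t) <= 2 * (K / lambda * expR (lambda * t)).
Proof.
move=> l0 K0 cf f0 fd hK t ht.
have key (g dg : R -> R) : (forall s t, `|g s - g t| <= normc (f s - f t)) -> g 0 = 0 ->
    (forall t, 0 < t -> is_derive t 1 g (dg t)) -> (forall t, `|dg t| <= normc (df t)) ->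
    `|g t| <= K / lambda * expR (lambda * t).
  move=> hg g0 gd hdg.
  have cg : forall t, 0 <= t -> `|g s - g t| @[s --> within halfline (nbhs t)] --> (0 : R).
    move=> r r0; apply: squeeze_cvgr (cvg_cst 0) (cf r r0).
    by apply: nearW => s; rewrite normr_ge0 hg.
  rewrite ler_norml lerNl; apply/andP; split.
    apply: (@exp_comparison (fun s => - g s) (fun s => - dg s) T) => //.
    - apply: within_continuous_path => r r0; apply: cvg_trans (cg r r0).
      by apply: near_eq_cvg; apply: nearW => s; rewrite -opprD normrN.
    - by rewrite g0 oppr0.
    - by move=> r r0; exact: is_deriveN (gd r r0).
    - by move=> r r0; rewrite normrN; exact: le_trans (hdg r) (hK r r0).
  apply: (@exp_comparison g dg T) => //; first exact: within_continuous_path.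
  by move=> r r0; exact: le_trans (hdg r) (hK r r0).
apply: le_trans (normc_le_ReIm _) _; rewrite mulr_natl mulr2n; apply: lerD.
  apply: (key (fun s => complex.Re (f s)) (fun s => complex.Re (df s))).
  - by move=> s r; rewrite -ReN -ReD; exact: Re_le_normc.
  - by rewrite f0.
  - by move=> r r0; exact: (fd r r0).1.
  - by move=> r; exact: Re_le_normc.
apply: (key (fun s => complex.Im (f s)) (fun s => complex.Im (df s))).
- by move=> s r; rewrite -ImN -ImD; exact: Im_le_normc.
- by rewrite f0.
- by move=> r r0; exact: (fd r r0).2.
- by move=> r; exact: Im_le_normc.
Qed.

(* The bound [M N(psi)] improves by a factor 2 at each application of [path_bound],
   in the exponentially weighted norm sup_t exp(- 12 c t) |X t psi|. *)
Lemma modes_vanish (V : Type) (P : V -> Prop) (A B : V -> V) (N : V -> R)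
    (Z Q H : R -> V -> C) (c M T : R) : 0 < c -> 0 <= M ->
  (forall p, P p -> P (A p)) -> (forall p, P p -> P (B p)) ->
  (forall p, 0 <= N p) ->
  (forall p, P p -> N (A p) <= c * N p) -> (forall p, P p -> N (B p) <= c * N p) ->
  (forall p, P p -> [/\ ccont (Z^~ p), ccont (Q^~ p) & ccont (H^~ p)]) ->
  (forall p, P p -> [/\ Z 0 p = 0, Q 0 p = 0 & H 0 p = 0]) ->
  (forall p t, P p -> 0 < t -> [/\ cder (Z^~ p) t (Q t (A p)),
     cder (Q^~ p) t (- Z t (A p) + H t (A p) - Q t (B p)) &
     cder (H^~ p) t (- H t (A p) - Q t (A p))]) ->
  (forall p t, P p -> 0 <= t <= T ->
     [/\ normc (Z t p) <= M * N p, normc (Q t p) <= M * N p & normc (H t p) <= M * N p]) ->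
  forall p t, P p -> 0 <= t <= T -> [/\ Z t p = 0, Q t p = 0 & H t p = 0].
Proof.
move=> c0 M0 PA PB N0 NA NB hc h0 hd hM.
(* A derivative has at most three terms, each at most [c] times the current bound, so [K] carries
   the factor [3 * c]; [path_bound] multiplies it by [2 / lam], and [2 * 3 / 12] is one half. *)
pose lam := 12 * c; have l0 : 0 < lam by rewrite mulr_gt0.
have half k p t : P p -> 0 <= t <= T ->
    [/\ normc (Z t p) <= M * N p * 2^-1 ^+ k * expR (lam * t),
        normc (Q t p) <= M * N p * 2^-1 ^+ k * expR (lam * t) &
        normc (H t p) <= M * N p * 2^-1 ^+ k * expR (lam * t)].
  elim: k p t => [|k IH] p t Pp ht.
    have [h1 h2 h3] := hM p t Pp ht.
    have e1 : 1 <= expR (lam * t).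
      by rewrite -expR0 ler_expR mulr_ge0 ?(ltW l0)//; case/andP: ht.
    have h : M * N p <= M * N p * 2^-1 ^+ 0 * expR (lam * t).
      by rewrite expr0 mulr1 ler_peMr// mulr_ge0.
    by split; apply: le_trans h.
  pose K := 3 * c * (M * N p * 2^-1 ^+ k).
  have K0 : 0 <= K by rewrite !mulr_ge0 ?exprn_ge0 ?(ltW c0).
  have e : M * N p * 2^-1 ^+ k.+1 * expR (lam * t) = 2 * (K / lam * expR (lam * t)).
    by rewrite /K /lam exprS; field; rewrite gt_eqF.
  have up q s (w : C) : N q <= c * N p -> normc w <= M * N q * 2^-1 ^+ k * expR (lam * s) ->
      normc w <= c * (M * N p * 2^-1 ^+ k) * expR (lam * s).
    move=> hq /le_trans; apply; rewrite ler_wpM2r ?expR_ge0// mulrA ler_wpM2r ?exprn_ge0//.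
    by rewrite mulrCA ler_wpM2l.
  have bnd s : 0 < s <= T -> [/\ normc (Z s (A p)) <= c * (M * N p * 2^-1 ^+ k) * expR (lam * s),
      normc (Q s (A p)) <= c * (M * N p * 2^-1 ^+ k) * expR (lam * s),
      normc (H s (A p)) <= c * (M * N p * 2^-1 ^+ k) * expR (lam * s) &
      normc (Q s (B p)) <= c * (M * N p * 2^-1 ^+ k) * expR (lam * s)].
    move=> /andP[s0 sT]; have hs : 0 <= s <= T by rewrite ltW.
    have [a1 a2 a3] := IH _ _ (PA _ Pp) hs; have [_ b2 _] := IH _ _ (PB _ Pp) hs.
    by split; [exact: up (NA _ Pp) a1|exact: up (NA _ Pp) a2|exact: up (NA _ Pp) a3|
               exact: up (NB _ Pp) b2].
  have KE s : K * expR (lam * s) = 3 * (c * (M * N p * 2^-1 ^+ k) * expR (lam * s)).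
    by rewrite /K; ring.
  have b0 s : 0 <= c * (M * N p * 2^-1 ^+ k) * expR (lam * s).
    by rewrite !mulr_ge0 ?expR_ge0 ?exprn_ge0 ?(ltW c0).
  have [c1 c2 c3] := hc p Pp; have [z1 z2 z3] := h0 p Pp.
  rewrite e; split.
  - apply: (path_bound (f := Z^~ p) (df := fun s => Q s (A p)) l0 K0 c1 z1 _ _ ht).
      by move=> s s0; have [? _ _] := hd p s Pp s0.
    move=> s hs; have [_ h2 _ _] := bnd s hs; have := b0 s; rewrite KE; lra.
  - apply: (path_bound (f := Q^~ p) (df := fun s => - Z s (A p) + H s (A p) - Q s (B p)) l0 K0 c2 z2 _ _ ht).
      by move=> s s0; have [_ ? _] := hd p s Pp s0.
    move=> s hs; have [h1 _ h3 h4] := bnd s hs; rewrite KE.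
    apply: le_trans (le_normcD _ _) _; rewrite normcN.
    by have := le_normcD (- Z s (A p)) (H s (A p)); rewrite normcN; lra.
  - apply: (path_bound (f := H^~ p) (df := fun s => - H s (A p) - Q s (A p)) l0 K0 c3 z3 _ _ ht).
      by move=> s s0; have [_ _ ?] := hd p s Pp s0.
    move=> s hs; have [_ h2 h3 _] := bnd s hs; have := b0 s; rewrite KE => b0s.
    by apply: le_trans (le_normcD _ _) _; rewrite !normcN; lra.
move=> p t Pp ht.
have lim (w : C) : (forall k, normc w <= M * N p * 2^-1 ^+ k * expR (lam * t)) -> w = 0.
  move=> hw; apply/eqP; rewrite -normc_eq0; apply/eqP.
  have h : (M * N p * 2^-1 ^+ k * expR (lam * t)) @[k --> \oo] --> (0 : R).
    have g : (2^-1 : R) ^+ k @[k --> \oo] --> (0 : R).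
      by apply: cvg_expr; rewrite ger0_norm// invf_lt1// ltr1n.
    have := cvgM (cvgM (cvg_cst (M * N p)) g) (cvg_cst (expR (lam * t))).
    by rewrite mulr0 mul0r; apply.
  by apply: (cst_le_cvg0 _ h) => k; rewrite ger0_norm ?normc_ge0.
by split; apply: lim => k; have [] := half k p t Pp ht.
Qed.

End paths.

(** * Paths of distributions tested against Schwartz functions *)

Section distribution_paths.
Context {R : realType} {n : nat}.
Local Notation C := R[i].
Local Notation E := 'rV[R]_n.
Local Notation mu := (leb R n).
Implicit Types (f g phi psi : E -> C) (T S : distr R n) (u : R -> distr R n).

Lemma nE_sub_le f g : sqE f -> sqE g ->
  `|nE f - nE g| <= nE (fun x => f x - g x) +
     2 * (Num.sqrt (nE (fun x => f x - g x)) * Num.sqrt (nE g)).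
Proof.
move=> sf sg; have sd : sqE (fun x => f x - g x) by exact: sqiB.
have e := nrm2DE sd sg.
have -> : nE f = nrm2 mu (fun t => f (point t) - g (point t) + g (point t)).
  by rewrite /nE; congr nrm2; apply/funext => t; rewrite subrK.
rewrite e -/(nE g) addrK; apply: le_trans (ler_normD _ _) _.
rewrite ger0_norm ?nrm2_ge0// lerD2l normrM ger0_norm// ler_wpM2l//.
apply: le_trans (Re_le_normc _) _.
apply: le_trans (cauchy_schwarz sd (sqiJ sg)) _.
by rewrite nrm2J.
Qed.

(** Both facts are Cauchy-Schwarz. The bound uniform in time is the maximum over the segment of the
    L2 norm of the representative, which is continuous by [nE_sub_le]. *)
Lemma C_L2_pairing u : C_L2 u ->
  (forall phi, schwartz phi -> ccont (u^~ phi)) /\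
  (forall T : R, 0 <= T -> exists2 M, 0 <= M & forall t phi, 0 <= t <= T -> schwartz phi ->
     normc (u t phi) <= M * Num.sqrt (nE phi)).
Proof.
move=> [f hf cf].
have sf t : 0 <= t -> sqE (f t) by move=> t0; apply/L2_sqE; exact: (hf t t0).1.
have uE t phi : 0 <= t -> schwartz phi ->
    u t phi = cI mu (fun r => f t (point r) * phi (point r)).
  by move=> t0 sphi; exact: (hf t t0).2.
pose d s t := Num.sqrt (nE (fun x => f s x - f t x)).
have cd t : 0 <= t -> d s t @[s --> within halfline (nbhs t)] --> (0 : R).
  move=> t0; have /fine_cvg h := cf t t0.
  apply: cvg_trans h; apply: near_eq_cvg.
  apply: filterS (@withinT _ (nbhs t) halfline _) => s s0.
  by rewrite /= L2normE//; apply: sqiB; exact: sf.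
split.
  move=> phi sphi t t0; have s1 := schwartz_sqi sphi.
  have h : (d s t * Num.sqrt (nE phi)) @[s --> within halfline (nbhs t)] --> (0 : R).
    by have := cvgM (cd t t0) (cvg_cst (Num.sqrt (nE phi))); rewrite mul0r; apply.
  apply: squeeze_cvgr (cvg_cst 0) h.
  apply: filterS (@withinT _ (nbhs t) halfline _) => s s0.
  rewrite normc_ge0 /= !uE// -cIB; [|by apply: sqiM => //; exact: sf..].
  rewrite (eq_cI _ (g := fun r => (f s (point r) - f t (point r)) * phi (point r))).
    by apply: cauchy_schwarzE => //; apply: sqiB; exact: sf.
  by move=> r; rewrite mulrBl.
move=> T T0.
have cN : {within `[0, T], continuous (fun t => nE (f t))}.
  apply: within_continuous_path => t t0.
  have h : (d s t ^+ 2 + 2 * (d s t * Num.sqrt (nE (f t)))) @[s --> within halfline (nbhs t)] --> (0 : R).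
    have := cvgD (cvgM (cd t t0) (cd t t0)) (cvgM (cvg_cst (2 : R)) (cvgM (cd t t0) (cvg_cst (Num.sqrt (nE (f t)))))).
    by rewrite !mul0r mulr0 addr0; apply.
  apply: squeeze_cvgr (cvg_cst 0) h.
  apply: filterS (@withinT _ (nbhs t) halfline _) => s s0.
  rewrite normr_ge0 /= /d sqr_sqrtr ?nrm2_ge0//.
  exact: nE_sub_le (sf s s0) (sf t t0).
have [c _ hc] := EVT_max T0 cN.
exists (Num.sqrt (nE (f c))); first exact: sqrtr_ge0.
move=> t phi ht sphi; have t0 : 0 <= t by case/andP: ht.
rewrite uE//; apply: le_trans (cauchy_schwarzE (sf t t0) (schwartz_sqi sphi)) _.
by rewrite ler_wpM2r ?sqrtr_ge0// ler_wsqrtr// hc// in_itv.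
Qed.

(** At a positive time any sequence tending to it is eventually in the half-line, so the derivative
    along the half-line is an ordinary two-sided one. *)
Lemma seq_within_halfline (t : R) (h : nat -> R) : 0 < t ->
  (forall k, h k != 0) -> h k @[k --> \oo] --> (0 : R) ->
  (t + h k) @[k --> \oo] --> within halfline t^'.
Proof.
move=> t0 hn h0.
have ht : (t + h k) @[k --> \oo] --> t.
  by have := cvgD (cvg_cst t) h0; rewrite addr0; apply.
move=> P hP.
have hP' : nbhs t [set s | s != t -> halfline s -> P s] by exact: hP.
have p0 : nbhs t [set s : R | 0 < s] by exact: lt_nbhsr.
have : \forall k \near \oo, (t + h k != t -> halfline (t + h k) -> P (t + h k)) /\ 0 < t + h k.
  exact: (ht _ (filterI hP' p0)).
apply: filterS => k [hk k0]; apply: hk; last exact: ltW.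
by rewrite -subr_eq0 addrC addKr.
Qed.

Lemma is_tderiv_cder u (t : R) S phi : 0 < t -> is_tderiv u t S -> schwartz phi ->
  cder (u^~ phi) t (S phi).
Proof.
move=> t0 uS sphi; have H := uS phi sphi.
have key (p : C -> R) : (forall a b, p (a - b) = p a - p b) ->
    (forall (a : R) b, p (a%:C * b) = a * p b) -> (forall a, `|p a| <= normc a) ->
    is_derive t 1 (fun s => p (u s phi)) (p (S phi)).
  move=> pB pZ pn.
  have h : (fun h : R => h^-1 *: (((fun s => p (u s phi)) \o shift t) (h *: 1) - p (u t phi)))
      @ 0^' --> p (S phi).
    apply/cvgr_dnbhsP => k [kn k0]; apply/subr_cvg0; apply/norm_cvg0P.
    have := cvg_comp _ _ (seq_within_halfline t0 kn k0) H.
    apply: squeeze_cvgr (cvg_cst 0); apply: nearW => j; rewrite normr_ge0 /=.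
    apply: le_trans (pn _); rewrite pB pZ pB scaleRE [k j *: 1]mulr1.
    by rewrite [t + k j]addrC addrK.
  by split; [apply/cvg_ex; exists (p (S phi))|exact/cvg_lim].
split; apply: key.
- by move=> a b; rewrite ReD ReN.
- by move=> a b; rewrite ReM /= mul0r subr0.
- exact: Re_le_normc.
- by move=> a b; rewrite ImD ImN.
- by move=> a b; rewrite ImM /= mul0r addr0.
- exact: Im_le_normc.
Qed.

Section tempered_linear.
Variable T : distr R n.
Hypothesis tT : tempered T.

Lemma temperedB phi psi : schwartz phi -> schwartz psi ->
  T (fun x => phi x - psi x) = T phi - T psi.
Proof.
move=> sphi spsi; have := tT.1 (-1) psi phi spsi sphi.
rewrite mulN1r addrC => <-; congr T.
by apply/funext => x; rewrite mulN1r addrC.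
Qed.

Lemma temperedN phi : schwartz phi -> T (fun x => -1 * phi x) = - T phi.
Proof.
move=> sphi; have h0 : T (fun=> 0) = 0.
  have e : (fun _ : E => 0 - 0 : C) = (fun=> 0) by apply/funext => x; rewrite subrr.
  by have := temperedB (@schwartz0 R n) (@schwartz0 R n); rewrite e subrr.
have := tT.1 (-1) phi (fun=> 0) sphi (@schwartz0 R n); rewrite h0 addr0 mulN1r => <-.
by congr T; apply/funext => x; rewrite addr0.
Qed.

Lemma tempered_laplacian psi : schwartz psi ->
  T (laplacian (fourier psi)) = - T (fourier (fun x => (rr x)%:C * psi x)).
Proof.
move=> spsi; have sr := schwartz_sqnorm spsi.
rewrite laplacian_fourier_rr// -temperedN; last exact: fourier_schwartz.
by congr T; rewrite fourierZ.
Qed.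

(** When the product with the symbol is a Schwartz function, as for band-limited [psi], both
    alternatives of [is_multiplier] give the same identity. *)
Lemma is_fracLap_pairing sigma S psi : is_fracLap sigma T S -> schwartz psi ->
  schwartz (fun x => (mm sigma x)%:C * psi x) ->
  S (fourier psi) = T (fourier (fun x => (mm sigma x)%:C * psi x)).
Proof.
move=> [[_ h] spsi _|[g [_ _ _ hT] [_ _ _ hS]] spsi sm]; first exact: h.
have -> : S (fourier psi) = distr_of (fun x => (mm sigma x)%:C * g x) psi by exact: hS.
rewrite -/(dfourier T _) (hT _ sm) /distr_of; congr cint; apply/funext => x; ring.
Qed.

End tempered_linear.

Section solution_modes.
Variables (sigma : R) (u0 u1 theta0 : distr R n) (u ut th z : R -> distr R n).
Hypothesis hu : solves_P sigma u0 u1 theta0 u ut th.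
Hypothesis hz : forall t : R, 0 <= t -> is_absD 2 (u t) (z t).
Hypotheses (cz : C_L2 z) (cut : C_L2 ut) (cth : C_L2 th).

(* [modeZ u] is [mode (|D|^2 u)]. *)
Definition modeZ (u : R -> distr R n) t psi := u t (fourier (fun x => (rr x)%:C * psi x)).
Definition mode (u : R -> distr R n) t psi := u t (fourier psi).

Lemma mode_ccont psi : schwartz psi ->
  [/\ ccont (modeZ u ^~ psi), ccont (mode ut ^~ psi) & ccont (mode th ^~ psi)].
Proof.
move=> spsi; have sf := fourier_schwartz spsi; split.
- move=> t t0; have [/(_ _ sf t t0) h _] := C_L2_pairing cz.
  apply: cvg_trans h; apply: near_eq_cvg.
  apply: filterS (@withinT _ (nbhs t) halfline _) => s s0.
  by rewrite /modeZ -(is_absD_pairing (hz s0) spsi) -(is_absD_pairing (hz t0) spsi).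
- exact: (C_L2_pairing cut).1.
- exact: (C_L2_pairing cth).1.
Qed.

Lemma mode_bound (T : R) : 0 <= T -> exists2 M : R, 0 <= M &
  forall psi t, schwartz psi -> 0 <= t <= T ->
    [/\ normc (modeZ u t psi) <= M * Num.sqrt (nE psi),
        normc (mode ut t psi) <= M * Num.sqrt (nE psi) &
        normc (mode th t psi) <= M * Num.sqrt (nE psi)].
Proof.
move=> T0; have [_ /(_ T T0) [M1 M10 h1]] := C_L2_pairing cz.
have [_ /(_ T T0) [M2 M20 h2]] := C_L2_pairing cut.
have [_ /(_ T T0) [M3 M30 h3]] := C_L2_pairing cth.
pose K : R := Num.sqrt ((2 * pi) ^+ n); have K0 : 0 <= K by exact: sqrtr_ge0.
have fE psi : schwartz psi -> Num.sqrt (nE (fourier psi)) = K * Num.sqrt (nE psi).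
  move=> spsi; rewrite /nE plancherel// sqrtrM//.
  by rewrite exprn_ge0// mulr_ge0// ltW// pi_gt0.
exists ((M1 + M2 + M3) * K); first by rewrite mulr_ge0 ?addr_ge0.
move=> psi t spsi ht; have sf := fourier_schwartz spsi.
have t0 : 0 <= t by case/andP: ht.
have up (M : R) w : M <= M1 + M2 + M3 -> normc w <= M * Num.sqrt (nE (fourier psi)) ->
    normc w <= (M1 + M2 + M3) * K * Num.sqrt (nE psi).
  move=> hM /le_trans; apply; rewrite fE// mulrA ler_wpM2r ?sqrtr_ge0//.
  by rewrite ler_wpM2r.
split.
- rewrite /modeZ -(is_absD_pairing (hz t0) spsi).
  by apply: (up M1); [lra|exact: h1].
- by apply: (up M2); [lra|exact: h2].
- by apply: (up M3); [lra|exact: h3].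
Qed.

(** Testing against [fourier psi] turns the operators into multiplications of [psi] by their
    symbols; the system becomes one of ordinary differential equations coupling different test
    functions. *)
Lemma mode_cder psi t : schwartz psi -> schwartz (fun x => (mm sigma x)%:C * psi x) -> 0 < t ->
  [/\ cder (modeZ u ^~ psi) t (mode ut t (fun x => (rr x)%:C * psi x)),
      cder (mode ut ^~ psi) t (- modeZ u t (fun x => (rr x)%:C * psi x) +
        mode th t (fun x => (rr x)%:C * psi x) - mode ut t (fun x => (mm sigma x)%:C * psi x)) &
      cder (mode th ^~ psi) t (- mode th t (fun x => (rr x)%:C * psi x) -
        mode ut t (fun x => (rr x)%:C * psi x))].
Proof.
move=> spsi sm t0; have sr := schwartz_sqnorm spsi; have sf := fourier_schwartz spsi.
have [ht du de _] := hu; have [tu tut tth] := ht t (ltW t0).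
split.
- by apply: is_tderiv_cder t0 (du t (ltW t0)) _; exact: fourier_schwartz.
- have [utt [tht [w [d1 _ fw e1 _]]]] := de t t0.
  have := is_tderiv_cder t0 d1 sf; congr cder.
  have := e1 _ sf; rewrite /dlaplacian fourier_bilaplacian// tempered_laplacian//.
  rewrite (is_fracLap_pairing fw spsi sm) /modeZ /mode => /eqP.
  rewrite -!addrA addr_eq0 => /eqP ->; ring.
- have [utt [tht [w [_ d2 _ _ e2]]]] := de t t0.
  have := is_tderiv_cder t0 d2 sf; congr cder.
  have := e2 _ sf; rewrite /dlaplacian !tempered_laplacian// /mode => /eqP.
  rewrite -!addrA addr_eq0 => /eqP ->; ring.
Qed.

Lemma mode_initial psi : schwartz psi ->
  [/\ modeZ u 0 psi = u0 (fourier (fun x => (rr x)%:C * psi x)),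
      mode ut 0 psi = u1 (fourier psi) & mode th 0 psi = theta0 (fourier psi)].
Proof.
move=> spsi; have [_ _ _ [h1 h2 h3]] := hu.
by split; [apply: h1|apply: h2|apply: h3]; apply: fourier_schwartz => //; exact: schwartz_sqnorm.
Qed.

End solution_modes.

End distribution_paths.

(** * Comparison of two solutions *)

Section uniqueness.
Context {R : realType} {n : nat}.
Local Notation C := R[i].
Local Notation E := 'rV[R]_n.
Implicit Types (phi psi : E -> C).

(** The path u itself is not assumed continuous in L2; continuity of its pairings up to time 0 comes
    from the derivative along the half-line, and [path_bound] requires it. *)
Lemma is_tderiv_ccont (u ut : R -> distr R n) phi : schwartz phi ->
  (forall t : R, 0 <= t -> is_tderiv u t (ut t)) -> ccont (u^~ phi).
Proof.
move=> sphi hu t t0; have H := hu t t0 phi sphi.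
set q := fun s => normc ((s - t)^-1%:C * (u s phi - u t phi) - ut t phi) in H.
have c1 : `|s - t| @[s --> within halfline t^'] --> (0 : R).
  apply: cvg_within_filter; apply/norm_cvg0P; apply/subr_cvg0.
  exact: (@nbhs_dnbhs _ t).
have c2 : (`|s - t| * (q s + normc (ut t phi))) @[s --> within halfline t^'] --> (0 : R).
  have := cvgM c1 (cvgD H (cvg_cst (normc (ut t phi)))).
  by rewrite mul0r; apply.
have le s : normc (u s phi - u t phi) <= `|s - t| * (q s + normc (ut t phi)).
  have [->|st] := eqVneq s t; first by rewrite subrr normc0 subrr normr0 mul0r.
  have st0 : s - t != 0 by rewrite subr_eq0.
  have e : u s phi - u t phi = (s - t)%:C * ((s - t)^-1%:C * (u s phi - u t phi)).
    by rewrite mulrA -rmorphM mulfV// mul1r.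
  rewrite {1}e normcM normcR ler_wpM2l//.
  have := le_normcD ((s - t)^-1%:C * (u s phi - u t phi) - ut t phi) (ut t phi).
  by rewrite subrK.
apply/cvgrPdist_lt => e e0; have /cvgrPdist_lt /(_ e e0) h := c2.
have h' : nbhs t [set s | s != t -> halfline s ->
   `|0 - `|s - t| * (q s + normc (ut t phi))| < e] by exact: h.
change (nbhs t [set s | halfline s -> `|0 - normc (u s phi - u t phi)| < e]).
apply: filterS h' => s hs s0; rewrite sub0r normrN ger0_norm ?normc_ge0//.
have [->|st] := eqVneq s t; first by rewrite subrr normc0.
by apply: le_lt_trans (le s) (le_lt_trans (ler_norm _) _); have := hs st s0; rewrite sub0r normrN.
Qed.

Lemma modeB (u : R -> distr R n) t phi psi : tempered (u t) -> schwartz phi -> schwartz psi ->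
  mode u t (fun x => phi x - psi x) = mode u t phi - mode u t psi.
Proof.
move=> tu sphi spsi.
rewrite /mode -(temperedB tu)//; try exact: fourier_schwartz.
congr (u t _); have := fourierZD (-1) spsi sphi.
rewrite (_ : (fun x => -1 * psi x + phi x) = (fun x => phi x - psi x)); last first.
  by apply/funext => x; rewrite mulN1r addrC.
by move=> ->; apply/funext => x; rewrite mulN1r addrC.
Qed.

Variables (sigma : R) (u0 u1 theta0 : distr R n).
Hypotheses (n1 : (1 <= n)%N) (s0 : 0 <= sigma).
Variables (u ut th v vt eta : R -> distr R n).
Hypothesis hu : [/\ solves_P sigma u0 u1 theta0 u ut th, C_H2dot u, C_L2 ut & C_L2 th].
Hypothesis hv : [/\ solves_P sigma u0 u1 theta0 v vt eta, C_H2dot v, C_L2 vt & C_L2 eta].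

Lemma blim_modes_vanish (a b l : R) psi t : 0 < a -> 0 <= b -> 0 < l -> blim a b l psi -> 0 <= t ->
  mode vt t psi = mode ut t psi /\ mode eta t psi = mode th t psi.
Proof.
move=> a0 b0 l0 bpsi t0.
have [su [zu hzu czu] cut cth] := hu; have [sv [zv hzv czv] cvt ceta] := hv.
have [Mu Mu0 hMu] := mode_bound hzu czu cut cth t0.
have [Mv Mv0 hMv] := mode_bound hzv czv cvt ceta t0.
(* Bounds both symbols on the annulus; the added 1 makes it positive in all cases. *)
pose c := b + b `^ sigma + 1.
have c0 : 0 < c by rewrite /c ltr_wpDl// addr_ge0// powR_ge0.
have M0 : 0 <= Mu + Mv by rewrite addr_ge0.
have sB (q : E -> C) : blim a b l q -> schwartz q by exact: blim_schwartz.
have rB (q : E -> C) : blim a b l q -> blim a b l (fun x => (rr x)%:C * q x) by exact: blim_rr.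
have mB (q : E -> C) : blim a b l q -> blim a b l (fun x => (mm sigma x)%:C * q x).
  exact: blim_mm.
have up (w z : C) Nu Nv N' : normc w <= Nu * N' -> normc z <= Nv * N' ->
    normc (w - z) <= (Nv + Nu) * N'.
  move=> hw hz'; apply: le_trans (le_normcD _ _) _; rewrite normcN; lra.
have H : forall p s, blim a b l p -> 0 <= s <= t -> [/\ modeZ v s p - modeZ u s p = 0,
    mode vt s p - mode ut s p = 0 & mode eta s p - mode th s p = 0].
  apply: (@modes_vanish R (E -> C) (blim a b l) (fun p x => (rr x)%:C * p x)
    (fun p x => (mm sigma x)%:C * p x) (fun p => Num.sqrt (nE p))
    (fun s p => modeZ v s p - modeZ u s p) (fun s p => mode vt s p - mode ut s p)
    (fun s p => mode eta s p - mode th s p) c (Mu + Mv) t c0 M0).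
  - exact: rB.
  - exact: mB.
  - by move=> p; exact: sqrtr_ge0.
  - move=> p bp; have sp := sB _ bp; have srp := sB _ (rB _ bp).
    apply: nE_le; [exact: ltW|exact: schwartz_sqi|exact: schwartz_sqi|] => x.
    apply: le_trans (blim_rr_le b0 l0 bp x) _.
    by rewrite ler_wpM2r ?normc_ge0// /c -addrA lerDl addr_ge0// powR_ge0.
  - move=> p bp; have sp := sB _ bp; have smp := sB _ (mB _ bp).
    apply: nE_le; [exact: ltW|exact: schwartz_sqi|exact: schwartz_sqi|] => x.
    apply: le_trans (blim_mm_le b0 l0 s0 bp x) _.
    by rewrite ler_wpM2r ?normc_ge0// /c addrAC lerDr addr_ge0.
  - move=> p /sB sp; have [a1 a2 a3] := mode_ccont hzu czu cut cth sp.
    have [b1 b2 b3] := mode_ccont hzv czv cvt ceta sp.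
    by split; exact: ccontB.
  - move=> p /sB sp; have [-> -> ->] := mode_initial su sp.
    by have [-> -> ->] := mode_initial sv sp; rewrite !subrr.
  - move=> p s bp sp; have smp := sB _ (mB _ bp); have /sB sp' := bp.
    have [a1 a2 a3] := mode_cder su sp' smp sp; have [b1 b2 b3] := mode_cder sv sp' smp sp.
    split; first exact: cderB.
      by have := cderB b2 a2; congr cder; ring.
    by have := cderB b3 a3; congr cder; ring.
  - move=> p s /sB sp hs; have [a1 a2 a3] := hMu p s sp hs; have [b1 b2 b3] := hMv p s sp hs.
    by split; [exact: up b1 a1|exact: up b2 a2|exact: up b3 a3].
have [|_ /eqP + /eqP] := H psi t bpsi; first by rewrite t0 lexx.
by rewrite !subr_eq0 => /eqP -> /eqP ->.
Qed.

Lemma modes_unique psi t : schwartz psi -> 0 <= t ->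
  mode vt t psi = mode ut t psi /\ mode eta t psi = mode th t psi.
Proof.
move=> spsi t0.
have [su [zu hzu czu] cut cth] := hu; have [sv [zv hzv czv] cvt ceta] := hv.
have [Mu Mu0 hMu] := mode_bound hzu czu cut cth t0.
have [Mv Mv0 hMv] := mode_bound hzv czv cvt ceta t0.
have [hau _ _ _] := su; have [hav _ _ _] := sv.
have [_ tut tth] := hau t t0; have [_ tvt teta] := hav t t0.
have tt : 0 <= t <= t by rewrite t0 lexx.
pose p k : E -> C := fun x => (cutoff k (rr x))%:C * psi x.
have bp k : blim k.+1%:R^-1 k.+1%:R k.+1%:R (p k) by exact: cutoff_blim.
have ip k : 0 < k.+1%:R^-1 :> R by rewrite invr_gt0 ltr0n.
have kp k : 0 < k.+1%:R :> R by rewrite ltr0n.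
have sp k : schwartz (p k) by apply: (blim_schwartz _ _ (bp k)).
have sd k : schwartz (fun x => psi x - p k x) by exact: schwartzB.
(* Stated for two abstract families so as to serve the pairs [vt], [ut] and [eta], [th]: they agree
   on the cut-off functions and are bounded in the L2 norm of the remainder, which tends to 0. *)
have lim (x y : R -> (E -> C) -> C) :
    (forall k, x t (fun z => psi z - p k z) = x t psi - x t (p k)) ->
    (forall k, y t (fun z => psi z - p k z) = y t psi - y t (p k)) ->
    (forall k, x t (p k) = y t (p k)) ->
    (forall q, schwartz q -> normc (x t q) <= Mv * Num.sqrt (nE q)) ->
    (forall q, schwartz q -> normc (y t q) <= Mu * Num.sqrt (nE q)) -> x t psi = y t psi.
  move=> xB yB xy bx by_; apply/eqP; rewrite -subr_eq0 -normc_eq0; apply/eqP.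
  have h : ((Mv + Mu) * Num.sqrt (nE (fun z => psi z - p k z))) @[k --> \oo] --> (0 : R).
    by apply: cvgZ0; apply: cvg_sqrt0; exact: cutoff_dense.
  apply: (cst_le_cvg0 _ h) => k; rewrite ger0_norm ?normc_ge0//.
  have -> : x t psi - y t psi = x t (fun z => psi z - p k z) - y t (fun z => psi z - p k z).
    by rewrite xB yB xy; ring.
  apply: le_trans (le_normcD _ _) _; rewrite normcN mulrDl.
  by apply: lerD; [exact: bx|exact: by_].
have V k := blim_modes_vanish (ip k) (ltW (kp k)) (kp k) (bp k) t0.
split; apply: lim.
- by move=> k; apply: modeB.
- by move=> k; apply: modeB.
- by move=> k; exact: (V k).1.
- by move=> q sq; have [_ ? _] := hMv q t sq tt.
- by move=> q sq; have [_ ? _] := hMu q t sq tt.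
- by move=> k; apply: modeB.
- by move=> k; apply: modeB.
- by move=> k; exact: (V k).2.
- by move=> q sq; have [_ _ ?] := hMv q t sq tt.
- by move=> q sq; have [_ _ ?] := hMu q t sq tt.
Qed.

Lemma solution_unique t : 0 <= t ->
  [/\ eqd (v t) (u t), eqd (vt t) (ut t) & eqd (eta t) (th t)].
Proof.
move=> t0.
have e r phi : 0 <= r -> schwartz phi -> vt r phi = ut r phi /\ eta r phi = th r phi.
  move=> r0 sphi; have := modes_unique (finv_schwartz sphi) r0.
  by rewrite /mode finvK.
split; [|by move=> phi sphi; exact: (e t phi t0 sphi).1|
         by move=> phi sphi; exact: (e t phi t0 sphi).2].
move=> phi sphi.
have [[_ du _ [iu _ _]] _ _ _] := hu; have [[_ dv _ [iv _ _]] _ _ _] := hv.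
have cf := ccontB (is_tderiv_ccont sphi dv) (is_tderiv_ccont sphi du).
apply/eqP; rewrite -subr_eq0 -normc_eq0 eq_le normc_ge0 andbT.
(* Zero is written as the bound of [path_bound] with [K = 0] and [lambda = 1]: the difference of
   u-components has zero derivative once [vt] and [ut] agree. *)
have -> : (0 : R) = 2 * (0 / 1 * expR (1 * t)) by rewrite mul0r mul0r mulr0.
apply: (path_bound (f := fun s => v s phi - u s phi) (df := fun s => vt s phi - ut s phi)
  (T := t) ltr01 (lexx 0) cf).
- by rewrite iv// iu// subrr.
- move=> s sp; apply: cderB.
    by apply: is_tderiv_cder => //; exact: dv (ltW sp).
  by apply: is_tderiv_cder => //; exact: du (ltW sp).
- move=> s /andP[sp _]; rewrite (e s phi (ltW sp) sphi).1 subrr normc0 mul0r//.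
- by rewrite t0 lexx.
Qed.

End uniqueness.

Lemma inL2_fourier (R : realType) (n : nat) (T : distr R n) : inL2 T ->
  exists a, sqE a /\ forall phi, schwartz phi ->
    T (fourier phi) = cI (leb R n) (fun s => a (point s) * phi (point s)).
Proof.
move=> [f /L2_sqE sf hf]; have [a [sa ha]] := fourier_L2 sf.
by exists a; split => // phi sphi; rewrite hf; [exact: ha|exact: fourier_schwartz].
Qed.

Theorem theorem3p2 (R : realType) (n : nat) (sigma : R)
    (u0 u1 theta0 : distr R n) :
  (1 <= n)%N -> 0 <= sigma <= 2 ->
  tempered u0 ->
  (exists2 z0 : distr R n, is_absD 2 u0 z0 & inL2 z0) ->
  inL2 u1 -> inL2 theta0 ->
  exists u ut theta : R -> distr R n,
    [/\ solves_P sigma u0 u1 theta0 u ut theta,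
        C_H2dot u, C_L2 ut & C_L2 theta] /\
    forall v vt eta : R -> distr R n,
      [/\ solves_P sigma u0 u1 theta0 v vt eta,
          C_H2dot v, C_L2 vt & C_L2 eta] ->
      forall t : R, 0 <= t ->
        [/\ eqd (v t) (u t), eqd (vt t) (ut t) & eqd (eta t) (theta t)].
Proof.
move=> n1 hs tu0 [z0 hz /inL2_fourier [a0 [sa0 h0]]].
move=> /inL2_fourier [a1 [sa1 h1]] /inL2_fourier [a2 [sa2 h2]].
exists (exU sigma a0 a1 a2 u0), (exP sigma a0 a1 a2 sV), (exP sigma a0 a1 a2 sH).
have hE : [/\ solves_P sigma u0 u1 theta0 (exU sigma a0 a1 a2 u0)
      (exP sigma a0 a1 a2 sV) (exP sigma a0 a1 a2 sH), C_H2dot (exU sigma a0 a1 a2 u0),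
    C_L2 (exP sigma a0 a1 a2 sV) & C_L2 (exP sigma a0 a1 a2 sH)].
  apply: existence => // phi sphi.
  - by rewrite -(is_absD_pairing hz sphi) h0.
  - by rewrite -h1 ?finvK//; exact: finv_schwartz.
  - by rewrite -h2 ?finvK//; exact: finv_schwartz.
split=> // v vt eta hv t t0.
by have /andP[s0 _] := hs; exact: (solution_unique n1 s0 hE hv).
Qed.
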